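(* Suppose that $(\mathcal{A},\mathcal{B},E,E')$ is an operator-valued infinitesimal probability space, let $\{r^{\mathcal{B}}_n\}_{n\ge1}$, $\{\beta^{\mathcal{B}}_n\}_{n\ge1}$, $\{h^{\mathcal{B}}_n\}_{n\ge1}$ be the families of free, Boolean and monotone operator-valued cumulants, and let $\{\partial r^{\mathcal{B}}_n\}_{n\ge1}$, $\{\partial\beta^{\mathcal{B}}_n\}_{n\ge1}$, $\{\partial h^{\mathcal{B}}_n\}_{n\ge1}$ be the families of free, Boolean and monotone operator-valued infinitesimal cumulants. Then the following relations hold for every $n$: $$\partial\beta^{\mathcal{B}}_n=\sum_{\pi\in\mathcal{NC}_{irr}(n)}\partial r^{\mathcal{B}}_\pi,\qquad \partial r^{\mathcal{B}}_n=\sum_{\pi\in\mathcal{NC}_{irr}(n)}(-1)^{|\pi|-1}\partial\beta^{\mathcal{B}}_\pi,$$ $$\partial\beta^{\mathcal{B}}_n=\sum_{\pi\in\mathcal{NC}_{irr}(n)}\frac{1}{\tau(\pi)!}\,\partial h^{\mathcal{B}}_\pi,\qquad \partial r^{\mathcal{B}}_n=\sum_{\pi\in\mathcal{NC}_{irr}(n)}\frac{(-1)^{|\pi|-1}}{\tau(\pi)!}\,\partial h^{\mathcal{B}}_\pi,$$ $$\partial h^{\mathcal{B}}_n=\sum_{\pi\in\mathcal{NC}_{irr}(n)}\omega(\pi)\,\partial\beta^{\mathcal{B}}_\pi,\qquad \partial h^{\mathcal{B}}_n=\sum_{\pi\in\mathcal{NC}_{irr}(n)}(-1)^{|\pi|-1}\omega(\pi)\,\partial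 r^{\mathcal{B}}_\pi.$$
   Context: Operator-valued infinitesimal probability space: a unital algebra $\mathcal{A}$, a unital subalgebra $\mathcal{B}$, linear maps $E,E':\mathcal{A}\to\mathcal{B}$ with $E(b)=b$, $E(bab')=bE(a)b'$, $E'(1)=0$, $E'(bab')=bE'(a)b'$ for $a\in\mathcal{A}$, $b,b'\in\mathcal{B}$. Partitions. $NC(n)$ is the lattice of non-crossing partitions of $[n]=\{1,\dots,n\}$, ordered by $\sigma\le\pi$ iff every block of $\sigma$ is contained in a block of $\pi$; $1_n$ is the one-block partition, $|\pi|$ the number of blocks, $\mathrm{Mob}$ the Möbius function of $NC(n)$. $\mathcal{I}(n)\subset NC(n)$ is the set of interval partitions. $\mathcal{NC}_{irr}(n)$ is the set of irreducible non-crossing partitions, i.e. those $\pi\in NC(n)$ with $1$ and $n$ in the same block. Set $\tau(\pi)!=\prod_{V\in\pi}\big|\{W\in\pi: W\subset[\min V,\max V]\}\big|$. For $\pi\in\mathcal{NC}_{irr}(n)$, $\omega_k(\pi)$ is the number of increasing $k$-colorings of $\pi$, that is, the number of ways $f$ of decorating the blocks of $\pi$ with elements of the set $[k]$ in such a way that $f(V)<f(W)$ whenever the block $V$ is nested inside the block $W$; and $\omega(\pi)=\sum_{k=1}^n\frac{(-1)^{k+1}}{k}\omega_k(\pi)$. Extension to partitions. Given a sequence of multilinear maps $f_n:\mathcal{A}^n\to\mathcal{B}$, $n\ge1$, define $f_\pi:\mathcal{A}^n\to\mathcal{B}$ for $\pi\in NC(n)$ recursively: $f_{1_n}=f_n$;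 otherwise pick an interval block $V=\{l+1,\dots,l+k\}\in\pi$, let $\pi'=\pi\setminus V\in NC(n-k)$ be obtained by deleting $V$, and set $$f_\pi(x_1,\dots,x_n)=f_{\pi'}(x_1,\dots,x_l f_k(x_{l+1},\dots,x_{l+k}),x_{l+k+1},\dots,x_n)$$ (if $l=0$, the factor $f_k(\cdot)$ multiplies $x_{k+1}$ from the left); the result does not depend on the choice of $V$ for the families used here. Given a second sequence $(\partial f_n)_{n\ge1}$ and $V\in\pi$, $\partial f_{\pi,V}$ is defined by the same recursion as $f_\pi$, except that for the block $V$ the map $f_{|V|}$ is replaced by $\partial f_{|V|}$; and $\partial f_\pi=\sum_{V\in\pi}\partial f_{\pi,V}$. In particular $E_\pi$ and $\partial E_\pi$ come from $E_n(x_1,\dots,x_n)=E(x_1\cdots x_n)$ and $\partial E_n(x_1,\dots,x_n)=E'(x_1\cdots x_n)$. Cumulants. $r^{\mathcal{B}}_n,\beta^{\mathcal{B}}_n,h^{\mathcal{B}}_n:\mathcal{A}^n\to\mathcal{B}$ are determined recursively by requiring, for all $n$ and all arguments, $$E_n=\sum_{\pi\in NC(n)}r^{\mathcal{B}}_\pi,\qquad E_n=\sum_{\pi\in\mathcal{I}(n)}\beta^{\mathcal{B}}_\pi,\qquad E_n=\sum_{\pi\in NC(n)}\frac{1}{\tau(\pi)!}h^{\mathcal{B}}_\pi.$$ The infinitesimal cumulants $\partial r^{\mathcal{B}}_n,\partial\beta^{\mathcal{B}}_n,\partial h^{\mathcal{B}}_n:\mathcal{A}^n\to\mathcal{B}$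 are defined by $$\partial r^{\mathcal{B}}_n=\sum_{\pi\in NC(n)}\mathrm{Mob}(\pi,1_n)\,\partial E_\pi,\qquad \partial\beta^{\mathcal{B}}_n=\sum_{\pi\in\mathcal{I}(n)}(-1)^{|\pi|-1}\partial E_\pi,$$ and (recursively) $E'(a_1\cdots a_n)=\sum_{\pi\in NC(n)}\frac{1}{\tau(\pi)!}\partial h^{\mathcal{B}}_\pi(a_1,\dots,a_n)$.
   Formalization: The increasing k-colorings counted by ω_k(π) are required to use all k colors; without this, ω of the one-block partition of [2] would be 0 and the relation for ∂h_2 would fail. *)

(* Defs.v *)
From HB Require Import structures.
From mathcomp Require Import all_boot all_order all_algebra.

Set Implicit Arguments.
Unset Strict Implicit.
Unset Printing Implicit Defensive.

Import Order.TTheory GRing.Theory Num.Theory.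
Local Open Scope ring_scope.

Section Mobius.
Variables (T : finType) (P : {set T}) (le : rel T).

(* mu(x, x) = 1 and mu(x, y) = - \sum_(x <= z < y) mu(x, z), over z in P;
   m is fuel, and #|P| is enough (see mobius_sum below). *)
Fixpoint mobius_rec (m : nat) (x y : T) : int :=
  if x == y then 1 else
  if m is m'.+1 then
    - \sum_(z in P | [&& le x z, le z y & z != y]) mobius_rec m' x z
  else 0.

Definition mobius (x y : T) : int := mobius_rec #|P| x y.

Hypothesis le_refl : {in P, reflexive le}.
Hypothesis le_anti : {in P &, antisymmetric le}.
Hypothesis le_trans : {in P & &, transitive le}.

Let strict_itv x y := [set z in P | [&& le x z, le z y & z != y]].

Lemma mobius_rec_fuel m m' x y : x \in P -> y \in P ->
  (#|strict_itv x y| <= m)%N -> (#|strict_itv x y| <= m')%N ->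
  mobius_rec m x y = mobius_rec m' x y.
Proof.
move=> xP; elim: m m' y => [|m IHm] [|m'] y yP //=.
- move=> /[!leqn0] /[!cards_eq0] /eqP I0 _; case: eqP => // _.
  rewrite big_pred0 ?oppr0 // => z; move/setP/(_ z): I0.
  by rewrite !inE.
- move=> _ /[!leqn0] /[!cards_eq0] /eqP I0; case: eqP => // _.
  rewrite big_pred0 ?oppr0 // => z; move/setP/(_ z): I0.
  by rewrite !inE.
move=> lem lem'; case: eqP => // _; congr (- _).
apply: eq_bigr => z /and4P[zP xz zy zny].
have ltI : (#|strict_itv x z| < #|strict_itv x y|)%N.
  apply/proper_card/properP; split.
    apply/subsetP => w; rewrite !inE => /and4P[wP xw wz wnz].
    rewrite wP xw (le_trans zP wP yP wz zy) /=.
    apply: contraNneq wnz => wy; rewrite wy in wz *.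
    by apply/eqP/(le_anti yP zP); rewrite wz zy.
  by exists z; rewrite !inE ?zP ?xz ?zy ?zny ?eqxx ?andbF.
by apply: IHm => //; rewrite -ltnS (leq_trans ltI).
Qed.

Lemma mobius_sum x y : x \in P -> y \in P -> le x y ->
  \sum_(z in P | le x z && le z y) mobius x z = (x == y)%:R.
Proof.
move=> xP yP xy; rewrite (bigD1 y) /= ?yP ?xy ?le_refl //.
have eqP' z : [&& z \in P, le x z & le z y] && (z != y)
            = (z \in P) && [&& le x z, le z y & z != y].
  by rewrite -!andbA.
rewrite (eq_bigl _ _ eqP').
have [<-|xny] := eqVneq x y.
  rewrite big_pred0 ?addr0; last first.
    move=> z; apply/and4P => -[zP xz zx] /eqP; apply.
    by apply: le_anti => //; rewrite xz zx.
  by rewrite /mobius; case: #|P| => [|k] /=; rewrite eqxx.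
have fuelS : mobius x y = mobius_rec #|P|.+1 x y.
  have leI : (#|strict_itv x y| <= #|P|)%N.
    by apply/subset_leq_card/subsetP => z /[!inE] /andP[].
  by apply: mobius_rec_fuel => //; apply: leqW.
by rewrite fuelS /= (negPf xny) addNr.
Qed.

End Mobius.

Section Partitions.
Variable n : nat.
Implicit Types (V W : {set 'I_n}) (pi sigma : {set {set 'I_n}}).

Definition crossing V W := [exists a in V, exists b in W, exists c in V,
  exists d in W, [&& a < b, b < c & c < d]%N].

Definition noncrossing pi :=
  [forall V in pi, forall W in pi, (V != W) ==> ~~ crossing V W].

Definition NC : {set {set {set 'I_n}}} :=
  [set pi | partition pi [set: 'I_n] & noncrossing pi].

Definition is_interval V :=
  [forall i in V, forall k in V, forall j : 'I_n, (i <= j <= k)%N ==> (j \in V)].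

Definition NCint : {set {set {set 'I_n}}} :=
  [set pi in NC | [forall V in pi, is_interval V]].

(* The first and last elements of [n] are i with i = 0 and i.+1 = n in 'I_n. *)
Definition NCirr : {set {set {set 'I_n}}} :=
  [set pi in NC | [exists V in pi,
     [forall i : 'I_n, ((i == 0%N :> nat) || (i.+1 == n)) ==> (i \in V)]]].

Definition refines sigma pi := [forall V in sigma, exists W in pi, V \subset W].

Definition one_part : {set {set 'I_n}} := [set [set: 'I_n]].

Definition Mob sigma pi : int := mobius NC refines sigma pi.

(* The interval [min V, max V]. *)
Definition hull V : {set 'I_n} :=
  [set i : 'I_n | [exists j in V, (j <= i)%N] && [exists k in V, (i <= k)%N]].

Definition tau_fact pi : nat :=
  (\prod_(V in pi) #|[set W in pi | W \subset hull V]|)%N.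

Definition nested V W := (V != W) && (V \subset hull W).

(* All k colours are used: omega below is then the Murua coefficient of the
   nesting forest of pi. *)
Definition increasing_coloring pi k (c : {ffun {V | V \in pi} -> 'I_k}) : bool :=
  [forall V, forall W, nested (val V) (val W) ==> (c V < c W)%N]
  && [forall j, exists V, c V == j].

Definition omega_k pi k : nat := #|[set c | @increasing_coloring pi k c]|.

Definition omega (K : fieldType) pi : K :=
  \sum_(1 <= k < n.+1) (-1) ^+ k.+1 / k%:R * (omega_k pi k)%:R.

End Partitions.

Section Extension.
Variables (K : fieldType) (A : algType K) (SB : {pred A}) (B : subAlgType SB).

(* A sequence of maps f_k : A^k -> B, k >= 1, is a function f : seq A -> B with
   f_k(x_1, ..., x_k) = f [:: x_1; ...; x_k]; the value f [::] plays no role. *)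

(* A partition is followed through the deletions by the word t of the block
   labels of the successive arguments x: the block labelled a is an interval
   block starting at position l when the letters a of t are consecutive and
   start at l. *)
Definition interval_block_at (T : eqType) (t : seq T) (l : nat) : bool :=
  if drop l t is a :: _ then
    take (count_mem a t) (drop l t) == nseq (count_mem a t) a
  else false.

(* (x_1, ..., x_l b, x_{l+k+1}, ...), or (b x_{k+1}, x_{k+2}, ...) if l = 0. *)
Definition absorb (l k : nat) (b : A) (x : seq A) : seq A :=
  if l is l'.+1 then take l' x ++ (nth 0 x l' * b) :: drop (l + k) x
  else (b * nth 0 x k) :: drop k.+1 x.

(* F a is the sequence of maps used for the block labelled a.  The interval
   block that is deleted is the leftmost one; m is fuel, and the number of
   arguments is enough since each step deletes at least one of them. *)
Fixpoint ext_word (T : eqType) (F : T -> seq A -> B) (m : nat)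
    (t : seq T) (x : seq A) : B :=
  match m, t with
  | m'.+1, a0 :: _ =>
    if constant t then F a0 x else
    let l := find (interval_block_at t) (iota 0 (size t)) in
    let a := nth a0 t l in
    let k := count_mem a t in
    ext_word F m' (take l t ++ drop (l + k) t)
      (absorb l k (val (F a (take k (drop l x)))) x)
  | _, _ => 0
  end.

Variable n : nat.
Implicit Types (pi : {set {set 'I_n}}) (V : {set 'I_n}) (x : n.-tuple A).

Definition ext_fam (F : {set 'I_n} -> seq A -> B) pi x : B :=
  ext_word F n [seq pblock pi i | i <- enum 'I_n] x.

Definition ext (f : seq A -> B) pi x : B := ext_fam (fun=> f) pi x.

Definition dext_at (f df : seq A -> B) pi V x : B :=
  ext_fam (fun W => if W == V then df else f) pi x.

Definition dext (f df : seq A -> B) pi x : B :=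
  \sum_(V in pi) dext_at f df pi V x.

End Extension.

Section Cumulants.
Variables (K : fieldType) (A : algType K) (SB : {pred A}) (B : subAlgType SB).

Record ov_inf_prob_space (E E' : {linear A -> B}) : Prop := OvInfProbSpace {
  ov_E_id : forall b : B, E (val b) = b;
  ov_E_bimod : forall (a : A) (b b' : B), E (val b * a * val b') = b * E a * b';
  ov_E'1 : E' 1 = 0;
  ov_E'_bimod : forall (a : A) (b b' : B),
    E' (val b * a * val b') = b * E' a * b' }.

Definition moments (E : A -> B) (x : seq A) : B := E (\prod_(a <- x) a).

Definition free_cumulants (E : A -> B) (r : seq A -> B) : Prop :=
  forall (n : nat) (x : n.-tuple A), (0 < n)%N ->
    moments E x = \sum_(pi in NC n) ext r pi x.

Definition boolean_cumulants (E : A -> B) (beta : seq A -> B) : Prop :=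
  forall (n : nat) (x : n.-tuple A), (0 < n)%N ->
    moments E x = \sum_(pi in NCint n) ext beta pi x.

Definition monotone_cumulants (E : A -> B) (h : seq A -> B) : Prop :=
  forall (n : nat) (x : n.-tuple A), (0 < n)%N ->
    moments E x = \sum_(pi in NC n) (tau_fact pi)%:R^-1 *: ext h pi x.

Definition dfree (E E' : A -> B) (x : seq A) : B :=
  \sum_(pi in NC (size x))
    (Mob pi (one_part (size x)))%:~R *:
      dext (moments E) (moments E') pi (in_tuple x).

Definition dboolean (E E' : A -> B) (x : seq A) : B :=
  \sum_(pi in NCint (size x))
    (-1) ^+ (#|pi|).-1 *: dext (moments E) (moments E') pi (in_tuple x).

Definition monotone_inf_cumulants (E' : A -> B) (h dh : seq A -> B) : Prop :=
  forall (n : nat) (x : n.-tuple A), (0 < n)%N ->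
    moments E' x = \sum_(pi in NC n) (tau_fact pi)%:R^-1 *: dext h dh pi x.

End Cumulants.

(* Main.v *)
(* Over the dual numbers K[eps] the pairs (E, E') form one operator-valued expectation
   a + eps a' |-> E a + eps (E' a + E a'), whose cumulants r + eps dr, beta + eps dbeta
   and h + eps dh carry the infinitesimal cumulants as their eps-components: the
   derivation rule defining (d f)_pi is the Leibniz rule in eps.  It is therefore enough
   to relate the three families of ordinary operator-valued cumulants and to read off
   the eps-component.

   The moments M = sum_NC r = sum_int beta = sum_NC h / tau! satisfy M = 1 / (1 - m)
   for the concatenation of words, where m is the sum over irreducible partitions;
   comparing irreducible parts expresses beta through r and h.  Summing products of
   moments over all subwords (the gaps between the letters being absorbed) gives a
   second, compositional product, in which sums over partitions compose by admissible
   cuts of nesting forests.  The inverse of M for it is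
   sum_int (-1)^|pi| r = sum_NC (-1)^|pi| beta = sum_NC (-1)^|pi| h / tau!, whose
   irreducible parts give the formulas for r.  The k-th power of M is both
   sum k^|pi| h / tau! and the sum of beta over partitions colored with k colors
   increasing along the nesting; its irreducible part is a polynomial in k, and the linear coefficient
   in k gives h in terms of beta with the weights omega, hence also in terms of r. *)

(* The cumulants are given as bare functions on sequences, without linearity or module properties,
   while trees and dual numbers call for both. So the given families are not lifted: families over
   the dual numbers are built recursively from the dual moments, inherit these properties from the
   expectation, and are then identified with the given ones, because a moment-cumulant formula
   determines its cumulants by induction on the number of arguments. The infinitesimal free and
   Boolean cumulants, being explicit sums, are matched with eps-components by Moebius inversion and
   by inverting 1 / (1 - m). Over dual numbers the inclusion of B in A becomes an induced morphism,
   so trees are evaluated along an arbitrary algebra morphism [v]. Trees make concatenation and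
   nesting structural recursions; the deletion recursion of the definitions is compared with them
   once, on words of block labels. The factor (-1)^(k+1) / k in omega is the linear coefficient in x
   of the binomial coefficient 'C(x, k): a coloring with x available colors amounts to a choice of
   the k colors in use and a coloring that uses all of them. *)
Require Import Defs.
From HB Require Import structures.
From mathcomp Require Import all_boot all_order all_algebra.
From mathcomp Require Import zify.
Import GRing.Theory.
Set Implicit Arguments.
Unset Strict Implicit.
Unset Printing Implicit Defensive.
Local Open Scope ring_scope.

(** * Binary trees as non-crossing partitions *)

(* A tree with n nodes encodes a non-crossing partition of n points: L is empty, and
   [N b s] is the irreducible component b of the first point followed by the partition
   s.  As a component (functions ending in B or R) a tree with n nodes has n + 1
   points: L is the last point of the outer block, and [N g b] is a point of that
   block, then the partition g of the gap up to its next point, then the rest b. *)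
Inductive bt : Type := L | N (l r : bt).

Fixpoint bt_eq (s t : bt) : bool :=
  match s, t with
  | L, L => true
  | N a b, N c d => bt_eq a c && bt_eq b d
  | _, _ => false
  end.

Lemma bt_eqP : Equality.axiom bt_eq.
Proof.
elim=> [|a IHa b IHb] [|c d] /=; try by constructor.
by apply: (iffP andP) => [[/IHa-> /IHb->]|[/IHa-> /IHb->]].
Qed.

HB.instance Definition _ := hasDecEq.Build bt bt_eqP.

Fixpoint bsz (t : bt) : nat := if t is N l r then (bsz l + bsz r).+1 else 0.

(** [m] is fuel, since neither part of a splitting of [n'] is a structural subterm; by [trsF_trs]
    any [m] of at least [n] gives the same list. *)
Fixpoint trsF (m n : nat) : seq bt :=
  match m, n with
  | m'.+1, n'.+1 =>
    flatten [seq allpairs N (trsF m' q) (trsF m' (n' - q)) | q <- iota 0 n'.+1]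
  | _, n'.+1 => [::]
  | _, 0 => [:: L]
  end.

Definition trs n := trsF n n.

Lemma trsFS m n : trsF m.+1 n.+1 =
  flatten [seq allpairs N (trsF m q) (trsF m (n - q)) | q <- iota 0 n.+1].
Proof. by []. Qed.

Lemma trsF_trs m n : (n <= m)%N -> trsF m n = trs n.
Proof.
rewrite /trs; elim/ltn_ind: n m => -[|n] IHn [|m] // lenm.
rewrite !trsFS; congr flatten; apply/eq_in_map => q; rewrite mem_iota => lt_q.
by rewrite !(IHn q) ?(IHn (n - q)%N) //; lia.
Qed.

Lemma trsS n : trs n.+1 =
  flatten [seq allpairs N (trs q) (trs (n - q)) | q <- iota 0 n.+1].
Proof.
rewrite {1}/trs trsFS; congr flatten; apply/eq_in_map => q.
by rewrite mem_iota => lt_q; rewrite !trsF_trs //; lia.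
Qed.

Lemma mem_trs n t : (t \in trs n) = (bsz t == n).
Proof.
elim/ltn_ind: n t => -[|n] IHn t; first by case: t.
rewrite trsS; apply/flatten_mapP/eqP => [[q]|].
  rewrite mem_iota => lt_q /allpairsP[[l r] /= [+ + ->]] /=.
  by rewrite !IHn; [move/eqP=> -> /eqP ->; lia | lia | lia].
case: t => [|l r] // E; have sz : (bsz l + bsz r = n)%N by case: E.
exists (bsz l); first by rewrite mem_iota; lia.
apply/allpairsP; exists (l, r) => /=.
by split => //; rewrite IHn; lia.
Qed.

Lemma uniq_trs n : uniq (trs n).
Proof.
elim/ltn_ind: n => -[|n] IHn //.
rewrite trsS.
have: uniq (iota 0 n.+1) by exact: iota_uniq.
have: {in iota 0 n.+1, forall q, (q <= n)%N}.
  by move=> q; rewrite mem_iota => /andP[_]; lia.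
elim: (iota 0 n.+1) => //= q s IHs leq /andP[nq us].
have leqn : (q <= n)%N by apply: leq; rewrite inE eqxx.
rewrite cat_uniq IHs ?andbT //; last by move=> p ps; apply: leq; rewrite inE ps orbT.
apply/andP; split.
  apply: allpairs_uniq; try (by apply: IHn; lia).
  by case=> a b [c d] _ _ /= [-> ->].
apply/hasPn => t /flatten_mapP[p ps] /allpairsP[[a b] /= [ap _ Et]]; rewrite Et.
apply/allpairsP => -[[c d] /= [cq _ [ac _]]].
move: ap cq; rewrite !mem_trs ac => /eqP-> /eqP E.
by rewrite -E ps in nq.
Qed.

Lemma big_trsS (V : nmodType) n (H : bt -> V) :
  \sum_(t <- trs n.+1) H t =
  \sum_(q < n.+1) \sum_(l <- trs q) \sum_(r <- trs (n - q)) H (N l r).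
Proof.
rewrite trsS big_flatten big_map -[iota 0 n.+1]/(index_iota 0 n.+1).
rewrite big_mkord; apply: eq_bigr => q _; rewrite big_flatten big_map.
by apply: eq_bigr => l _; rewrite big_map.
Qed.

Lemma bsz_trs t n : t \in trs n -> bsz t = n.
Proof. by rewrite mem_trs => /eqP. Qed.

(** * Evaluation of trees along an algebra morphism *)

Section Eval.
Variables (K : fieldType) (A B : algType K) (v : {lrmorphism B -> A}).
Implicit Types (f : seq A -> B) (t s : bt) (w acc u : seq A).

(* [acc] holds the arguments already collected for the current outer block, each
   multiplied by the value of the gap on its right. *)
Fixpoint evS f t w : B :=
  if t is N b s
  then evB f b [::] (take (bsz b).+1 w) * evS f s (drop (bsz b).+1 w) else 1
with evB f t acc w : B :=
  if t is N g b
  then evB f b (rcons acc (head 0 w * v (evS f g (take (bsz g) (behead w)))))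
               (drop (bsz g) (behead w))
  else f (rcons acc (head 0 w)).

Definition cen (c : B) := (forall b, b * c = c * b) /\ (forall a, a * v c = v c * a).

(* Only central scalars move out of every slot; these include K and, over dual
   numbers, eps. *)
Definition slotlin f := forall p q y z c, cen c ->
  f (p ++ (y * v c + z) :: q) = f (p ++ y :: q) * c + f (p ++ z :: q).
Definition leftlin f := forall b y q, f (v b * y :: q) = b * f (y :: q).
Definition rightlin f := forall p y b, f (rcons p (y * v b)) = f (rcons p y) * b.

Definition good f := [/\ slotlin f, leftlin f & rightlin f].

Lemma cen1 : cen 1. Proof. by split=> x; rewrite ?rmorph1 ?mulr1 ?mul1r. Qed.

Lemma cenZ (k : K) : cen k%:A.
Proof.
split=> x; first by rewrite -scalerAr -scalerAl mulr1 mul1r.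
by rewrite linearZ /= rmorph1 -scalerAr -scalerAl mulr1 mul1r.
Qed.

Lemma evB_acc f t p q y z c w : slotlin f -> cen c ->
  evB f t (p ++ (y * v c + z) :: q) w =
  evB f t (p ++ y :: q) w * c + evB f t (p ++ z :: q) w.
Proof.
move=> fl cc; elim: t q w => [|g _ b IHb] q w /=.
  by rewrite !rcons_cat /= fl.
by rewrite !rcons_cat /= IHb.
Qed.

Lemma evB_slot_last f t p y z c w : slotlin f -> cen c ->
  evB f t (rcons p (y * v c + z)) w =
  evB f t (rcons p y) w * c + evB f t (rcons p z) w.
Proof. by move=> fl cc; rewrite -!cats1 evB_acc. Qed.

Lemma evB_last_sum f t p y w (I : Type) (r : seq I) (a : I -> K) (F : I -> B) :
  slotlin f ->
  evB f t (rcons p (y * v (\sum_(i <- r) a i *: F i))) w =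
  \sum_(i <- r) a i *: evB f t (rcons p (y * v (F i))) w.
Proof.
move=> fl.
have ev0 : evB f t (rcons p 0) w = 0.
  have := evB_slot_last t p 0 0 w fl cen1.
  by rewrite mul0r add0r mulr1 => /eqP; rewrite -subr_eq subrr eq_sym => /eqP.
elim: r => [|i r IHr]; first by rewrite !big_nil rmorph0 mulr0.
rewrite !big_cons raddfD /= mulrDr.
have -> : a i *: F i = F i * (a i)%:A by rewrite -scalerAr mulr1.
rewrite rmorphM mulrA evB_slot_last //; last exact: cenZ.
by rewrite IHr -scalerAr mulr1.
Qed.

Lemma evB_last_scale f t p y w (a : K) (e : B) : slotlin f ->
  evB f t (rcons p (y * v (a *: e))) w = a *: evB f t (rcons p (y * v e)) w.
Proof.
move=> fl; have := evB_last_sum t p y w [:: tt] (fun=> a) (fun=> e) fl.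
by rewrite !big_seq1.
Qed.

End Eval.

Lemma big_triangle (V : nmodType) n (F : nat -> nat -> V) :
  \sum_(i < n) \sum_(j < i.+1) F i j = \sum_(j < n) \sum_(k < n - j) F (j + k)%N j.
Proof.
elim: n => [|n IHn]; first by rewrite !big_ord0.
rewrite big_ord_recr /= IHn [RHS]big_ord_recr /= subSnn big_ord1 addn0.
rewrite [X in _ + X = _]big_ord_recr /= addrA; congr (_ + _).
rewrite -big_split /=; apply: eq_bigr => j _.
by rewrite subSn ?(ltnW (ltn_ord j)) // big_ord_recr /= subnKC // ltnW.
Qed.

(** The character of the forest algebra with values [aB] on components. Sums with such weights
    satisfy the renewal equation [ES_chr]. *)
Fixpoint chr (R : pzSemiRingType) (aB : bt -> R) (t : bt) : R :=
  if t is N b s then aB b * chr aB s else 1.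

Section Star.
Variables (K : fieldType) (A B : algType K) (v : {lrmorphism B -> A}).
Implicit Types (f : seq A -> B) (t s : bt) (w acc u : seq A).

Notation evS := (evS v). Notation evB := (evB v).

(** * Sums over partitions and cuts *)

Section Cut.
Variables (V : lmodType K) (aB : bt -> K).

(* [cutS t G] sums [a(pruned) *: G(root part)] over the admissible cuts of the
   forest t: the pruned part is a union of blocks closed under nesting, and [a]
   is the multiplicative weight with [aB] on irreducible components. *)
Fixpoint cutS t (G : bt -> V) : V :=
  if t is N b s then aB b *: cutS s G + cutB b (fun b' => cutS s (fun s' => G (N b' s')))
  else G L
with cutB t (G : bt -> V) : V :=
  if t is N g b then cutS g (fun g' => cutB b (fun b' => G (N g' b'))) else G L.

Lemma eq_cut t : (forall G G' : bt -> V, G =1 G' -> cutS t G = cutS t G')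
  /\ (forall G G' : bt -> V, G =1 G' -> cutB t G = cutB t G').
Proof.
elim: t => [|l [IHlS IHlB] r [IHrS IHrB]]; first by split=> G G' E /=.
split=> G G' E /=.
  by congr (_ *: _ + _); [exact: IHrS|apply: IHlB => b; apply: IHrS => s].
by apply: IHlS => g; apply: IHrB => b.
Qed.

End Cut.

Definition ES f (G : bt -> K) w : B := \sum_(t <- trs (size w)) G t *: evS f t w.

(** A component on [size w] points is a tree with one node fewer. *)
Definition EB f (G : bt -> K) w : B :=
  \sum_(b <- trs (size w).-1) G b *: evB f b [::] w.

(** The weight depends jointly on the first component and on the rest: weights that come from cuts
    need not factor, so products of [EB] and [ES] are not enough. *)
Definition ESB f (G : bt -> bt -> K) acc w : B :=
  \sum_(q < size w) \sum_(b <- trs q) \sum_(s <- trs (size w - q.+1))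
    G b s *: (evB f b acc (take q.+1 w) * evS f s (drop q.+1 w)).

Lemma eq_ES f G G' w : G =1 G' -> ES f G w = ES f G' w.
Proof. by move=> E; apply: eq_bigr => t _; rewrite E. Qed.

Lemma eq_ESB f G G' acc w : G =2 G' -> ESB f G acc w = ESB f G' acc w.
Proof. by move=> E; do 3![apply: eq_bigr => ? _]; rewrite E. Qed.

Lemma ES_nil f G : ES f G [::] = G L *: 1.
Proof. by rewrite /ES big_seq1. Qed.

Lemma ES_ESB f G y w : ES f G (y :: w) = ESB f (fun b s => G (N b s)) [::] (y :: w).
Proof.
rewrite /ES /ESB [size _]/= big_trsS; apply: eq_bigr => q _.
rewrite big_seq_cond [RHS]big_seq_cond; apply: eq_bigr => b /andP[/bsz_trs bq _].
by rewrite subSS; apply: eq_bigr => s _; rewrite -bq.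
Qed.

Lemma ESB_prod f (G G' : bt -> K) y w :
  ESB f (fun b s => G b * G' s) [::] (y :: w) =
  \sum_(q < (size w).+1) EB f G (y :: take q w) * ES f G' (drop q w).
Proof.
apply: eq_bigr => q _; rewrite /EB /ES [size (_ :: take _ _)]/= size_takel; last by rewrite -ltnS.
rewrite [size (_ :: _)]/= subSS size_drop mulr_suml; apply: eq_bigr => b _.
rewrite mulr_sumr; apply: eq_bigr => s _.
by rewrite -scalerAl -scalerAr scalerA.
Qed.

(** The renewal equation M = 1 + m M for concatenation, sorted by the end of the first component. *)
Lemma ES_chr f aB y w : ES f (chr aB) (y :: w) =
  \sum_(q < (size w).+1) EB f aB (y :: take q w) * ES f (chr aB) (drop q w).
Proof. by rewrite ES_ESB -ESB_prod; apply: eq_ESB. Qed.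

(** Either [y] is the last point of its outer block, or it is followed by a gap of [j] letters,
    whose value it absorbs. *)
Lemma ESB_cons f G acc y w :
  ESB f G acc (y :: w) = f (rcons acc y) * ES f (G L) w
  + \sum_(j < size w) \sum_(g <- trs j)
     ESB f (fun b s => G (N g b) s) (rcons acc (y * v (evS f g (take j w)))) (drop j w).
Proof.
rewrite /ESB [size _]/= big_ord_recl /= big_seq1 subSS subn0 drop0 take0.
congr (_ + _).
  by rewrite /ES mulr_sumr; apply: eq_bigr => s _; rewrite -scalerAr.
(* [i] marks the end of the first component and [j] the length of the gap after [y]; exchanging the
   sums puts the choice of the gap outside. *)
pose F i j := \sum_(g <- trs j) \sum_(b <- trs (i - j)) \sum_(s <- trs (size w - i.+1))
  G (N g b) s *: (evB f b (rcons acc (y * v (evS f g (take j w))))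
      (drop j (take i.+1 w)) * evS f s (drop i.+1 w)).
transitivity (\sum_(i < size w) \sum_(j < i.+1) F i j).
  apply: eq_bigr => i _; rewrite /bump /= add1n big_trsS; apply: eq_bigr => j _.
  rewrite /F big_seq_cond [RHS]big_seq_cond; apply: eq_bigr => g /andP[/bsz_trs gj _].
  apply: eq_bigr => b _; rewrite subSS; apply: eq_bigr => s _; rewrite /= gj.
  by rewrite take_takel //; apply: ltnW.
rewrite big_triangle; apply: eq_bigr => j _; rewrite exchange_big /=.
apply: eq_bigr => g _; rewrite size_drop; apply: eq_bigr => k _.
rewrite addKn; apply: eq_bigr => b _; rewrite -subnDA addnS; apply: eq_bigr => s _.
by rewrite -addnS drop_drop take_drop [(k.+1 + j)%N]addnC.
Qed.

(** * Subwords with absorbed gaps *)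

Section Fixed.
Variable f : seq A -> B.
Variable M : seq A -> B.
Hypothesis M0 : M [::] = 1.

(* The pairs (c, u) where u is obtained from w by keeping some of its letters
   and absorbing into them the value [M] of the gap on their right, and [c] is the
   value of the initial gap, which extends [gap]. *)
Fixpoint subs (gap w : seq A) : seq (B * seq A) :=
  if w is y :: w' then
    [seq (M gap, y * v p.1 :: p.2) | p <- subs [::] w'] ++ subs (rcons gap y) w'
  else [:: (M gap, [::])].

Lemma big_subs_cons (V : nmodType) gap y w (H : B -> seq A -> V) :
  \sum_(p <- subs gap (y :: w)) H p.1 p.2 =
  \sum_(p <- subs [::] w) H (M gap) (y * v p.1 :: p.2)
  + \sum_(p <- subs (rcons gap y) w) H p.1 p.2.
Proof. by rewrite /= big_cat big_map. Qed.

(** The kept letter at the cut is letter [i] of [w]. The gap on its right is the initial gap of a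
    subword of the remaining letters, so the two sides are chosen independently. *)
Lemma big_subs_split (V : nmodType) gap w (G : B -> seq A -> seq A -> V) :
  \sum_(p <- subs gap w) \sum_(j < size p.2) G p.1 (take j p.2) (drop j p.2) =
  \sum_(i < size w) \sum_(p <- subs gap (take i w))
    \sum_(p' <- subs [::] (drop i.+1 w)) G p.1 p.2 (nth 0 w i * v p'.1 :: p'.2).
Proof.
elim: w gap G => [|y w IHw] gap G; first by rewrite /= big_seq1 !big_ord0.
rewrite (big_subs_cons _ _ _ (fun c u => \sum_(j < size u) G c (take j u) (drop j u))).
under eq_bigr do rewrite [size _]/= big_ord_recl /=.
rewrite big_split /= (IHw [::] (fun c u1 u2 => G (M gap) (y * v c :: u1) u2)) IHw.
rewrite [in RHS]big_ord_recl /= big_seq1 drop0 -addrA; congr (_ + _).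
rewrite -big_split /=; apply: eq_bigr => i _.
rewrite (big_subs_cons _ _ _ (fun c u =>
  \sum_(p' <- subs [::] (drop i.+1 w)) G c u (nth 0 w i * v p'.1 :: p'.2))).
by [].
Qed.

(* The renewal equation M = 1 / (1 - m) passes to the sums over subwords. *)
Lemma subs_renewal (m X : seq A -> B) :
  (forall y z, M (y :: z) =
     \sum_(q < (size z).+1) m (y :: take q z) * M (drop q z)) ->
  forall y w, \sum_(p <- subs [:: y] w) p.1 * X p.2 =
    \sum_(q < (size w).+1) m (y :: take q w) *
      \sum_(p <- subs [::] (drop q w)) p.1 * X p.2.
Proof.
move=> Mm y w; pose S w := \sum_(p <- subs [::] w) p.1 * X p.2.
(* The initial gap must grow during the induction on [w]. The first sum collects the components of
   the gap that end inside [u], the second those that end later. *)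
suff E u : \sum_(p <- subs (y :: u) w) p.1 * X p.2 =
    \sum_(q < size u) m (y :: take q u) * (\sum_(p <- subs (drop q u) w) p.1 * X p.2)
    + \sum_(q < (size w).+1) m (y :: u ++ take q w) * S (drop q w).
  by rewrite E big_ord0 add0r.
elim: w u => [|z w IHw] u.
  rewrite /= big_seq1 /= big_ord1 /= cats0 Mm big_ord_recr /= mulrDl.
  rewrite take_size drop_size M0 mulr1; congr (_ + _).
    rewrite mulr_suml; apply: eq_bigr => q _.
    by rewrite big_seq1 mulrA.
  by rewrite /S big_seq1 M0 mul1r.
pose Y c := \sum_(p <- subs [::] w) c * X (z * v p.1 :: p.2).
have cY a b : Y (a * b) = a * Y b.
  by rewrite /Y mulr_sumr; apply: eq_bigr => p _; rewrite mulrA.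
have Eq gap : \sum_(p <- subs gap (z :: w)) p.1 * X p.2 =
  Y (M gap) + \sum_(p <- subs (rcons gap z) w) p.1 * X p.2.
  by rewrite (big_subs_cons _ _ _ (fun c u => c * X u)).
rewrite Eq rcons_cons IHw size_rcons.
under [in RHS]eq_bigr do rewrite Eq mulrDr.
rewrite big_split /=.
have YM : Y (M (y :: u)) =
    \sum_(q < size u) m (y :: take q u) * Y (M (drop q u)) + m (y :: u) * Y 1.
  rewrite Mm big_ord_recr /= take_size drop_size M0.
  have YD a b : Y (a + b) = Y a + Y b.
    by rewrite /Y -big_split /=; apply: eq_bigr => p _; rewrite mulrDl.
  rewrite YD cY; congr (_ + _).
  have Y0 : Y 0 = 0 by rewrite /Y big1 // => p _; rewrite mul0r.
  rewrite (big_morph Y YD Y0); apply: eq_bigr => q _; exact: cY.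
rewrite YM -!addrA; congr (_ + _).
rewrite big_ord_recr /= [X in _ = _ + X]big_ord_recl /= cats0 /S Eq /= M0 mulrDr.
have -> : drop (size u) (rcons u z) = [:: z] by rewrite -cats1 drop_size_cat.
have -> : take (size u) (rcons u z) = u by rewrite -cats1 take_size_cat.
rewrite -!addrA [LHS]addrCA; congr (_ + (_ + (_ + _))).
  apply: eq_bigr => q _.
  by rewrite -cats1 takel_cat ?drop_cat ?ltn_ord ?cats1 // ltnW.
by apply: eq_bigr => q _; rewrite cat_rcons.
Qed.

(** Only the subword that keeps every letter has full length, and all its gaps but the initial one
    are empty. Hence summation over subwords is unitriangular for the length, which gives
    [subs_inj]. *)
Lemma subs_absorb (H : B -> seq A -> B) gap w :
  (forall c u, (size u < size w)%N -> H c u = 0) ->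
  \sum_(p <- subs gap w) H p.1 p.2 = H (M gap) w.
Proof.
elim: w gap H => [|y w IHw] gap H H0; first by rewrite /= big_seq1.
rewrite big_subs_cons (IHw [::] (fun c u => H (M gap) (y * v c :: u))); last first.
  by move=> c u lt_u; apply: H0.
rewrite M0 rmorph1 mulr1 big_seq big1 ?addr0 // => p ps; apply: H0.
suff: (size p.2 <= size w)%N by [].
move: ps {IHw}; move: (rcons gap y) => {}gap.
elim: w gap p => [|z w IHw] gap p /=; first by rewrite inE => /eqP->.
by rewrite mem_cat => /orP[/mapP[p' /IHw + ->]|/IHw /leqW].
Qed.

Lemma subs_inj (X X' : seq A -> B) :
  (forall w, \sum_(p <- subs [::] w) p.1 * X p.2 =
             \sum_(p <- subs [::] w) p.1 * X' p.2) -> X =1 X'.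
Proof.
move=> E w; have [n] := ubnP (size w); elim: n w => // n IHn w lt_wn.
apply/eqP; rewrite -subr_eq0; move/eqP: (E w); rewrite -subr_eq0.
rewrite -sumrB (eq_bigr (fun p => p.1 * (X p.2 - X' p.2))); last first.
  by move=> p _; rewrite mulrBr.
rewrite (subs_absorb (H := fun c u => c * (X u - X' u))) ?M0 ?mul1r // => c u lt_u.
by rewrite IHn ?subrr ?mulr0 //; apply: leq_trans lt_u _.
Qed.

End Fixed.

Section StarTheorem.
Variables (f : seq A -> B) (aB : bt -> K).
Hypotheses (fl : slotlin v f) (fr : rightlin v f).
Let M := ES f (chr aB).
Let cS t (G : bt -> K) : K := cutS (V := K^o) aB t G.
Let cB t (G : bt -> K) : K := cutB (V := K^o) aB t G.

(** The two statements are proved together by induction on the number of letters. In [star_block]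
    the letter [y] is kept, so the outer block of its component is never pruned: this is the
    difference between [cutB] and [cutS]. *)
Definition star_forest w := forall G,
  \sum_(p <- subs M [::] w) p.1 * ES f G p.2 = ES f (cS ^~ G) w.
Definition star_block w := forall acc y (G : bt -> bt -> K),
  \sum_(p <- subs M [::] w) ESB f G acc (y * v p.1 :: p.2) =
  ESB f (fun b s => cB b (fun b' => cS s (G b'))) acc (y :: w).

Lemma star_block_step w :
  (forall u, (size u <= size w)%N -> star_forest u) ->
  (forall u, (size u < size w)%N -> star_block u) -> star_block w.
Proof.
move=> IHS IHB acc y G.
under eq_bigr do rewrite ESB_cons fr -mulrA.
rewrite big_split /= -mulr_sumr IHS // ESB_cons; congr (_ + _).
rewrite (eq_bigr (fun p => \sum_(j < size p.2) \sum_(g <- trs (size (take j p.2)))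
  ESB f (fun b s => G (N g b) s)
     (rcons acc (y * v (p.1 * evS f g (take j p.2)))) (drop j p.2))); last first.
  move=> p _; apply: eq_bigr => j _; rewrite size_takel; last exact: ltnW.
  by apply: eq_bigr => g _; rewrite rmorphM mulrA.
rewrite (big_subs_split M [::] w (fun c u1 u2 => \sum_(g <- trs (size u1))
  ESB f (fun b s => G (N g b) s) (rcons acc (y * v (c * evS f g u1))) u2)).
apply: eq_bigr => i _; have lt_i := ltn_ord i.
have sd : (size (drop i.+1 w) < size w)%N by rewrite size_drop; lia.
have st : (size (take i w) <= size w)%N by rewrite size_takel ltnW.
under eq_bigr => p _.
  rewrite exchange_big /=.
  under eq_bigr do rewrite IHB // -drop_nth //.
  over.
pose H g b s := cB b (fun b' => cS s (fun s' => G (N g b') s')).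
(* By linearity in the last collected slot, the sum over the subwords of the gap moves into that
   slot, where [star_forest] applies to the gap. *)
transitivity (\sum_(q < size (drop i w)) \sum_(b <- trs q)
  \sum_(s <- trs (size (drop i w) - q.+1))
   evB f b (rcons acc (y * v (\sum_(p <- subs M [::] (take i w)) p.1 *
      ES f (fun g => H g b s) p.2))) (take q.+1 (drop i w)) *
   evS f s (drop q.+1 (drop i w))).
  rewrite /ESB.
  transitivity (\sum_(p <- subs M [::] (take i w)) \sum_(q < size (drop i w))
    \sum_(b <- trs q) \sum_(s <- trs (size (drop i w) - q.+1))
    \sum_(g <- trs (size p.2)) H g b s *:
      (evB f b (rcons acc (y * v (p.1 * evS f g p.2))) (take q.+1 (drop i w)) *
       evS f s (drop q.+1 (drop i w)))).
    apply: eq_bigr => p _; rewrite exchange_big; apply: eq_bigr => q _.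
    by rewrite exchange_big; apply: eq_bigr => b _; rewrite exchange_big.
  rewrite exchange_big; apply: eq_bigr => q _.
  rewrite exchange_big; apply: eq_bigr => b _.
  rewrite exchange_big; apply: eq_bigr => s _ /=.
  have -> : \sum_(p <- subs M [::] (take i w)) p.1 * ES f (fun g => H g b s) p.2 =
      \sum_(p <- subs M [::] (take i w)) (1 : K) *: \sum_(g <- trs (size p.2))
        H g b s *: (p.1 * evS f g p.2).
    apply: eq_bigr => p _; rewrite scale1r /ES mulr_sumr; apply: eq_bigr => g _.
    by rewrite -scalerAr.
  rewrite evB_last_sum // mulr_suml; apply: eq_bigr => p _.
  rewrite scale1r evB_last_sum // mulr_suml; apply: eq_bigr => g _.
  by rewrite -scalerAl.
rewrite [RHS]exchange_big; apply: eq_bigr => q _.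
rewrite [RHS]exchange_big; apply: eq_bigr => b _.
rewrite [RHS]exchange_big; apply: eq_bigr => s _ /=.
rewrite IHS // /ES evB_last_sum // size_takel; last exact: ltnW.
by rewrite mulr_suml; apply: eq_bigr => g _; rewrite -scalerAl.
Qed.

Lemma star_forest_step w :
  (forall u, (size u < size w)%N -> star_forest u) ->
  (forall u, (size u < size w)%N -> star_block u) -> star_forest w.
Proof.
have M0 : M [::] = 1 by rewrite /M ES_nil scale1r.
case: w => [|y w] IHS IHB G; first by rewrite /= big_seq1 M0 mul1r !ES_nil.
(* Either [y] is kept, which is [star_block], or it lies in the initial gap and its whole component
   is pruned, which is the renewal equation. These are the two terms of [cutS]. *)
rewrite (big_subs_cons _ _ _ _ (fun c u => c * ES f G u)) M0.
under eq_bigr do rewrite mul1r ES_ESB.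
rewrite IHB // (subs_renewal M0 (m := EB f aB)); last exact: ES_chr.
rewrite (eq_bigr (fun q : 'I_(size w).+1 =>
   EB f aB (y :: take q w) * ES f (cS ^~ G) (drop q w))); last first.
  by move=> q _; rewrite IHS // size_drop ltnS leq_subr.
rewrite -ESB_prod ES_ESB /ESB -big_split; apply: eq_bigr => q _.
rewrite -big_split; apply: eq_bigr => b _; rewrite -big_split; apply: eq_bigr => s _.
by rewrite /= -scalerDl addrC.
Qed.

(** A partition of the kept letters together with one of each gap is a partition of all letters with
    an admissible cut: the blocks in the gaps are pruned, and they are closed under nesting because
    a gap lies between consecutive kept letters. *)
Lemma star G w :
  \sum_(p <- subs M [::] w) p.1 * ES f G p.2 = ES f (cS ^~ G) w.
Proof.
have [n] := ubnP (size w).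
suff: (forall w, (size w < n)%N -> star_forest w) /\
      (forall w, (size w < n)%N -> star_block w).
  by case=> E _ lt_w; apply: E.
elim: n {G w} => // n [IHS IHB].
have HS w : (size w <= n)%N -> star_forest w.
  by move=> le_w; apply: star_forest_step => u lt_u; [apply: IHS|apply: IHB];
     apply: leq_trans le_w.
split=> // w; rewrite ltnS => le_w; apply: star_block_step => u le_u; last first.
  by apply: IHB; apply: leq_trans le_w.
by apply: HS; apply: leq_trans le_w.
Qed.

End StarTheorem.
End Star.
Arguments eq_cut {K V}.

Fixpoint prodgaps (R : pzSemiRingType) (a : bt -> R) (t : bt) : R :=
  if t is N g b then a g * prodgaps a b else 1.

Fixpoint flat (t : bt) : bool := if t is N g b then (g == L) && flat b else true.

Fixpoint nbS (t : bt) : nat := if t is N b s then (nbB b + nbS s)%N else 0%N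
with nbB t := if t is N g b then (nbS g + nbB b)%N else 1%N.

(* m is the number of blocks already met inside the span of the outer block. *)
Fixpoint tauS (t : bt) : nat := if t is N b s then (tauB b 0 * tauS s)%N else 1%N
with tauB t m := if t is N g b then (tauS g * tauB b (m + nbS g))%N else m.+1.

(* The number of colorings of the blocks of the component b with k colors that
   increase strictly with nesting, by induction on whether color 0 is used. *)
Fixpoint OB (k : nat) (b : bt) : nat :=
  if k is k'.+1 then OB k' b + prodgaps (chr (OB k')) b else 0.

(** * Scalar weights and their convolution over cuts *)

Section Scalars.
Variable K : fieldType.
Implicit Types (t b s : bt).

Lemma eq_chr (R : pzSemiRingType) (a a' : bt -> R) : a =1 a' -> chr a =1 chr a'.
Proof. by move=> E; elim=> //= b _ s ->; rewrite E. Qed.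

Lemma chr0 (R : pzSemiRingType) (a : bt -> R) t :
  (forall b, a b = 0) -> chr a t = (t == L)%:R.
Proof. by move=> E; case: t => //= b s; rewrite E mul0r. Qed.

Lemma eq_cut_weight (V : lmodType K) (aB aB' : bt -> K) t : aB =1 aB' ->
  (forall G : bt -> V, cutS aB t G = cutS aB' t G) /\
  (forall G : bt -> V, cutB aB t G = cutB aB' t G).
Proof.
move=> Ea; elim: t => [|l [IHlS IHlB] r [IHrS IHrB]] //=; split=> G.
  by rewrite Ea IHrS IHlB; congr (_ + _); apply: (eq_cut _ l).2 => b'; apply: IHrS.
by rewrite IHlS; apply: (eq_cut _ l).1 => g'; apply: IHrB.
Qed.

Lemma cut_linear (V W : lmodType K) (phi : V -> W) (aB : bt -> K) t :
  (forall a x y, phi (a *: x + y) = a *: phi x + phi y) ->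
  (forall G, phi (cutS aB t G) = cutS aB t (phi \o G)) /\
  (forall G, phi (cutB aB t G) = cutB aB t (phi \o G)).
Proof.
move=> phiL; elim: t => [|l [IHlS IHlB] r [IHrS IHrB]] //=; split=> G.
  rewrite phiL IHrS IHlB; congr (_ + _).
  by apply: (eq_cut aB l).2 => b' /=; rewrite IHrS.
by rewrite IHlS; apply: (eq_cut aB l).1 => g' /=; rewrite IHrB.
Qed.

Lemma cut_lincomb (V : lmodType K) (aB : bt -> K) t a (G H : bt -> V) :
  (cutS aB t (fun b => a *: G b + H b) = a *: cutS aB t G + cutS aB t H) *
  (cutB aB t (fun b => a *: G b + H b) = a *: cutB aB t G + cutB aB t H).
Proof.
elim: t G H => [|l IHl r IHr] G H //=; split.
  under (eq_cut aB l).2 do rewrite (IHr _ _).1.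
  by rewrite (IHl _ _).2 (IHr _ _).1 !scalerDr !scalerA mulrC addrACA.
under (eq_cut aB l).1 do rewrite (IHr _ _).2.
by rewrite (IHl _ _).1.
Qed.

Lemma cut_zero (V : lmodType K) (aB : bt -> K) t :
  (cutS aB t (fun=> 0 : V) = 0) * (cutB aB t (fun=> 0 : V) = 0).
Proof.
have zL (a : K) (x y : V) : 0 = a *: (0 : V) + 0 by rewrite scaler0 addr0.
by have [/(_ (fun=> 0)) <- /(_ (fun=> 0)) <-] :=
  cut_linear (phi := fun=> 0 : V) aB t zL.
Qed.

Lemma cut_mulr (R : comAlgType K) (aB : bt -> K) t (G : bt -> R) x :
  (cutS aB t (fun s => x * G s) = x * cutS aB t G) *
  (cutB aB t (fun s => x * G s) = x * cutB aB t G).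
Proof.
have xL a y z : x * (a *: y + z) = a *: (x * y) + x * z by rewrite mulrDr scalerAr.
by have [-> ->] := cut_linear aB t xL.
Qed.

Lemma cut_mull (R : comAlgType K) (aB : bt -> K) t (G : bt -> R) x :
  (cutS aB t (fun s => G s * x) = cutS aB t G * x) *
  (cutB aB t (fun s => G s * x) = cutB aB t G * x).
Proof.
split; rewrite mulrC -cut_mulr; [apply: (eq_cut aB t).1 | apply: (eq_cut aB t).2];
  by move=> s; rewrite mulrC.
Qed.

(** Cuts of different components are independent, and a component is either pruned whole or keeps
    its outer block. So the convolution of two characters is a character. *)
Lemma cutS_chr (R : comAlgType K) (aB : bt -> K) (bB : bt -> R) t :
  cutS aB t (chr bB) = chr (fun b => (aB b)%:A + cutB aB b bB) t.
Proof.
elim: t => //= b _ s <-; rewrite mulrDl -scalerAl mul1r; congr (_ + _).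
rewrite -cut_mull; apply: (eq_cut aB b).2 => b' /=.
by rewrite cut_mulr.
Qed.

(** A flat root part consists of the outer block alone, which forces every gap to be pruned
    entirely. *)
Lemma cutB_flat (aB : bt -> K) b :
  cutB (V := K^o) aB b (fun b => (flat b)%:R) = prodgaps (chr aB) b.
Proof.
have cutS_L g x : cutS (V := K^o) aB g (fun g => (g == L)%:R * x) = chr aB g * x.
  elim: g => [|c _ s IHs] /=; first by rewrite mul1r.
  rewrite IHs scalerAl.
  rewrite [X in _ + X](_ : _ = 0) ?addr0 //.
  rewrite -[RHS](cut_zero _ aB c).2; apply: (eq_cut aB c).2 => b'.
  rewrite -[RHS](cut_zero _ aB s).1; apply: (eq_cut aB s).1 => s'.
  by rewrite mul0r.
elim: b => //= g _ b <-; rewrite -cutS_L; apply: (eq_cut aB g).1 => g'.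
rewrite -(cut_mulr aB b (fun b => (flat b)%:R : K^o) _).2.
by apply: (eq_cut aB b).2 => b'; rewrite -natrM mulnb.
Qed.

(** With these weights a cut removes an arbitrary set of innermost blocks, and the alternating sum
    over such sets vanishes as soon as one block can be removed. In [cutB] the outer block stays, so
    a single block survives with sign -1. *)
Lemma cut_flat_sign (t : bt) :
  (cutS (V := K^o) (fun b => (flat b)%:R : K) t (fun s => (-1) ^+ nbS s) = (t == L)%:R) /\
  (cutB (V := K^o) (fun b => (flat b)%:R : K) t (fun b => (-1) ^+ nbB b) = - (flat t)%:R).
Proof.
elim: t => [|l [IHlS IHlB] r [IHrS IHrB]] /=; first by rewrite expr0 expr1.
split.
  have -> : cutB (V := K^o) (fun b => (flat b)%:R : K) l (fun b' => cutS (V := K^o)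
      (fun b => (flat b)%:R : K) r (fun s' => (-1) ^+ (nbB b' + nbS s')))
    = - (flat l)%:R * (r == L)%:R.
    rewrite -IHlB -IHrS -(cut_mull _ _ _ _).2; apply: (eq_cut _ l).2 => b'.
    by rewrite -cut_mulr; apply: (eq_cut _ r).1 => s'; rewrite exprD.
  by rewrite IHrS mulNr addrN.
transitivity ((l == L)%:R * - (flat r)%:R : K); last by rewrite mulrN -natrM mulnb.
rewrite -IHlS -IHrB -[RHS](cut_mull (R := K^o) _ _ _ _).1; apply: (eq_cut _ l).1 => g'.
by rewrite -cut_mulr; apply: (eq_cut _ r).2 => b'; rewrite exprD.
Qed.

Lemma chr_sign t : chr (fun b => (-1) ^+ nbB b : K) t = (-1) ^+ nbS t.
Proof. by elim: t => //= b _ s ->; rewrite exprD. Qed.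

Lemma chr_OB k t : chr (fun b => (OB k b)%:R : K) t = (chr (OB k) t)%:R.
Proof. by elim: t => //= b _ s ->; rewrite -natrM. Qed.

Lemma prodgaps_OB k b :
  prodgaps (chr (fun b => (OB k b)%:R : K)) b = (prodgaps (chr (OB k)) b)%:R.
Proof. by elim: b => //= b _ s ->; rewrite chr_OB -natrM. Qed.

(** * The weights u^|t| / tau(t)! as iterated integrals *)

Section Primitive.
Hypothesis charK0 : [pchar K] =i pred0.
Implicit Types (p q : {poly K}) (u x : K).

Lemma natK_neq0 n : (n.+1)%:R != 0 :> K.
Proof. by rewrite ((pcharf0P K).1 charK0). Qed.

Definition primitive p : {poly K} := \poly_(i < (size p).+1) (p`_i.-1 / i%:R).

Lemma coef_primitive p i : (primitive p)`_i = p`_i.-1 / i%:R.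
Proof.
rewrite coef_poly ltnS; case: leqP => // lt_pi.
by rewrite nth_default ?mul0r //; case: i lt_pi.
Qed.

Lemma primitive_linear a p q :
  primitive (a *: p + q) = a *: primitive p + primitive q.
Proof.
apply/polyP=> i; rewrite coefD coefZ !coef_primitive coefD coefZ.
by rewrite mulrDl mulrA.
Qed.

Lemma deriv_primitive p : (primitive p)^`() = p.
Proof.
apply/polyP=> i; rewrite coef_deriv coef_primitive /= -[_ *+ _]mulr_natr.
by rewrite divfK ?natK_neq0.
Qed.

Lemma primitive_comp p u : primitive (p \Po ('X + u%:P)) =
  (primitive p \Po ('X + u%:P)) - (primitive p).[u]%:P.
Proof.
(* The difference vanishes at 0 and has derivative 0, hence is 0 in characteristic zero. *)
apply/eqP; rewrite -subr_eq0; set d := (X in X == 0).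
have d0 : d.[0] = 0.
  rewrite /d !(hornerD, hornerN, hornerC, horner_comp, hornerX) add0r subrr subr0.
  by rewrite horner_coef0 coef_primitive invr0 mulr0.
have dd : d^`() = 0.
  rewrite /d !derivE deriv_comp !derivE !deriv_primitive.
  by rewrite addr0 mulr1 subr0 subrr.
move: d d0 dd => d; rewrite horner_coef0 => d0 dd.
apply/eqP; apply/polyP => -[|i]; first by rewrite coef0.
have := congr1 (fun q => q`_i) dd; rewrite coef_deriv coef0 -mulr_natr.
by rewrite coef0; move/eqP; rewrite mulf_eq0 (negPf (natK_neq0 i)) orbF => /eqP.
Qed.

(* Replacing each block by an integration gives u ^ |t| / tau(t)! at u, and Taylor's
   formula turns the convolution over cuts into u + x. *)
Fixpoint wtS t : {poly K} := if t is N b s then wtB b 1 * wtS s else 1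
with wtB t p := if t is N g b then wtB b (p * wtS g) else primitive p.

Lemma wtB_linear b a p q : wtB b (a *: p + q) = a *: wtB b p + wtB b q.
Proof.
elim: b p q => [|g _ b IHb] p q /=; first exact: primitive_linear.
by rewrite mulrDl -scalerAl IHb.
Qed.

(** Integrating a shifted polynomial from 0 gives the shifted integral minus its value at [u]. That
    constant is restored in [cutS] by the term in which the component is pruned whole. *)
Lemma cut_wt u t :
  (cutS (fun b => (wtB b 1).[u]) t wtS = wtS t \Po ('X + u%:P)) /\
  (forall p, cutB (fun b => (wtB b 1).[u]) t (fun b => wtB b (p \Po ('X + u%:P)))
   = (wtB t p \Po ('X + u%:P)) - (wtB t p).[u]%:P).
Proof.
elim: t => [|l [IHlS IHlB] r [IHrS IHrB]] /=.
  by split=> [|p]; [rewrite comp_polyC | rewrite primitive_comp].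
split=> [|p].
  rewrite (_ : cutB _ l _ = cutB (fun b => (wtB b 1).[u]) l (fun b => wtB b 1) *
     cutS (fun b => (wtB b 1).[u]) r wtS); last first.
    rewrite -(cut_mull _ _ _ _).2; apply: (eq_cut _ l).2 => b'.
    by rewrite -cut_mulr.
  have := IHlB 1; rewrite comp_polyC => ->; rewrite IHrS comp_polyM mulrBl.
  by rewrite addrC mul_polyC subrK.
(* [p] is the product of the gaps already met. As [phi] is linear, it commutes with the cuts of the
   next gap, so that both induction hypotheses apply in turn. *)
pose phi q := cutB (fun b => (wtB b 1).[u]) r (fun b => wtB b ((p \Po ('X + u%:P)) * q)).
have phiL (a : K) (q q' : {poly K}) : phi (a *: q + q') = a *: phi q + phi q'.
  rewrite /phi -(cut_lincomb _ _ _ _ _).2; apply: (eq_cut _ r).2 => b'.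
  by rewrite mulrDr -scalerAr wtB_linear.
have [E _] := cut_linear (fun b => (wtB b 1).[u]) l phiL.
rewrite -[LHS](E wtS) IHlS /phi -IHrB.
by apply: (eq_cut _ r).2 => b'; rewrite comp_polyM.
Qed.

(** When an outer block with m blocks inside closes, integrating X^m yields 1 / (m + 1), which is
    the factor of that block in 1 / tau!. *)
Lemma wt_explicit t :
  (wtS t = (tauS t)%:R^-1 *: 'X^(nbS t)) /\
  (forall a m, wtB t (a *: 'X^m) = (a / (tauB t m)%:R) *: 'X^(m + nbB t)).
Proof.
elim: t => [|l [IHlS IHlB] r [IHrS IHrB]] /=; split=> [|a m].
- by rewrite invr1 scale1r expr0.
- apply/polyP=> i; rewrite coef_primitive !coefZ !coefXn addn1.
  case: i => [|i] /=; first by rewrite invr0 !mulr0.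
  by rewrite eqSS; case: eqP => [->|]; rewrite ?mulr1 ?mulr0 ?mul0r.
- have := IHlB 1 0%N; rewrite scale1r expr0 => ->.
  rewrite IHrS -scalerAl -scalerAr -exprD scalerA add0n mul1r.
  by rewrite natrM invfM.
rewrite IHlS -scalerAl -scalerAr -exprD scalerA IHrB addnA natrM invfM.
by rewrite mulrA.
Qed.

Definition hwt u b : K := u ^+ nbB b / (tauB b 0)%:R.

Lemma wtB_eval u b : (wtB b 1).[u] = hwt u b.
Proof.
have [_ /(_ 1 0%N)] := wt_explicit b; rewrite scale1r expr0 => ->.
by rewrite hornerZ hornerXn add0n mul1r mulrC.
Qed.

Lemma wtS_eval u t : (wtS t).[u] = chr (hwt u) t.
Proof. by elim: t => [|b _ s IHs] /=; rewrite hornerE // IHs wtB_eval. Qed.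

(** The characters [hwt u] form a one-parameter group under convolution over cuts: [hwt k%:R] is the
    k-th power of [hwt 1], and [hwt (-1)] its inverse. *)
Lemma cutS_hwt u x t :
  cutS (V := K^o) (hwt u) t (chr (hwt x)) = chr (hwt (x + u)) t.
Proof.
pose ev (p : {poly K}) : K^o := p.[x].
have evL a p q : ev (a *: p + q) = a *: ev p + ev q by rewrite /ev !hornerE.
have [E _] := cut_linear (fun b => (wtB b 1).[u]) t evL.
rewrite -wtS_eval.
transitivity ((wtS t \Po ('X + u%:P)).[x]); last first.
  by rewrite horner_comp !hornerE.
rewrite -(cut_wt u t).1 -[RHS]/(ev _) E.
transitivity (cutS (V := K^o) (hwt u) t (ev \o wtS)).
  by apply: (eq_cut _ t).1 => s /=; rewrite /ev wtS_eval.
by apply/esym/(eq_cut_weight _ _ _).1 => b; apply: wtB_eval.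
Qed.

End Primitive.

End Scalars.

(** * Cancellation and powers for the compositional product *)

Section Relations.
Variables (K : fieldType) (A B : algType K) (v : {lrmorphism B -> A}).
Implicit Types (f g h : seq A -> B) (t b s : bt) (w acc u : seq A).
Notation ES := (ES v). Notation EB := (EB v).
Notation evS := (evS v). Notation evB := (evB v).

Definition fopp f : seq A -> B := fun w => - f w.

Lemma slotlin_opp f : slotlin v f -> slotlin v (fopp f).
Proof. by move=> fl p q y z c cc; rewrite /fopp fl // opprD mulNr. Qed.

Lemma rightlin_opp f : rightlin v f -> rightlin v (fopp f).
Proof. by move=> fr p y c; rewrite /fopp fr mulNr. Qed.

Lemma eq_subs (M M' : seq A -> B) gap w : M =1 M' -> subs v M gap w = subs v M' gap w.
Proof.
move=> E; elim: w gap => [|y w IHw] gap /=; first by rewrite E.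
by rewrite !IHw E.
Qed.

(** The last term of the renewal equation is the irreducible part of the full word times 1, and the
    other terms involve shorter words. So a sum determines its irreducible part. *)
Lemma ES_inj f g (a a' : bt -> K) :
  ES f (chr a) =1 ES g (chr a') -> forall y w, EB f a (y :: w) = EB g a' (y :: w).
Proof.
move=> E y w; have [n] := ubnP (size w); elim: n w => // n IHn w lt_w.
have := E (y :: w); rewrite !ES_chr !big_ord_recr /= take_size drop_size.
rewrite !ES_nil /= scale1r !mulr1 => H.
move: H; rewrite [X in X + _ = _](eq_bigr (fun q : 'I_(size w) =>
    EB g a' (y :: take q w) * ES g (chr a') (drop q w))); first by move/addrI.
move=> q _; rewrite E IHn // size_takel ?(ltnW (ltn_ord q)) //.
exact: leq_trans (ltn_ord q) _.
Qed.

Lemma sum_flat_evB f acc y w : \sum_(b <- trs (size w)) (flat b)%:R *: evB f b acc (y :: w)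
  = f (acc ++ y :: w).
Proof.
elim: w acc y => [|z w IHw] acc y.
  by rewrite big_seq1 /= scale1r cats1.
rewrite [size _]/= big_trsS big_ord_recl /= [X in _ + X]big1 ?addr0; last first.
  move=> q _; rewrite big_seq big1 // => g /bsz_trs gq; rewrite big1 // => b _.
  by case: g gq => //= *; rewrite scale0r.
rewrite big_seq1 subn0 /=.
rewrite (eq_bigr (fun b => (flat b)%:R *: evB f b (rcons acc y) (z :: w))).
  by rewrite IHw cat_rcons.
by move=> b _; rewrite rmorph1 mulr1.
Qed.

Lemma EB_flat f y w : EB f (fun b => (flat b)%:R) (y :: w) = f (y :: w).
Proof. exact: sum_flat_evB. Qed.

Lemma ES_unit f w : ES f (fun t => (t == L)%:R) w = (w == [::])%:R.
Proof.
case: w => [|y w]; first by rewrite ES_nil scale1r.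
rewrite /ES big_seq big1 // => t /bsz_trs.
by case: t => //= *; rewrite scale0r.
Qed.

(** Left cancellation: equal left factors and equal products have equal right factors, by [star] and
    [subs_inj]. *)
Lemma star_unique f g (a a' b b' : bt -> K) (c c' : bt -> K) :
  slotlin v f -> rightlin v f -> slotlin v g -> rightlin v g ->
  ES f (chr a) =1 ES g (chr a') ->
  (forall t, cutS (V := K^o) a t (chr b) = c t) ->
  (forall t, cutS (V := K^o) a' t (chr b') = c' t) ->
  ES f c =1 ES g c' -> ES f (chr b) =1 ES g (chr b').
Proof.
move=> fl fr gl gr E Ec Ec' Ecc.
have M0 : ES f (chr a) [::] = 1 by rewrite ES_nil scale1r.
apply: (subs_inj (v := v) (M := ES f (chr a)) M0) => w.
rewrite star // (eq_subs _ _ E) star //.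
transitivity (ES f c w); first exact: eq_ES.
by rewrite Ecc; apply/esym/eq_ES.
Qed.

Lemma ev_opp f t : slotlin v f ->
  (forall w, evS (fopp f) t w = (-1) ^+ nbS t *: evS f t w) /\
  (forall acc w, evB (fopp f) t acc w = (-1) ^+ nbB t *: evB f t acc w).
Proof.
move=> fl; elim: t => [|l [IHlS IHlB] r [IHrS IHrB]] /=; split=> [w|acc w].
- by rewrite scale1r.
- by rewrite scaleN1r.
- by rewrite IHlB IHrS -scalerAl -scalerAr scalerA exprD.
by rewrite IHrB IHlS evB_last_scale // scalerA exprD mulrC.
Qed.

Lemma chr_mulsign (a : bt -> K) t :
  chr (fun b => (-1) ^+ nbB b * a b) t = (-1) ^+ nbS t * chr a t.
Proof. by elim: t => [|b _ s IHs] /=; rewrite ?mul1r // IHs exprD mulrACA. Qed.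

Lemma ES_opp f a w : slotlin v f ->
  ES (fopp f) (chr a) w = ES f (chr (fun b => (-1) ^+ nbB b * a b)) w.
Proof.
move=> fl; apply: eq_bigr => t _.
by rewrite (ev_opp t fl).1 chr_mulsign scalerA mulrC.
Qed.

Lemma EB_opp f a w : slotlin v f ->
  EB (fopp f) a w = EB f (fun b => (-1) ^+ nbB b * a b) w.
Proof.
by move=> fl; apply: eq_bigr => t _; rewrite (ev_opp t fl).2 scalerA mulrC.
Qed.

Section Powers.
Hypothesis charK0 : [pchar K] =i pred0.

Lemma nbB_gt0 b : (0 < nbB b)%N.
Proof. by elim: b => //= g _ b; rewrite addn_gt0 => ->; rewrite orbT. Qed.

Lemma hwt0 b : hwt 0 b = 0 :> K.
Proof. by rewrite /hwt expr0n -[_ == _]negbK -lt0n nbB_gt0 mul0r. Qed.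

(** Both sides are the k-th compositional power of the moments; the step multiplies by one more
    factor on the right, in each of the two descriptions. *)
Lemma ES_powers f h : slotlin v f -> rightlin v f -> slotlin v h -> rightlin v h ->
  ES f (chr (fun b => (flat b)%:R)) =1 ES h (chr (hwt 1)) ->
  forall k, ES f (chr (fun b => (OB k b)%:R)) =1 ES h (chr (hwt k%:R)).
Proof.
move=> fl fr hl hr E1; elim=> [|k IHk] w.
  transitivity (ES f (fun t => (t == L)%:R) w).
    by apply: eq_ES => t; rewrite (chr0 (a := fun=> 0)).
  rewrite ES_unit -(ES_unit h); apply: eq_ES => t.
  by rewrite (chr0 (a := hwt 0)) // => b; apply: hwt0.
have := star (fun b => (OB k b)%:R) fl fr (chr (fun b => (flat b)%:R)) w.
have := star (hwt k%:R) hl hr (chr (hwt 1)) w.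
rewrite -(eq_subs _ _ IHk); under eq_bigr do rewrite -E1.
move=> -> Ef.
transitivity (ES h (fun t => cutS (V := K^o) (hwt k%:R) t (chr (hwt 1))) w); last first.
  by apply: eq_ES => t; rewrite cutS_hwt // -natr1 addrC.
rewrite Ef; apply: eq_ES => t.
(* A component is pruned whole or keeps only its outer block: these are the two terms in the
   recursion of [OB]. *)
rewrite (cutS_chr (R := K^o) _ _ t); apply: eq_chr => b /=.
by rewrite cutB_flat prodgaps_OB /GRing.scale /= mulr1 natrD.
Qed.

End Powers.
End Relations.

(** * Relations between cumulants *)

Section LinearCoefficient.
Variables (K : fieldType) (charK0 : [pchar K] =i pred0).

(* ['C(x, j)] as a polynomial in x. *)
Fixpoint binpoly (j : nat) : {poly K} :=
  if j is j'.+1 then (j%:R^-1) *: (binpoly j' * ('X - (j'%:R)%:P)) else 1.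

Lemma size_binpoly j : (size (binpoly j) <= j.+1)%N.
Proof.
elim: j => [|j IHj] /=; first by rewrite size_poly1.
rewrite (leq_trans (size_scale_leq _ _)) // (leq_trans (size_polyMleq _ _)) //.
by rewrite size_XsubC addn2 /=.
Qed.

Lemma horner_binpoly j k : (binpoly j).[k%:R] = 'C(k, j)%:R.
Proof.
elim: j => [|j IHj] /=; first by rewrite hornerC bin0.
rewrite hornerZ hornerM IHj hornerXsubC.
apply: (mulfI (natK_neq0 charK0 j)); rewrite mulrA divff ?mul1r ?natK_neq0 //.
rewrite -natrM mul_bin_left.
case: (leqP j k) => [le_jk|lt_kj]; last by rewrite bin_small // muln0 mul0r.
by rewrite natrM natrB // mulrC.
Qed.

Lemma coef_binpolyS j i : (binpoly j.+1)`_i =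
  (j.+1)%:R^-1 * ((if i == 0%N then 0 else (binpoly j)`_i.-1) - (binpoly j)`_i * j%:R).
Proof. by rewrite [binpoly _]/= -/(binpoly j) coefZ mulrBr coefB coefMX coefMC. Qed.

(** The second equation is the origin of the coefficients in [omega]. *)
Lemma coef_binpoly j :
  (binpoly j)`_0 = (j == 0%N)%:R /\ (binpoly j.+1)`_1 = (-1) ^+ j / (j.+1)%:R.
Proof.
have E i : (binpoly i.+1)`_0 = 0.
  elim: i => [|i IHi]; rewrite coef_binpolyS /= sub0r ?mulr0 ?oppr0 ?mulr0 //.
  by rewrite IHi mul0r oppr0 mulr0.
split; first by case: j => [|j]; [rewrite coef1 | rewrite E].
elim: j => [|j IHj].
  by rewrite coef_binpolyS /= !coef1 mulr0 subr0 mulrC.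
rewrite coef_binpolyS [_ == _]/= E sub0r IHj exprS mulN1r divfK ?natK_neq0 //.
by rewrite mulrC.
Qed.

(** A polynomial of degree at most n with coefficients in a module, zero at 0, ..., n, is zero:
    these points are distinct in characteristic zero, so the Vandermonde matrix inverts. *)
Lemma vandermonde_inj (V : lmodType K) n (D : nat -> V) :
  (forall k, (k <= n)%N -> \sum_(i < n.+1) k%:R ^+ i *: D i = 0) ->
  forall m, (m <= n)%N -> D m = 0.
Proof.
move=> HD m le_mn.
pose a : 'rV[K]_n.+1 := \row_i (i%:R).
pose W := Vandermonde n.+1 a.
have Wu : W \in unitmx.
  rewrite unitmxE det_Vandermonde unitfE; apply/prodf_neq0 => i _.
  apply/prodf_neq0 => j lt_ij; rewrite !mxE -natrB ?(ltnW lt_ij) //.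
  by rewrite ((pcharf0P K).1 charK0) subn_eq0 -ltnNge.
pose m' : 'I_n.+1 := inord m.
have -> : D m = \sum_(i < n.+1) (W *m invmx W) i m' *: D i.
  rewrite mulmxV // (bigD1 m') //= !mxE eqxx scale1r inordK // big1 ?addr0 //.
  by move=> i ne; rewrite !mxE (negPf ne) scale0r.
under eq_bigr do rewrite mxE scaler_suml.
rewrite exchange_big big1 //= => k _.
under eq_bigr do rewrite mulrC -scalerA !mxE.
by rewrite -scaler_sumr HD ?scaler0 // -ltnS.
Qed.

(** Both sides of the hypothesis are polynomials in k of degree at most n + 1 that agree at n + 2
    points; the conclusion compares their linear coefficients. *)
Lemma linear_coef_binomial (V : lmodType K) n (u z : nat -> V) :
  (forall k, (k <= n.+1)%N -> \sum_(j < n.+2) 'C(k, j)%:R *: u j =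
     \sum_(j < n.+2) k%:R ^+ j *: z j) ->
  \sum_(1 <= j < n.+2) ((-1) ^+ j.+1 / j%:R) *: u j = z 1%N.
Proof.
move=> E.
pose D i := \sum_(j < n.+2) (binpoly j)`_i *: u j - z i.
have D0 : D 1%N = 0.
  apply: (@vandermonde_inj _ n.+1) => // k le_kn.
  rewrite /D; under eq_bigr do rewrite scalerBr scaler_sumr.
  rewrite sumrB -E // exchange_big /= -sumrB big1 // => j _.
  under eq_bigr do rewrite scalerA mulrC.
  rewrite -scaler_suml -scalerBl -horner_binpoly.
  rewrite (@horner_coef_wide _ n.+2) ?subrr ?scale0r //.
  by rewrite (leq_trans (size_binpoly _)).
move/eqP: D0; rewrite subr_eq0 => /eqP <-.
rewrite big_ord_recl coef1 scale0r add0r big_add1 big_mkord.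
apply: eq_bigr => j _; rewrite lift0 (coef_binpoly j).2.
by rewrite !exprS mulrA mulrNN !mul1r.
Qed.

End LinearCoefficient.

Section MainRelations.
Variables (K : fieldType) (A B : algType K) (v : {lrmorphism B -> A}).
Hypothesis charK0 : [pchar K] =i pred0.
Notation ES := (ES v). Notation EB := (EB v).
Implicit Types (f h : seq A -> B) (w : seq A).

Lemma nbB_le b : (nbB b <= (bsz b).+1)%N.
Proof.
suff: (nbS b <= bsz b)%N /\ (nbB b <= (bsz b).+1)%N by case.
by elim: b => //= g [IHgS IHgB] b [IHbS IHbB]; split; lia.
Qed.

Lemma nbB1 b : (nbB b == 1%N) = flat b.
Proof.
elim: b => //= g _ b <-; case: g => //= l r.
by have := nbB_gt0 b; have := nbB_gt0 l; lia.
Qed.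

Lemma tauB_flat b : flat b -> tauB b 0 = 1%N.
Proof. by elim: b => //= g _ b IHb /andP[/eqP-> /IHb]; rewrite /= mul1n. Qed.

(** [W j b] stands for the number of increasing colorings of [b] that use all of j colors. The
    irreducible part of the k-th power is expanded in binomials of k on the side of [f] and in
    powers of k on the side of [h]. *)
Lemma omega_relation f h (W : nat -> bt -> K) n y w :
  slotlin v f -> rightlin v f -> slotlin v h -> rightlin v h ->
  ES f (chr (fun b => (flat b)%:R)) =1 ES h (chr (hwt 1)) ->
  size w = n ->
  (forall k b, (k <= n.+1)%N -> bsz b = n ->
     (OB k b)%:R = \sum_(j < n.+2) 'C(k, j)%:R * W j b) ->
  h (y :: w) =
  EB f (fun b => \sum_(1 <= j < n.+2) ((-1) ^+ j.+1 / j%:R) * W j b) (y :: w).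
Proof.
move=> fl fr hl hr E sw HW.
pose u j := EB f (W j) (y :: w).
pose z j := EB h (fun b => (nbB b == j)%:R / (tauB b 0)%:R) (y :: w).
(* The linear term keeps only the component with one block, whose value is [h] itself. *)
transitivity (z 1%N).
  rewrite -(EB_flat v); apply: eq_bigr => b _; congr (_ *: _).
  rewrite nbB1; case fb: (flat b); last by rewrite mul0r.
  by rewrite tauB_flat // mul1r invr1.
rewrite -(@linear_coef_binomial K charK0 _ n u z).
  rewrite /u /EB; under eq_bigr do rewrite scaler_sumr.
  rewrite exchange_big; apply: eq_bigr => b _.
  by rewrite scaler_suml; apply: eq_bigr => j _; rewrite scalerA.
move=> k le_kn.
transitivity (EB f (fun b => (OB k b)%:R) (y :: w)).
  rewrite /u /EB; under eq_bigr do rewrite scaler_sumr.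
  rewrite exchange_big /= big_seq [RHS]big_seq; apply: eq_bigr => b /bsz_trs bn.
  rewrite HW ?bn // scaler_suml; apply: eq_bigr => j _; by rewrite scalerA.
rewrite (ES_inj (ES_powers charK0 fl fr hl hr E k)).
rewrite /z /EB; under [RHS]eq_bigr do rewrite scaler_sumr.
rewrite [RHS]exchange_big /= big_seq [RHS]big_seq; apply: eq_bigr => b /bsz_trs bn.
have lt_b : (nbB b < n.+2)%N by have := nbB_le b; rewrite bn; lia.
rewrite (bigD1 (Ordinal lt_b)) //= eqxx mul1r scalerA big1 ?addr0 // => j ne_j.
rewrite (_ : (nbB b == j) = false) ?mul0r ?scale0r ?scaler0 //.
by apply: contraNF ne_j => /eqP E'; apply/eqP/val_inj.
Qed.

Section Three.
Variables r beta h : seq A -> B.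
Hypotheses (rl : slotlin v r) (rr : rightlin v r).
Hypotheses (bl : slotlin v beta) (br : rightlin v beta).
Hypotheses (hl : slotlin v h) (hr : rightlin v h).
Hypothesis Hrb : ES r (chr (fun=> 1)) =1 ES beta (chr (fun b => (flat b)%:R)).
Hypothesis Hbh : ES beta (chr (fun b => (flat b)%:R)) =1 ES h (chr (hwt 1)).

Let sgB b : K := (-1) ^+ nbB b.

(** For each component, pruning it whole contributes 1 and keeping only its outer block contributes
    -1. *)
Lemma cut_r t : cutS (V := K^o) (fun=> 1) t (chr (fun b => - (flat b)%:R)) = (t == L)%:R.
Proof.
rewrite (cutS_chr (R := K^o) _ _ t) chr0 // => b.
rewrite (_ : cutB _ _ _ = -1 * cutB (V := K^o) (fun=> 1) b (fun b => (flat b)%:R)).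
  rewrite cutB_flat mulN1r /GRing.scale /= mulr1.
  suff -> : prodgaps (chr (fun=> 1)) b = 1 :> K by rewrite subrr.
  have chr1 t' : chr (fun=> 1) t' = 1 :> K.
    by elim: t' => //= ? _ ? ->; rewrite mulr1.
  by elim: b => //= ? _ ? ->; rewrite chr1 mulr1.
rewrite -(cut_mulr (R := K^o) _ _ _ _).2.
by apply: (eq_cut _ b).2 => b'; rewrite mulN1r.
Qed.

(** All these sums are right inverses of the same moments for the compositional product, so
    [star_unique] identifies them. *)
Lemma star_inverse :
  [/\ ES r (chr (fun b => - (flat b)%:R)) =1 ES beta (chr sgB),
      ES beta (chr sgB) =1 ES h (chr (hwt (-1)))
    & ES beta (chr sgB) =1 ES (fopp beta) (chr (fun=> 1))].
Proof.
have cut_b t : cutS (V := K^o) (fun b => (flat b)%:R) t (chr sgB) = (t == L)%:R.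
  rewrite -(cut_flat_sign K t).1; apply: (eq_cut _ t).1 => s; exact: chr_sign.
have cut_h t : cutS (V := K^o) (hwt 1) t (chr (hwt (-1))) = (t == L)%:R.
  by rewrite cutS_hwt // addNr chr0 // => b; apply: hwt0.
split.
- apply: (star_unique _ _ _ _ Hrb cut_r cut_b) => // w; by rewrite !ES_unit.
- apply: (star_unique _ _ _ _ Hbh cut_b cut_h) => // w; by rewrite !ES_unit.
by move=> w; rewrite ES_opp //; apply: eq_ES => t; apply: eq_chr => b; rewrite mulr1.
Qed.

Lemma EB_opp_flat f y w : EB f (fun b => - (flat b)%:R) (y :: w) = - f (y :: w).
Proof.
rewrite -[in RHS](EB_flat v) /EB -sumrN; apply: eq_bigr => b _.
by rewrite scaleNr.
Qed.

Lemma signS b : (-1) ^+ (nbB b).-1 = - (-1) ^+ nbB b :> K.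
Proof. by have := nbB_gt0 b; case: (nbB b) => //= n _; rewrite exprS mulN1r opprK. Qed.

Lemma EB_sign f (a : bt -> K) w :
  EB f (fun b => (-1) ^+ (nbB b).-1 * a b) w = - EB f (fun b => (-1) ^+ nbB b * a b) w.
Proof.
by rewrite /EB -sumrN; apply: eq_bigr => b _; rewrite signS mulNr scaleNr.
Qed.

Lemma relations y w :
  [/\ beta (y :: w) = EB r (fun=> 1) (y :: w),
      r (y :: w) = EB beta (fun b => (-1) ^+ (nbB b).-1) (y :: w),
      beta (y :: w) = EB h (fun b => (tauB b 0)%:R^-1) (y :: w)
    & r (y :: w) = EB h (fun b => (-1) ^+ (nbB b).-1 / (tauB b 0)%:R) (y :: w)].
Proof.
have [Nr Nb _] := star_inverse.
have rE : EB beta sgB (y :: w) = - r (y :: w) by rewrite -(ES_inj Nr) EB_opp_flat.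
have eqEB f (a a' : bt -> K) w' : a =1 a' -> EB f a w' = EB f a' w'.
  by move=> E; apply: eq_bigr => b _; rewrite E.
split.
- by rewrite (ES_inj Hrb) EB_flat.
- rewrite (eqEB _ _ (fun b => (-1) ^+ (nbB b).-1 * 1)); last by move=> b; rewrite mulr1.
  rewrite EB_sign (eqEB _ _ sgB); last by move=> b; rewrite mulr1.
  by rewrite rE opprK.
- rewrite -(EB_flat v) (ES_inj Hbh); apply: eqEB => b.
  by rewrite /hwt expr1n mul1r.
by rewrite EB_sign -(ES_inj Nb) rE opprK.
Qed.

Lemma relations_omega (W : nat -> bt -> K) n y w : size w = n ->
  (forall k b, (k <= n.+1)%N -> bsz b = n ->
     (OB k b)%:R = \sum_(j < n.+2) 'C(k, j)%:R * W j b) ->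
  let om b := \sum_(1 <= j < n.+2) ((-1) ^+ j.+1 / j%:R) * W j b in
  h (y :: w) = EB beta om (y :: w) /\
  h (y :: w) = EB r (fun b => (-1) ^+ (nbB b).-1 * om b) (y :: w).
Proof.
move=> sw HW om; split; first exact: omega_relation.
have [Nr Nb _] := star_inverse.
(* The inverse of the moments has [fopp r] as its Boolean and [fopp h] as its monotone cumulants, so
   the relation just proved applies to this pair. *)
rewrite EB_sign -EB_opp //; apply: oppr_inj; rewrite opprK.
rewrite -[LHS]/(fopp h (y :: w)); apply: omega_relation => //;
  try exact: slotlin_opp; try exact: rightlin_opp.
move=> u; rewrite !ES_opp //.
transitivity (ES h (chr (hwt (-1))) u).
  rewrite -Nb -Nr; apply: eq_ES => t; apply: eq_chr => b; rewrite -nbB1.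
  by case: eqP => [->|_]; rewrite ?expr1 ?mulN1r // oppr0 mulr0.
apply: eq_ES => t; apply: eq_chr => b.
by rewrite /hwt expr1n mul1r.
Qed.

End Three.
End MainRelations.

(** * Labelled evaluation and existence of cumulants *)

Section SeqSlots.
Variable T : Type.
Implicit Types (p q w : seq T) (y x : T).

Lemma take_slot_lt k p y q : (size p < k)%N ->
  take k (p ++ y :: q) = p ++ y :: take (k - size p).-1 q.
Proof.
move=> lt_pk; rewrite take_cat ltnNge ltnW //=.
by case E: (k - size p)%N => [|m] //; lia.
Qed.

Lemma drop_slot_lt k p y q : (size p < k)%N ->
  drop k (p ++ y :: q) = drop (k - size p).-1 q.
Proof.
move=> lt_pk; rewrite drop_cat ltnNge ltnW //=.
by case E: (k - size p)%N => [|m] //; lia.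
Qed.

Lemma take_slot_ge k p y q : (k <= size p)%N -> take k (p ++ y :: q) = take k p.
Proof. by move=> le_kp; rewrite takel_cat. Qed.

Lemma drop_slot_ge k p y q : (k <= size p)%N ->
  drop k (p ++ y :: q) = drop k p ++ y :: q.
Proof.
move=> le_kp; rewrite drop_cat; case: ltnP => // le_pk.
have -> : k = size p by apply/eqP; rewrite eqn_leq le_kp.
by rewrite subnn drop_size.
Qed.

Lemma take_rcons_le k w x : (k <= size w)%N -> take k (rcons w x) = take k w.
Proof. by move=> le_kw; rewrite -cats1 takel_cat. Qed.

Lemma drop_rcons_le k w x : (k <= size w)%N -> drop k (rcons w x) = rcons (drop k w) x.
Proof. by move=> le_kw; rewrite -!cats1 drop_slot_ge. Qed.

End SeqSlots.

(* The word of block labels; a block is labelled by the position of its first point. *)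
Fixpoint wdS (i : nat) (t : bt) : seq nat :=
  if t is N b s then wdB i i b ++ wdS (i + bsz b).+1 s else [::]
with wdB (o i : nat) (t : bt) : seq nat :=
  if t is N g b then o :: wdS i.+1 g ++ wdB o (i.+1 + bsz g) b else [:: o].

Lemma size_wd t : (forall i, size (wdS i t) = bsz t) /\
  (forall o i, size (wdB o i t) = (bsz t).+1).
Proof.
elim: t => //= l [IHlS IHlB] r [IHrS IHrB]; split=> [i|o i];
  by rewrite size_cat ?IHlB ?IHrS ?IHlS ?IHrB; lia.
Qed.

Lemma size_wdS i t : size (wdS i t) = bsz t. Proof. exact: (size_wd t).1. Qed.

Lemma size_wdB o i t : size (wdB o i t) = (bsz t).+1. Proof. exact: (size_wd t).2. Qed.

Lemma mem_wd t : (forall i a, a \in wdS i t -> (i <= a < i + bsz t)%N) /\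
  (forall o i a, a \in wdB o i t -> (a == o) || (i < a <= i + bsz t)%N).
Proof.
elim: t => [|l [IHlS IHlB] r [IHrS IHrB]] /=; split=> //.
- by move=> o i a; rewrite inE => ->.
- move=> i a; rewrite mem_cat => /orP[/IHlB|/IHrS]; last by lia.
  by case/orP => [/eqP->|]; lia.
move=> o i a; rewrite inE => /orP[-> //|]; rewrite mem_cat => /orP[/IHlS|/IHrB].
  by move=> H; apply/orP; right; lia.
by case/orP => [-> //|H]; apply/orP; right; lia.
Qed.

Fixpoint comb (n : nat) : bt := if n is n'.+1 then N L (comb n') else L.

Lemma bsz_comb n : bsz (comb n) = n. Proof. by elim: n => //= n ->. Qed.

Lemma flatE b : flat b -> b = comb (bsz b).
Proof. by elim: b => //= g _ b IHb /andP[/eqP-> /IHb {1}->]. Qed.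

Lemma flat_comb n : flat (comb n). Proof. by elim: n. Qed.

(* Largest block size; a block under construction already has k letters. *)
Fixpoint mbS (t : bt) : nat := if t is N b s then maxn (mbB 0 b) (mbS s) else 0
with mbB (k : nat) (t : bt) : nat :=
  if t is N g b then maxn (mbS g) (mbB k.+1 b) else k.+1.

Lemma mb_le t : (mbS t <= bsz t)%N /\ (forall k, (mbB k t <= k + (bsz t).+1)%N).
Proof.
elim: t => [|l [IHlS IHlB] r [IHrS IHrB]] /=; split=> //.
- by move=> k; rewrite addn1.
- by have := IHlB 0%N; lia.
by move=> k; have := IHrB k.+1; lia.
Qed.

Lemma mb_lt b : ~~ flat b -> forall k, (mbB k b < k + (bsz b).+1)%N.
Proof.
elim: b => //= g _ b IHb; rewrite negb_and => H k.
have [gS _] := mb_le g; have [_ bB] := mb_le b.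
case/orP: H => [ng|nb]; last by have := IHb nb k.+1; lia.
by have := bB k.+1; case: g ng gS => //=; lia.
Qed.

Section LabelledEval.
Variables (K : fieldType) (A B : algType K) (v : {lrmorphism B -> A}).
Implicit Types (f : seq A -> B) (F G : nat -> seq A -> B) (t s : bt).
Implicit Types (w acc u p q : seq A).

(** Each block uses the map attached to its own label, as is needed to differentiate at one
    block. *)
Fixpoint evLS F i t w : B :=
  if t is N b s
  then evLB F i i b [::] (take (bsz b).+1 w) * evLS F (i + bsz b).+1 s (drop (bsz b).+1 w)
  else 1
with evLB F o i t acc w : B :=
  if t is N g b
  then evLB F o (i.+1 + bsz g) b
         (rcons acc (head 0 w * v (evLS F i.+1 g (take (bsz g) (behead w)))))
         (drop (bsz g) (behead w))
  else F o (rcons acc (head 0 w)).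

Lemma evL_const f t : (forall i w, evLS (fun=> f) i t w = evS v f t w) /\
  (forall o i acc w, evLB (fun=> f) o i t acc w = evB v f t acc w).
Proof.
elim: t => //= l [IHlS IHlB] r [IHrS IHrB]; split=> [i w|o i acc w].
  by rewrite IHlB IHrS.
by rewrite IHlS IHrB.
Qed.

Lemma evL_agree F G t :
  (forall i w, (forall o u, o \in wdS i t -> (0 < size u <= mbS t)%N -> F o u = G o u) ->
     evLS F i t w = evLS G i t w) /\
  (forall o i acc w,
     (forall a u, a \in wdB o i t -> (0 < size u <= mbB (size acc) t)%N -> F a u = G a u) ->
     evLB F o i t acc w = evLB G o i t acc w).
Proof.
elim: t => [|l [IHlS IHlB] r [IHrS IHrB]] /=; split=> //.
- by move=> o i acc w H; apply: H; rewrite ?inE ?size_rcons /=.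
- move=> i w H; congr (_ * _).
    apply: IHlB => a u ain /andP[u0 u1]; apply: H; rewrite ?mem_cat ?ain //.
    by rewrite u0 leq_max u1.
  apply: IHrS => a u ain /andP[u0 u1]; apply: H; rewrite ?mem_cat ?ain ?orbT //.
  by rewrite u0 leq_max u1 orbT.
move=> o i acc w H; rewrite (IHlS i.+1 _); last first.
  move=> a u ain /andP[u0 u1]; apply: H; rewrite ?inE ?mem_cat ?ain ?orbT //.
  by rewrite u0 leq_max u1.
apply: IHrB => a u ain; rewrite size_rcons => /andP[u0 u1].
apply: H; rewrite ?inE ?mem_cat ?ain ?orbT //.
by rewrite u0 leq_max u1 orbT.
Qed.

Lemma ev_agree f g t w : (forall u, (0 < size u <= mbS t)%N -> f u = g u) ->
  evS v f t w = evS v g t w.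
Proof.
move=> E; rewrite -!((evL_const _ t).1 0%N); apply: (evL_agree _ _ t).1 => _ u _.
exact: E.
Qed.

Lemma evL_left F t : (forall o, leftlin v (F o)) ->
  (forall i b x w, t != L -> evLS F i t (v b * x :: w) = b * evLS F i t (x :: w)) /\
  (forall o i b x w, evLB F o i t [::] (v b * x :: w) = b * evLB F o i t [::] (x :: w)) /\
  (forall o i b y acc w, evLB F o i t (v b * y :: acc) w = b * evLB F o i t (y :: acc) w).
Proof.
move=> Fl; elim: t => [|l [IHlS [IHlB IHlA]] r [IHrS [IHrB IHrA]]] /=.
  by split=> //; split=> *; rewrite Fl.
split; first by move=> i b x w _; rewrite IHlB mulrA.
split=> [o i b x w|o i b y acc w]; last exact: IHrA.
by rewrite -mulrA IHrA.
Qed.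

Lemma evS_left f t b x w : leftlin v f -> t != L ->
  evS v f t (v b * x :: w) = b * evS v f t (x :: w).
Proof.
move=> fl tL; rewrite -!((evL_const _ t).1 0%N).
by apply: (evL_left t _).1 => // _.
Qed.

Lemma evB_comb f n acc w : size w = n.+1 -> evB v f (comb n) acc w = f (acc ++ w).
Proof.
elim: n acc w => [|n IHn] acc [|y w] //= [sw].
  by case: w sw => // _; rewrite cats1.
by rewrite drop0 rmorph1 mulr1 IHn // cat_rcons.
Qed.

Lemma evS_comb f n w : size w = n.+1 -> evS v f (N (comb n) L) w = f w.
Proof. by move=> sw; rewrite /= mulr1 bsz_comb take_oversize ?sw // evB_comb. Qed.

Lemma ev_slot f t : slotlin v f ->
  (forall p q y z c, cen v c -> size (p ++ y :: q) = bsz t ->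
    evS v f t (p ++ (y * v c + z) :: q) =
    evS v f t (p ++ y :: q) * c + evS v f t (p ++ z :: q)) /\
  (forall acc p q y z c, cen v c -> size (p ++ y :: q) = (bsz t).+1 ->
    evB v f t acc (p ++ (y * v c + z) :: q) =
    evB v f t acc (p ++ y :: q) * c + evB v f t acc (p ++ z :: q)).
Proof.
move=> fl; elim: t => [|l [IHlS IHlB] r [IHrS IHrB]].
  split=> [p q y z c cc|acc p q y z c cc]; rewrite size_cat /=; first by lia.
  by case: p q => [|? ?] [|? ?] //= E; [rewrite -!cats1 fl | lia..].
split=> [p q y z c cc E|acc p q y z c cc E].
  have [lt|le] := ltnP (size p) (bsz l).+1 => /=.
    rewrite !(take_slot_lt _ _ lt) !(drop_slot_lt _ _ lt) IHlB //; last first.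
      move: E; rewrite !size_cat /= size_take_min; lia.
    by rewrite mulrDl -!mulrA cc.1.
  rewrite !(take_slot_ge _ _ le) !(drop_slot_ge _ _ le) IHrS //; last first.
    by move: E; rewrite !size_cat /= size_drop; lia.
  by rewrite mulrDr mulrA.
case: p E => [|x p] E /=.
  rewrite mulrDl -mulrA -rmorphM -cc.1 rmorphM mulrA.
  by rewrite evB_slot_last.
have [lt|le] := ltnP (size p) (bsz l).
  rewrite !(take_slot_lt _ _ lt) !(drop_slot_lt _ _ lt) IHlS //; last first.
    by move: E; rewrite !size_cat /= size_take_min; lia.
  by rewrite rmorphD rmorphM mulrDr mulrA evB_slot_last.
rewrite !(take_slot_ge _ _ le) !(drop_slot_ge _ _ le) IHrB //.
by move: E; rewrite !size_cat /= size_drop; lia.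
Qed.

Lemma ev_right f t : rightlin v f ->
  (forall w x c, (size w).+1 = bsz t ->
    evS v f t (rcons w (x * v c)) = evS v f t (rcons w x) * c) /\
  (forall acc w x c, size w = bsz t ->
    evB v f t acc (rcons w (x * v c)) = evB v f t acc (rcons w x) * c).
Proof.
move=> fr; elim: t => [|l [IHlS IHlB] r [IHrS IHrB]].
  by split=> // acc [|//] x c _ /=; rewrite fr.
split=> [w x c /= [E]|acc w x c /= E].
  case: r IHrS IHrB E => [|r1 r2] IHrS IHrB E.
    rewrite !take_oversize ?size_rcons; try by rewrite E addn0.
    by rewrite IHlB ?mulr1 // E addn0.
  have le : ((bsz l).+1 <= size w)%N by rewrite E /=; lia.
  rewrite !take_rcons_le // !drop_rcons_le // IHrS ?mulrA //.
  by rewrite size_drop E /=; lia.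
case: w E => [|y w] //= [E].
have le : (bsz l <= size w)%N by rewrite E; lia.
by rewrite !take_rcons_le // !drop_rcons_le // IHrB // size_drop E; lia.
Qed.

Lemma big_trs_comb (V : nmodType) n (H : bt -> V) :
  \sum_(t <- trs n.+1) H t =
  H (N (comb n) L) + \sum_(t <- trs n.+1 | t != N (comb n) L) H t.
Proof.
rewrite (bigD1_seq (N (comb n) L)) ?uniq_trs //.
by rewrite mem_trs /= bsz_comb addn0.
Qed.

(** Only the one-block partition has a block of full size; this makes the moment-cumulant recursion
    well founded. *)
Lemma mbS_lt n t : bsz t = n.+1 -> t != N (comb n) L -> (mbS t <= n)%N.
Proof.
case: t => //= b s [sz] ne; have [_ bB] := mb_le b; have [sS _] := mb_le s.
have := bB 0%N; case: s sS sz ne => [|s1 s2] sS sz ne.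
  have fb : ~~ flat b.
    by apply: contraNN ne => /flatE ->; rewrite -sz addn0.
  by have := mb_lt fb 0; move: sz => /=; lia.
by move: sz sS => /=; lia.
Qed.

(** * Recursive construction of cumulants *)

Section Existence.
Variables (M : seq A -> B) (c : bt -> K).
Hypothesis Mgood : good v M.
Hypothesis c1 : forall n, c (N (comb n) L) = 1.

(** Solves the formula for its one-block term. [n] is fuel: the value is final on nonempty words of
    length at most [n], by [cumF_stable]. *)
Fixpoint cumF (n : nat) (w : seq A) : B :=
  if n is n'.+1 then
    M w - \sum_(t <- trs (size w) | t != N (comb (size w).-1) L)
            c t *: evS v (cumF n') t w
  else 0.

Lemma cumF_good n : good v (cumF n).
Proof.
elim: n => [|n [gs gl gr]] /=.
  by split=> [p q y z d cd|d y q|p y d]; rewrite /= ?mul0r ?mulr0 ?addr0.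
have [Ms Ml Mr] := Mgood; split=> [p q y z d cd|d y q|p y d] /=.
- have E x x' : size (p ++ x :: q) = size (p ++ x' :: q) by rewrite !size_cat.
  rewrite Ms // !(E (y * v d + z) y) !(E z y) mulrBl addrACA -opprD; congr (_ - _).
  rewrite mulr_suml -big_split /= [LHS]big_seq_cond [RHS]big_seq_cond.
  apply: eq_bigr => t /andP[/bsz_trs sz _].
  by rewrite (ev_slot t gs).1 // scalerDr scalerAl.
- rewrite Ml mulrBr mulr_sumr; congr (_ - _).
  rewrite [LHS]big_seq_cond [RHS]big_seq_cond.
  apply: eq_bigr => t /andP[/bsz_trs sz _].
  by rewrite evS_left ?scalerAr //; case: t sz.
rewrite Mr mulrBl mulr_suml !size_rcons; congr (_ - _).
rewrite [LHS]big_seq_cond [RHS]big_seq_cond.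
apply: eq_bigr => t /andP[/bsz_trs sz _].
by rewrite (ev_right t gr).1 // scalerAl.
Qed.

Definition cumulant w := cumF (size w) w.

Lemma cumF_stable n w : (0 < size w <= n)%N -> cumF n w = cumulant w.
Proof.
elim/ltn_ind: n w => n IHn w /andP[w0 wn]; rewrite /cumulant.
case: n IHn wn => [|n] IHn wn; first by lia.
case: w w0 wn => [|y w] // _ wn /=; congr (_ - _).
rewrite [LHS]big_seq_cond [RHS]big_seq_cond.
apply: eq_bigr => t /andP[/bsz_trs sz ne]; congr (_ *: _); apply: ev_agree => u.
have := mbS_lt sz ne; move=> le_mb /andP[u0 u1].
rewrite !IHn ?u0 //=; move: wn => /=; lia.
Qed.

Lemma cumulant_good : good v cumulant.
Proof.
split=> [p q y z d cd|d y q|p y d].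
- rewrite /cumulant.
  have E x x' : size (p ++ x :: q) = size (p ++ x' :: q) by rewrite !size_cat.
  rewrite (E (y * v d + z) y) (E z y).
  by have [gs _ _] := cumF_good (size (p ++ y :: q)); apply: gs.
- rewrite /cumulant [size (_ :: _)]/= [size (y :: q)]/=.
  by have [_ gl _] := cumF_good (size q).+1; apply: gl.
rewrite /cumulant !size_rcons.
by have [_ _ gr] := cumF_good (size p).+1; apply: gr.
Qed.

Lemma cumulantP y w : M (y :: w) = ES v cumulant c (y :: w).
Proof.
rewrite /ES [size _]/= big_trs_comb c1 scale1r evS_comb //.
rewrite {1}/cumulant /= addrAC -addrA.
rewrite [X in _ = M _ + X](_ : _ = 0) ?addr0 //; apply/eqP.
rewrite subr_eq0; apply/eqP.
rewrite [LHS]big_seq_cond [RHS]big_seq_cond.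
apply: eq_bigr => t /andP[/bsz_trs sz ne]; congr (_ *: _); apply: ev_agree => u.
move=> /andP[u0 u1]; have := mbS_lt sz ne => le_mb.
by rewrite cumF_stable // u0 (leq_trans u1).
Qed.

End Existence.
End LabelledEval.

Section Dual.
Variables (K : fieldType) (R : algType K).

(** * Dual numbers *)

(* The pair (a, b) stands for a + eps b. *)
Definition dual : Type := (R * R)%type.

HB.instance Definition _ := GRing.Lmodule.on dual.

Implicit Types x y z : dual.

Definition dual_one : dual := (1, 0).
Definition dual_mul x y : dual := (x.1 * y.1, x.1 * y.2 + x.2 * y.1).

Lemma dual_mulA : associative dual_mul.
Proof.
move=> x y z; rewrite /dual_mul /= mulrA; congr pair.
by rewrite mulrDr mulrDl !mulrA addrA.
Qed.

Lemma dual_mul1 : left_id dual_one dual_mul.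
Proof. by case=> a b; rewrite /dual_mul /= !mul1r mul0r addr0. Qed.

Lemma dual_mulr1 : right_id dual_one dual_mul.
Proof. by case=> a b; rewrite /dual_mul /= !mulr1 mulr0 add0r. Qed.

Lemma dual_mulDl : left_distributive dual_mul +%R.
Proof.
by move=> x y z; rewrite /dual_mul /= !mulrDl addrACA.
Qed.

Lemma dual_mulDr : right_distributive dual_mul +%R.
Proof.
by move=> x y z; rewrite /dual_mul /= !mulrDr addrACA.
Qed.

Lemma dual_one_neq0 : dual_one != 0.
Proof. by apply/eqP => -[] /eqP; rewrite oner_eq0. Qed.

HB.instance Definition _ := GRing.Zmodule_isNzRing.Build dual
  dual_mulA dual_mul1 dual_mulr1 dual_mulDl dual_mulDr dual_one_neq0.

Lemma dual_eqP x y : x.1 = y.1 -> x.2 = y.2 -> x = y.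
Proof. by case: x y => [a b] [c d] /= -> ->. Qed.

Lemma dualM1 x y : (x * y).1 = x.1 * y.1. Proof. by []. Qed.
Lemma dualM2 x y : (x * y).2 = x.1 * y.2 + x.2 * y.1. Proof. by []. Qed.
Lemma dualD1 x y : (x + y).1 = x.1 + y.1. Proof. by []. Qed.
Lemma dualD2 x y : (x + y).2 = x.2 + y.2. Proof. by []. Qed.
Lemma dualZ1 (a : K) x : (a *: x).1 = a *: x.1. Proof. by []. Qed.
Lemma dualZ2 (a : K) x : (a *: x).2 = a *: x.2. Proof. by []. Qed.

Lemma dual_scaleAl (a : K) x y : a *: (x * y) = (a *: x : dual) * y.
Proof.
apply: dual_eqP; first exact: scalerAl.
by rewrite dualZ2 !dualM2 dualZ1 dualZ2 scalerDr !scalerAl.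
Qed.

HB.instance Definition _ := GRing.Lmodule_isLalgebra.Build K dual dual_scaleAl.

Lemma dual_scaleAr (a : K) x y : a *: (x * y) = x * (a *: y : dual).
Proof.
apply: dual_eqP; first exact: scalerAr.
by rewrite dualZ2 !dualM2 dualZ1 dualZ2 scalerDr !scalerAr.
Qed.

HB.instance Definition _ := GRing.Lalgebra_isAlgebra.Build K dual dual_scaleAr.

Lemma dual_sum1 (I : Type) (r : seq I) (P : pred I) (F : I -> dual) :
  (\sum_(i <- r | P i) F i).1 = \sum_(i <- r | P i) (F i).1.
Proof. by apply: (big_morph fst dualD1). Qed.
Lemma dual_sum2 (I : Type) (r : seq I) (P : pred I) (F : I -> dual) :
  (\sum_(i <- r | P i) F i).2 = \sum_(i <- r | P i) (F i).2.
Proof. by apply: (big_morph snd dualD2). Qed.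

Definition inj (a : R) : dual := (a, 0).
Definition eps : dual := (0, 1).

End Dual.

Section DualMap.
Variables (K : fieldType) (A B : algType K).

Definition dual_map (f : B -> A) (x : dual B) : dual A := (f x.1, f x.2).

Section Morphism.
Variable v : {lrmorphism B -> A}.

Lemma dual_map_linear : linear (dual_map v).
Proof. by move=> a x y; apply: dual_eqP; apply: linearP. Qed.

HB.instance Definition _ := GRing.isLinear.Build K (dual B) (dual A) _ (dual_map v)
  dual_map_linear.

Lemma dual_map_monoid : monoid_morphism (dual_map v).
Proof.
split=> [|x y]; apply: dual_eqP; first exact: rmorph1.
- exact: rmorph0.
- exact: rmorphM.
transitivity (v (x.1 * y.2 + x.2 * y.1)); first by [].
by rewrite rmorphD !rmorphM.
Qed.

HB.instance Definition _ := GRing.isMonoidMorphism.Build (dual B) (dual A) (dual_map v)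
  dual_map_monoid.

End Morphism.
End DualMap.

Fixpoint labS (i : nat) (t : bt) : seq nat :=
  if t is N b s then i :: labR i b ++ labS (i + bsz b).+1 s else [::]
with labR (i : nat) (t : bt) : seq nat :=
  if t is N g b then labS i.+1 g ++ labR (i.+1 + bsz g) b else [::].

Lemma mem_lab t : (forall i a, a \in labS i t -> (i <= a < i + bsz t)%N) /\
  (forall i a, a \in labR i t -> (i < a <= i + bsz t)%N).
Proof.
elim: t => [|l [IHlS IHlB] r [IHrS IHrB]] /=; split=> // i a.
  rewrite inE mem_cat => /orP[/eqP->|/orP[/IHlB|/IHrS]]; lia.
by rewrite mem_cat => /orP[/IHlS|/IHrB]; lia.
Qed.

(** * The Leibniz rule in eps *)

Section DualEval.
Variables (K : fieldType) (A B : algType K) (v : {lrmorphism B -> A}).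
Let vd : {lrmorphism dual B -> dual A} := dual_map v.
Variable f : seq (dual A) -> dual B.
Hypothesis fgood : good vd f.
Implicit Types (x w acc : seq A).

Definition part1 x : B := (f (map (@inj K A) x)).1.
Definition part2 x : B := (f (map (@inj K A) x)).2.

Lemma injM (a b : A) : inj (a * b) = inj a * inj b :> dual A.
Proof. by apply: dual_eqP => //; rewrite dualM2 /= mulr0 mul0r addr0. Qed.

Lemma injD (a b : A) : inj (a + b) = inj a + inj b :> dual A.
Proof. by apply: dual_eqP => //; rewrite dualD2 /= addr0. Qed.

Lemma vd_inj (b : B) : vd (inj b) = inj (v b).
Proof. by apply: dual_eqP => //=; rewrite /dual_map /= rmorph0. Qed.

Lemma cen_inj (c : B) : cen v c -> cen vd (inj c).
Proof.
case=> cB cA; split=> [x|x].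
  by apply: dual_eqP; rewrite ?dualM1 ?dualM2 /= ?mulr0 ?mul0r ?add0r ?addr0 cB.
rewrite vd_inj.
by apply: dual_eqP; rewrite ?dualM1 ?dualM2 /= ?mulr0 ?mul0r ?add0r ?addr0 cA.
Qed.

Lemma cen_eps : cen vd (eps B).
Proof.
split=> x; apply: dual_eqP; rewrite ?dualM1 ?dualM2 /= ?rmorph0 ?rmorph1;
  by rewrite ?mulr0 ?mul0r ?mul1r ?mulr1 ?add0r ?addr0.
Qed.

Lemma mul_eps (x : dual B) : x * eps B = (0, x.1).
Proof.
by apply: dual_eqP; rewrite ?dualM1 ?dualM2 /= ?mulr0 ?mulr1 ?addr0.
Qed.

Lemma dual_decomp (y : dual A) : y = inj y.2 * vd (eps B) + inj y.1.
Proof.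
apply: dual_eqP; rewrite ?dualD1 ?dualD2 ?dualM1 ?dualM2 /= ?rmorph0 ?rmorph1;
  by rewrite ?mulr0 ?mul0r ?mul1r ?mulr1 ?add0r ?addr0.
Qed.

Lemma part1_slotlin : slotlin v part1.
Proof.
have [fs _ _] := fgood => p q y z c cc.
rewrite /part1 !map_cat /= injD injM -vd_inj fs; last exact: cen_inj.
by rewrite dualD1 dualM1.
Qed.

Lemma part1_leftlin : leftlin v part1.
Proof.
have [_ fl _] := fgood => b y q.
by rewrite /part1 /= injM -vd_inj fl dualM1.
Qed.

Lemma part2_leftlin : leftlin v part2.
Proof.
have [_ fl _] := fgood => b y q.
by rewrite /part2 /= injM -vd_inj fl dualM2 /= mul0r addr0.
Qed.

(** The eps-part of an argument comes out as a factor eps, which has no first component. *)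
Lemma f_part1 (w : seq (dual A)) : (f w).1 = part1 (map fst w).
Proof.
rewrite /part1.
suff E p : (f (p ++ w)).1 = (f (p ++ map (@inj K A) (map fst w))).1 by apply: (E [::]).
have [fs _ _] := fgood.
elim: w p => [|y w IHw] p //=; rewrite -[in RHS]cat_rcons -IHw cat_rcons.
rewrite {1}(dual_decomp y) fs; last exact: cen_eps.
by rewrite dualD1 mul_eps /= add0r.
Qed.

Definition split_fam (V : nat) : nat -> seq A -> B :=
  fun o => if o == V then part2 else part1.

Lemma head_inj w : head 0 (map (@inj K A) w) = inj (head 0 w).
Proof. by case: w. Qed.

Lemma behead_inj w : behead (map (@inj K A) w) = map (@inj K A) (behead w).
Proof. by case: w. Qed.

Lemma dual_ev1 t :
  (forall w, (evS vd f t (map (@inj K A) w)).1 = evS v part1 t w) /\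
  (forall (acc : seq (dual A)) w,
    (evB vd f t acc (map (@inj K A) w)).1 = evB v part1 t (map fst acc) w).
Proof.
elim: t => [|l [IHlS IHlB] r [IHrS IHrB]]; split=> [w|acc w] //.
- by rewrite /= f_part1 map_rcons head_inj.
- by rewrite [evS vd f _ _]/= dualM1 -map_take -map_drop IHlB IHrS.
rewrite [evB vd f _ _ _]/= behead_inj -map_take -map_drop IHrB map_rcons head_inj dualM1.
by rewrite [(dual_map _ _).1]/= IHlS.
Qed.

Lemma evL_split V t :
  (forall i w, V \notin wdS i t -> evLS v (split_fam V) i t w = evS v part1 t w) /\
  (forall o i acc w, V \notin wdB o i t ->
     evLB v (split_fam V) o i t acc w = evB v part1 t acc w).
Proof.
split=> [i w|o i acc w] Vn.
  rewrite -((evL_const v part1 t).1 i); apply: (evL_agree _ _ _ _).1 => o u oin _.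
  by rewrite /split_fam; case: eqP => // E; rewrite -E oin in Vn.
rewrite -((evL_const v part1 t).2 o i); apply: (evL_agree _ _ _ _).2 => a u oin _.
by rewrite /split_fam; case: eqP => // E; rewrite -E oin in Vn.
Qed.

(** The eps-component of a product differentiates one factor at a time, so a tree gives one term for
    each block. The bound on [o] keeps the outer label apart from the labels inside the gaps. *)
Lemma dual_ev2 t :
  (forall i w, (evS vd f t (map (@inj K A) w)).2 =
     \sum_(V <- labS i t) evLS v (split_fam V) i t w) /\
  (forall o i acc w, (o <= i)%N ->
    (evB vd f t (map (@inj K A) acc) (map (@inj K A) w)).2 =
     \sum_(V <- o :: labR i t) evLB v (split_fam V) o i t acc w).
Proof.
have [fs _ _] := fgood.
elim: t => [|l [IHlS IHlB] r [IHrS IHrB]]; split=> [i w|o i acc w oi].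
- by rewrite big_nil.
- by rewrite big_seq1 /= /split_fam eqxx /part2 map_rcons head_inj.
- rewrite [evS _ _ _ _]/= dualM2 -map_take -map_drop.
  rewrite (dual_ev1 l).2 (dual_ev1 r).1 /= (IHlB i i [::]) //.
  rewrite (IHrS (i + bsz l).+1) -cat_cons big_cat /= addrC; congr (_ + _).
    rewrite mulr_sumr big_seq [RHS]big_seq; apply: eq_bigr => V Vin.
    congr (_ * _); rewrite (evL_split _ _).2 //.
    apply/negP => /(mem_wd l).2 /orP[/eqP E|]; move/(mem_lab r).1: Vin; rewrite ?E; lia.
  rewrite mulr_suml big_seq [RHS]big_seq; apply: eq_bigr => V Vin.
  congr (_ * _); rewrite (evL_split _ _).1 //.
  apply/negP => /(mem_wd r).1; move: Vin; rewrite inE => /orP[/eqP->|]; first by lia.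
  by move=> /(mem_lab l).2; lia.
rewrite [evB _ _ _ _ _]/= behead_inj -map_take -map_drop head_inj.
set w1 := take _ _; set w2 := drop _ _.
set e := evS vd f l _; set x0 := head 0 w.
rewrite -[dual_map v e]/(vd e).
(* The eps-part of the gap is written with the central factor eps, which slot linearity moves out:
   the first term differentiates inside the gap, the second elsewhere. *)
have -> : inj x0 * vd e = inj (x0 * v e.2) * vd (eps B) + inj (x0 * v e.1).
  rewrite [LHS]dual_decomp; congr (inj _ * _ + inj _).
  by rewrite dualM2 /= mul0r addr0.
rewrite evB_slot_last //; last exact: cen_eps.
rewrite dualD2 mul_eps [(0, _).2]/= -!map_rcons (IHrB o (i.+1 + bsz l)%N); last by lia.
rewrite (dual_ev1 r).2 -map_comp map_id.
rewrite /e (IHlS i.+1) (dual_ev1 l).1.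
rewrite (eq_bigr (fun V => (1 : K) *: evLS v (split_fam V) i.+1 l w1)); last first.
  by move=> V _; rewrite scale1r.
rewrite evB_last_sum; last exact: part1_slotlin.
rewrite [RHS]/= !big_cons big_cat /= addrCA; congr (_ + (_ + _)).
- rewrite (evL_split o l).1 //.
  by apply/negP => /(mem_wd l).1; lia.
- rewrite big_seq [RHS]big_seq; apply: eq_bigr => V Vin.
  rewrite scale1r (evL_split _ _).2 //.
  apply/negP => /(mem_wd r).2 /orP[/eqP E|]; move/(mem_lab l).1: Vin; rewrite ?E; lia.
rewrite big_seq [RHS]big_seq; apply: eq_bigr => V Vin.
rewrite [in RHS](evL_split _ _).1 //.
by apply/negP => /(mem_wd l).1; move/(mem_lab r).2: Vin; lia.
Qed.

End DualEval.

Lemma find_iota (p : pred nat) l n : (l < n)%N -> p l ->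
  (forall j, (j < l)%N -> ~~ p j) -> find p (iota 0 n) = l.
Proof.
move=> lt_ln pl np; have -> : n = (l + (n - l).-1.+1)%N by lia.
rewrite iotaD find_cat size_iota.
rewrite (negPf (_ : ~~ has p (iota 0 l))) /= ?add0n ?pl ?addn0 //.
by apply/hasPn => j; rewrite mem_iota => /andP[_]; apply: np.
Qed.

Lemma map_inj_in (T T' : eqType) (phi : T -> T') (t w1 w2 : seq T) :
  {in t &, injective phi} -> {subset w1 <= t} -> {subset w2 <= t} ->
  map phi w1 = map phi w2 -> w1 = w2.
Proof.
move=> phiI; elim: w1 w2 => [|a w1 IHw] [|b w2] //= s1 s2 [Eab Ew].
have -> : a = b by apply: phiI => //; [apply: s1|apply: s2]; rewrite inE eqxx.
by rewrite (IHw w2) // => c cw; [apply: s1|apply: s2]; rewrite inE cw orbT.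
Qed.

Section SubalgebraEmbedding.
Variables (K : fieldType) (A : algType K) (SB : {pred A}) (B : subAlgType SB).

Definition emb (b : B) : A := val b.

Lemma emb_linear : linear emb.
Proof. by move=> a x y; rewrite /emb linearP. Qed.

Lemma emb_monoid : monoid_morphism emb.
Proof. by split=> [|x y]; rewrite /emb ?rmorph1 ?rmorphM. Qed.

HB.instance Definition _ := GRing.isLinear.Build K B A _ emb emb_linear.
HB.instance Definition _ := GRing.isMonoidMorphism.Build B A emb emb_monoid.

End SubalgebraEmbedding.

(** * The deletion recursion on words of block labels *)

Section ExtWord.
Variables (K : fieldType) (A : algType K) (SB : {pred A}) (B : subAlgType SB).
Let v : {lrmorphism B -> A} := @emb K A SB B.

Section Words.
Variable T : eqType.
Implicit Types (t u z : seq T) (F : T -> seq A -> B) (x w acc : seq A).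

Lemma interval_block_head u a k z : (0 < k)%N -> a \notin u -> a \notin z ->
  interval_block_at (u ++ nseq k a ++ z) (size u).
Proof.
move=> k0 au az; rewrite /interval_block_at drop_size_cat //.
have Ec : count_mem a (u ++ nseq k a ++ z) = k.
  rewrite !count_cat (count_memPn au) (count_memPn az) count_nseq /= eqxx.
  by rewrite mul1n addn0.
move: Ec; move: (u ++ _) => t Ec.
case: k k0 Ec => // k _ Ec; rewrite /= Ec.
by rewrite /= eqseq_cons eqxx take_size_cat ?size_nseq /= ?eqxx.
Qed.

(** A letter of [u] occurs again in [z], beyond the letters [a], so its occurrences from [l] on
    cannot be consecutive: its block is still open. *)
Lemma interval_block_open u a k z l : (0 < k)%N -> a \notin u ->
  {subset u <= z} -> (l < size u)%N ->
  ~~ interval_block_at (u ++ nseq k a ++ z) l.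
Proof.
move=> k0 au uz lt_l; rewrite /interval_block_at.
case: u au uz lt_l => // c0 u'; set u := c0 :: u' => au uz lt_l.
set t := u ++ _; have Ed : drop l t = nth c0 u l :: drop l.+1 t.
  rewrite (drop_nth c0) /t; first by rewrite nth_cat lt_l.
  by rewrite size_cat; lia.
set b := nth c0 u l in Ed; rewrite Ed -Ed.
have bu : b \in u by apply: mem_nth.
have ab : a != b by apply: contraNneq au => ->.
set c := count_mem b t; apply/negP => /eqP E.
have cs : count_mem b (drop c (drop l t)) = 0%N.
  have: (count_mem b (drop l t) <= c)%N.
    by rewrite /c -{2}(cat_take_drop l t) count_cat leq_addl.
  rewrite -{1}(cat_take_drop c (drop l t)) count_cat E count_nseq /= eqxx; lia.
have Et : drop l t = drop l u ++ nseq k a ++ z.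
  by rewrite /t drop_cat lt_l.
have [le_c|lt_c] := leqP c (size (drop l u)).
  move/count_memPn: cs; rewrite Et drop_cat.
  have: b \in z by apply: uz.
  case: ltnP => _ bz; last have -> : (c - size (drop l u))%N = 0%N by lia.
    by rewrite !mem_cat bz !orbT.
  by rewrite drop0 mem_cat bz orbT.
have: a \in take c (drop l t).
  rewrite Et take_cat ltnNge ltnW //= mem_cat.
  case E2: (c - size (drop l u))%N => [|c']; first by lia.
  by case: k k0 {t Ed c E cs Et lt_c E2} => //= k _; rewrite inE eqxx orbT.
by rewrite E mem_nseq (negPf ab) andbF.
Qed.

Lemma ext_word_const F m a k x : ext_word F m.+1 (nseq k.+1 a) x = F a x.
Proof. by rewrite /= all_pred1_nseq. Qed.

Lemma ext_wordS F m t x c : t != [::] -> ~~ constant t ->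
  let l := find (interval_block_at t) (iota 0 (size t)) in
  let a := nth (head c t) t l in
  let k := count_mem a t in
  ext_word F m.+1 t x =
  ext_word F m (take l t ++ drop (l + k) t) (absorb l k (v (F a (take k (drop l x)))) x).
Proof. by case: t => // a0 t' _ /negPf /= ct; rewrite ct. Qed.

Lemma ext_word_constant F m t x c : t != [::] -> constant t ->
  ext_word F m.+1 t x = F (head c t) x.
Proof. by case: t => // a0 t' _ /= ->. Qed.

Lemma ext_word_step F m u a k z xu y xa xz :
  (0 < k)%N -> a \notin u -> a \notin z -> {subset u <= z} ->
  size u = (size xu).+1 -> size xa = k ->
  ext_word F m.+1 (u ++ nseq k a ++ z) (rcons xu y ++ xa ++ xz) =
  ext_word F m (u ++ z) (rcons xu (y * v (F a xa)) ++ xz).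
Proof.
move=> k0 au az uz su sx.
have E : find (interval_block_at (u ++ nseq k a ++ z))
     (iota 0 (size (u ++ nseq k a ++ z))) = size u.
  apply: find_iota; first by rewrite !size_cat size_nseq; lia.
    exact: interval_block_head.
  by move=> j lt_j; apply: interval_block_open.
have cF : constant (u ++ nseq k a ++ z) = false.
  case: u su au {uz E} => // c u _; rewrite inE negb_or => /andP[ac _].
  apply/negP => /= /allP /(_ a); rewrite !mem_cat mem_nseq k0 eqxx orbT.
  by move/(_ isT)/eqP => Ea; rewrite Ea eqxx in ac.
have Ea c : nth c (u ++ nseq k a ++ z) (size u) = a.
  by rewrite nth_cat ltnn subnn; case: k k0 {sx E cF}.
have tn : u ++ nseq k a ++ z != [::] by rewrite -size_eq0 size_cat su.
have Ec : count_mem a (u ++ nseq k a ++ z) = k.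
  by rewrite !count_cat (count_memPn au) (count_memPn az) count_nseq /= eqxx; lia.
rewrite (ext_wordS F m _ a tn) ?cF // E Ea Ec.
rewrite take_size_cat // drop_cat ltnNge leq_addr /= addKn drop_size_cat ?size_nseq //.
congr (ext_word _ _ _ _).
rewrite drop_size_cat ?size_rcons ?su // take_size_cat // /absorb.
rewrite [in drop _ _]catA drop_size_cat ?size_cat ?size_rcons ?sx //.
by rewrite !cat_rcons take_size_cat // nth_cat ltnn subnn.
Qed.

(** A block at the left end has no letter before it, so its value multiplies the next argument from
    the left. *)
Lemma ext_word_first F m a k z xa y xz :
  (0 < k)%N -> a \notin z -> z != [::] -> size xa = k ->
  ext_word F m.+1 (nseq k a ++ z) (xa ++ y :: xz) =
  ext_word F m z (v (F a xa) * y :: xz).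
Proof.
move=> k0 az zn sx.
have E : find (interval_block_at (nseq k a ++ z)) (iota 0 (size (nseq k a ++ z))) = 0%N.
  apply: find_iota => //; first by rewrite size_cat size_nseq; lia.
  exact: (@interval_block_head [::]).
have cF : constant (nseq k a ++ z) = false.
  case: k k0 {sx E} => // k _; case: z zn az => // c z _; rewrite inE negb_or => /andP[ac _].
  apply/negP => /= /allP /(_ c); rewrite !mem_cat inE eqxx orbT.
  by move/(_ isT)/eqP => Ec; rewrite Ec eqxx in ac.
have Ec : count_mem a (nseq k a ++ z) = k.
  by rewrite !count_cat (count_memPn az) count_nseq /= eqxx; lia.
have tn : nseq k a ++ z != [::] by rewrite -size_eq0 size_cat size_nseq; lia.
rewrite (ext_wordS F m _ a tn) ?cF // E.
have -> c : nth c (nseq k a ++ z) 0 = a by case: k k0 {sx E Ec cF tn}.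
rewrite Ec take0 drop0 add0n drop_size_cat ?size_nseq //.
congr (ext_word _ _ _ _); rewrite /absorb take_size_cat //.
by rewrite nth_cat sx ltnn subnn /= -cat_rcons drop_size_cat // size_rcons sx.
Qed.

End Words.

Lemma ext_word_map (T T' : eqType) (phi : T -> T') (F : T' -> seq A -> B) m (t : seq T) x :
  {in t &, injective phi} ->
  ext_word F m (map phi t) x = ext_word (fun a => F (phi a)) m t x.
Proof.
elim: m t x => [|m IHm] [|a0 t'] x //; set t := a0 :: t' => phiI.
have cnt a : a \in t -> count_mem (phi a) (map phi t) = count_mem a t.
  move=> ta; rewrite count_map; apply: eq_in_count => b tb /=.
  by apply/eqP/eqP => [/phiI -> //|->].
have cst : constant (map phi t) = constant t.
  rewrite /= all_map; apply: eq_in_all => b tb /=.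
  apply/eqP/eqP => [/phiI ->|->] //; by rewrite inE ?eqxx ?tb ?orbT.
have ib l : interval_block_at (map phi t) l = interval_block_at t l.
  rewrite /interval_block_at -map_drop; case Ed: (drop l t) => [|a s] //.
  have ta : a \in t by rewrite -(cat_take_drop l t) mem_cat Ed inE eqxx orbT.
  rewrite map_cons cnt // -map_cons -map_take.
  rewrite -map_nseq; apply/eqP/eqP => [|-> //]; apply: (map_inj_in phiI) => b.
    by move/mem_take; rewrite -Ed => /mem_drop.
  by rewrite mem_nseq => /andP[_ /eqP->].
have [ct|ct] := boolP (constant t).
  by rewrite (ext_word_constant F m x (phi a0)) ?cst // (ext_word_constant _ m x a0).
rewrite (ext_wordS F m x (phi a0)) ?cst // (ext_wordS _ m x a0) //.
rewrite (eq_find ib) size_map -[head _ (map _ _)]/(phi a0) -[head _ t]/a0.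
set l := find _ _.
have nl : nth (phi a0) (map phi t) l = phi (nth a0 t l).
  have [lt_l|le_l] := ltnP l (size t); first exact: nth_map.
  by rewrite !nth_default ?size_map.
have tl : nth a0 t l \in t.
  have [lt_l|le_l] := ltnP l (size t); first exact: mem_nth.
  by rewrite nth_default // inE eqxx.
rewrite nl cnt // -map_take -map_drop -map_cat IHm // => b c.
by rewrite !mem_cat => /orP[/mem_take bt|/mem_drop bt] /orP[/mem_take dt|/mem_drop dt];
   apply: phiI.
Qed.

End ExtWord.

Lemma wdB_root o i t : o \in wdB o i t.
Proof. by case: t => *; rewrite inE eqxx. Qed.

Lemma nseq_cons (T : Type) k (a : T) s : nseq k a ++ a :: s = nseq k.+1 a ++ s.
Proof. by elim: k => //= k ->. Qed.

Section ExtWordTree.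
Variables (K : fieldType) (A : algType K) (SB : {pred A}) (B : subAlgType SB).
Let v : {lrmorphism B -> A} := @emb K A SB B.
Variable F : nat -> seq A -> B.
Implicit Types (u z : seq nat) (x w acc xu xz : seq A).

(* Evaluating the words of labels is a stack process: when the letters on the left
   of a subforest all reappear on its right, the leftmost interval block lies in the
   subforest, so that the subforest is absorbed first. *)
Lemma ext_word_forest t :
  (forall i u z xu y w xz R,
     (forall a, (i <= a < i + bsz t)%N -> (a \notin u) && (a \notin z)) ->
     {subset u <= z} -> size u = (size xu).+1 -> size w = bsz t ->
     (forall m, (size (u ++ z) <= m)%N ->
        ext_word F m (u ++ z) (rcons xu (y * v (evLS v F i t w)) ++ xz) = R) ->
     forall m, (size (u ++ wdS i t ++ z) <= m)%N ->
        ext_word F m (u ++ wdS i t ++ z) (rcons xu y ++ w ++ xz) = R) /\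
  (forall o i u z xu y acc w xz R,
     (o <= i)%N -> o \notin u -> o \notin z ->
     (forall a, (i < a <= i + bsz t)%N -> (a \notin u) && (a \notin z)) ->
     {subset u <= z} -> size u = (size xu).+1 -> size w = (bsz t).+1 ->
     (forall m, (size (u ++ z) <= m)%N ->
        ext_word F m (u ++ z) (rcons xu (y * v (evLB v F o i t acc w)) ++ xz) = R) ->
     forall m, (size (u ++ nseq (size acc) o ++ wdB o i t ++ z) <= m)%N ->
        ext_word F m (u ++ nseq (size acc) o ++ wdB o i t ++ z)
          (rcons xu y ++ acc ++ w ++ xz) = R).
Proof.
elim: t => [|g [IHgS IHgB] b [IHbS IHbB]]; split.
- move=> i u z xu y w xz R _ _ _ /size0nil -> H m le_m.
  by have := H m le_m; rewrite /= rmorph1 mulr1.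
- move=> o i u z xu y acc [|c [|//]] // xz R oi ou oz _ uz su _ H m.
  have -> : nseq (size acc) o ++ wdB o i L ++ z = nseq (size acc).+1 o ++ z.
    exact: nseq_cons.
  move=> le_m.
  rewrite [acc ++ _]catA.
  case: m le_m => [|m] le_m; first by move: le_m; rewrite !size_cat su.
  rewrite ext_word_step //; last by rewrite size_cat addn1.
  by rewrite cats1; apply: H; move: le_m; rewrite !size_cat size_nseq; lia.
- move=> i u z xu y w xz R Ha uz su sw H m /=; rewrite -catA => le_m.
  rewrite -(cat_take_drop (bsz g).+1 w) -catA.
  apply: (IHgB i i u (wdS (i + bsz g).+1 b ++ z) xu y [::]) => //.
  + by have /andP[] := Ha i ltac:(rewrite /=; lia).
  + rewrite mem_cat negb_or; have /andP[_ ->] := Ha i ltac:(rewrite /=; lia).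
    by rewrite andbT; apply/negP => /(mem_wd b).1; lia.
  + move=> a Hia; have /andP[-> az] := Ha a ltac:(rewrite /=; lia).
    by rewrite mem_cat negb_or az andbT; apply/negP => /(mem_wd b).1; lia.
  + by move=> a au; rewrite mem_cat uz ?orbT.
  + by rewrite size_takel // sw /=; lia.
  move=> m' le_m'; apply: IHbS => //.
  + by move=> a Hia; apply: Ha; rewrite /=; lia.
  + by rewrite size_drop sw /=; lia.
  by move=> m'' le_m''; rewrite -mulrA -rmorphM; apply: H.
move=> o i u z xu y acc [|w0 w] // xz R oi ou oz Ha uz su [sw] H m.
rewrite [wdB _ _ _]/= [(_ :: w) ++ _]/=.
have -> : nseq (size acc) o ++ (o :: wdS i.+1 g ++ wdB o (i.+1 + bsz g) b) ++ z =
   nseq (size acc).+1 o ++ wdS i.+1 g ++ wdB o (i.+1 + bsz g) b ++ z.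
  by rewrite cat_cons nseq_cons -catA.
rewrite catA => le_m.
rewrite -(cat_take_drop (bsz g) w).
have -> : rcons xu y ++ acc ++ w0 :: (take (bsz g) w ++ drop (bsz g) w) ++ xz =
  rcons (rcons xu y ++ acc) w0 ++ take (bsz g) w ++ drop (bsz g) w ++ xz.
  by rewrite -!cats1 -!catA.
apply: IHgS le_m.
- move=> a Hia; rewrite !mem_cat mem_nseq !negb_or /=.
  have /andP[-> ->] := Ha a ltac:(rewrite /=; lia); rewrite andbT /=.
  apply/andP; split; first by apply/eqP; lia.
  by apply/negP => /(mem_wd b).2 /orP[/eqP|]; lia.
- move=> a; rewrite !mem_cat mem_nseq => /orP[/uz ->|/andP[_ /eqP->]].
    by rewrite orbT.
  by rewrite wdB_root.
- by rewrite !size_cat size_nseq size_rcons; lia.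
- by rewrite size_takel // sw; lia.
move=> m' le_m'.
set e := w0 * _.
have -> : rcons (rcons xu y ++ acc) e ++ drop (bsz g) w ++ xz =
   rcons xu y ++ rcons acc e ++ drop (bsz g) w ++ xz.
  by rewrite rcons_cat -catA.
rewrite -[(u ++ _) ++ _]catA -(size_rcons acc e) in le_m' *.
apply: IHbB le_m' => //; first by lia.
- by move=> a Hia; apply: Ha; rewrite /=; lia.
- by rewrite size_drop sw; lia.
Qed.

(** A component at the left end of the word. Its value is the final result when nothing follows;
    otherwise it multiplies the next argument. The hypothesis on [R] is the continuation in these
    two cases. *)
Lemma ext_word_block t : forall o i z acc w xz R,
  (o <= i)%N -> o \notin z -> (forall a, (i < a <= i + bsz t)%N -> a \notin z) ->
  size w = (bsz t).+1 ->
  (forall m, (size z <= m)%N -> if z is [::] then xz = [::] /\ evLB v F o i t acc w = R else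
     exists y xz', xz = y :: xz' /\ ext_word F m z (v (evLB v F o i t acc w) * y :: xz') = R) ->
  forall m, (size (nseq (size acc) o ++ wdB o i t ++ z) <= m)%N ->
    ext_word F m (nseq (size acc) o ++ wdB o i t ++ z) (acc ++ w ++ xz) = R.
Proof.
elim: t => [|g _ b IHb] o i z acc [|w0 w] // xz R oi oz Ha [sw] H m.
  case: w sw H => // _ H; rewrite [wdB _ _ _]/= cat_cons cat0s nseq_cons.
  case: m => [|m] le_m; first by move: le_m; rewrite size_cat size_nseq.
  have /H : (size z <= m)%N by move: le_m; rewrite size_cat size_nseq; lia.
  rewrite catA; case: z oz {H le_m Ha} => [|c z] oz.
    by case=> -> <-; rewrite !cats0 ext_word_const /= cats1.
  case=> y [xz' [-> <-]]; rewrite ext_word_first ?size_cat ?addn1 //=.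
  by rewrite cats1.
rewrite [wdB _ _ _]/= !cat_cons nseq_cons -catA.
have -> : acc ++ w0 :: w ++ xz =
  rcons acc w0 ++ take (bsz g) w ++ drop (bsz g) w ++ xz.
  by rewrite cat_rcons [take _ _ ++ _]catA cat_take_drop.
move=> le_m; apply: (ext_word_forest g).1 le_m.
- move=> a Hia; rewrite !mem_cat mem_nseq !negb_or /=.
  have -> := Ha a ltac:(rewrite /=; lia); rewrite andbT /=.
  apply/andP; split; first by apply/eqP; lia.
  by apply/negP => /(mem_wd b).2 /orP[/eqP|]; lia.
- by move=> a; rewrite mem_nseq => /andP[_ /eqP->]; rewrite mem_cat wdB_root.
- by rewrite size_nseq.
- by rewrite size_takel // sw; lia.
set e := w0 * _ => m' le_m'.
rewrite -(size_rcons acc e) in le_m' *.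
apply: IHb le_m' => //; first by lia.
- by move=> a Hia; apply: Ha; rewrite /=; lia.
- by rewrite size_drop sw; lia.
Qed.

(** The recursion pushes the value of each component into the next one; left linearity turns this
    into the product of the values. *)
Lemma ext_word_wdS : (forall o, leftlin v (F o)) -> forall t i x m,
  t != L -> size x = bsz t -> (bsz t <= m)%N ->
  ext_word F m (wdS i t) x = evLS v F i t x.
Proof.
move=> Fl; elim=> // b _ s IHs i x m _ sx le_m.
rewrite [evLS _ _ _ _ _]/= -{1}(cat_take_drop (bsz b).+1 x) [wdS _ _]/=.
apply: (@ext_word_block b i i (wdS (i + bsz b).+1 s) [::]) => //.
- by apply/negP => /(mem_wd s).1; lia.
- by move=> a Ha; apply/negP => /(mem_wd s).1; lia.
- by rewrite size_takel // sx /=; lia.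
- move=> m' le_m'; case: s IHs sx le_m le_m' => [|b' s'] IHs sx le_m le_m'.
    by rewrite /= mulr1 drop_oversize // sx /=; lia.
  set s := N b' s' in IHs sx le_m le_m' *.
  have sd : size (drop (bsz b).+1 x) = bsz s by rewrite size_drop sx /=; lia.
  case Ed: (drop (bsz b).+1 x) sd => [|y xz] // sd.
  have := (evL_left s Fl).1 (i + bsz b).+1.
  move=> /(_ (evLB v F i i b [::] (take (bsz b).+1 x)) y xz isT) <-.
  case Ew: (wdS _ s) le_m' => [|c z] le_m'.
    by move/(congr1 size): Ew; rewrite size_wdS.
  by exists y, xz; split => //; rewrite -Ew IHs // -(size_wdS (i + bsz b).+1) Ew.
by rewrite /= size_cat size_wdB size_wdS; move: le_m => /=; lia.
Qed.

End ExtWordTree.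

Local Close Scope ring_scope.

(** * Trees and elements of NC(n) *)

(** Avoidance of the pattern abab, the form that the non-crossing condition takes on labels. *)
Definition nopat (w : seq nat) := forall i j k l, i < j < k -> k < l < size w ->
  nth 0 w i = nth 0 w k -> nth 0 w j = nth 0 w l -> nth 0 w i = nth 0 w j.

(** Since [v] shares no letter with the rest, two equal letters lie both inside [v] or both outside
    it, and [v] is contiguous. *)
Lemma nopat_insert u v z : nopat (u ++ z) -> nopat v ->
  (forall a, a \in v -> (a \notin u) && (a \notin z)) -> nopat (u ++ v ++ z).
Proof.
move=> Nuz Nv D.
pose inv p := size u <= p < size u + size v.
have nthv p : inv p -> nth 0 (u ++ v ++ z) p = nth 0 v (p - size u).
  by move=> /andP[up pv]; rewrite nth_cat ltnNge up /= nth_cat ltn_subLR // pv.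
pose q p := if p < size u then p else p - size v.
have nthuz p : ~~ inv p -> nth 0 (u ++ v ++ z) p = nth 0 (u ++ z) (q p).
  rewrite /inv /q negb_and -!ltnNge ltnS => /orP[lt_p|le_p].
    by rewrite lt_p !nth_cat lt_p.
  have -> : (p < size u) = false by lia.
  rewrite !nth_cat; have -> : (p < size u) = false by lia.
  have -> : (p - size u < size v) = false by lia.
  have -> : (p - size v < size u) = false by lia.
  by congr nth; lia.
have diff p p' : p < size (u ++ v ++ z) -> p' < size (u ++ v ++ z) -> inv p -> ~~ inv p' ->
    nth 0 (u ++ v ++ z) p = nth 0 (u ++ v ++ z) p' -> False.
  move=> sp sp' ip ip' E.
  have vin : nth 0 (u ++ v ++ z) p \in v.
    have lt_v : p - size u < size v by move: ip; rewrite /inv; lia.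
    by rewrite nthv // mem_nth.
  have lt_q : q p' < size (u ++ z).
    by move: sp' ip'; rewrite /inv /q !size_cat; case: ifP; lia.
  by have := D _ vin; rewrite E nthuz // -negb_or -mem_cat mem_nth.
move=> i j k l /andP[ij jk] /andP[kl ls] Eik Ejl.
case: (boolP (inv i)) => ii; case: (boolP (inv k)) => ik;
  try by case: (diff i k _ _ _ _ Eik); lia.
- have := Nv (i - size u) (j - size u) (k - size u) (l - size u).
  have ij' : inv j by move: ii ik; rewrite /inv; lia.
  case: (boolP (inv l)) => il; last by case: (diff j l _ _ _ _ Ejl); lia.
  move: Eik Ejl; rewrite !nthv // => Eik Ejl; apply=> //.
    by move: ii; rewrite /inv; lia.
  by move: il ik; rewrite /inv; lia.
- by case: (diff k i _ _ _ _ (esym Eik)); lia.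
case: (boolP (inv j)) => ij'; case: (boolP (inv l)) => il.
- by move: ij' ik il; rewrite /inv; lia.
- by case: (diff j l _ _ _ _ Ejl); lia.
- by case: (diff l j _ _ _ _ (esym Ejl)); lia.
move: Eik Ejl; rewrite !nthuz // => Eik Ejl; apply: (Nuz _ _ (q k) (q l)) => //;
  move: ii ij' ik il ls; rewrite /inv /q !size_cat; (do ! case: ifP); lia.
Qed.

Lemma nopat_nseq k o : nopat (nseq k o).
Proof.
move=> i j m l; rewrite size_nseq => /andP[ij jm] /andP[ml lk] _ _.
by rewrite !nth_nseq; do 2!case: ifP => //; lia.
Qed.

Lemma nopat_wd t : (forall i, nopat (wdS i t)) /\
  (forall o i k, o <= i -> nopat (nseq k o ++ wdB o i t)).
Proof.
elim: t => [|l [IHlS IHlB] r [IHrS IHrB]]; split=> [i|o i k oi].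
- by move=> ? ? ? ?; rewrite /= ltn0 andbF.
- by rewrite nseq_cons cats0; apply: nopat_nseq.
- rewrite -[wdS _ _]cats0 -catA; apply: nopat_insert => //.
    by rewrite cats0; apply: (IHlB i i 0).
  move=> a /(mem_wd r).1 Ha; rewrite andbT; apply/negP => /(mem_wd l).2.
  by move=> /orP[/eqP|]; lia.
rewrite [wdB _ _ _]/= nseq_cons; apply: nopat_insert => //.
  by apply: IHrB; lia.
move=> a /(mem_wd l).1 Ha; rewrite mem_nseq negb_and /=.
apply/andP; split; first by apply/eqP; lia.
by apply/negP => /(mem_wd r).2 /orP[/eqP|]; lia.
Qed.

(** Each label is the position of the first point of its block, which makes the word a normal form
    for the partition. *)
Lemma wd_canon t : (forall i p, p < bsz t -> let a := nth 0 (wdS i t) p in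
     a <= i + p /\ nth 0 (wdS i t) (a - i) = a) /\
  (forall o i p, o <= i -> p <= bsz t -> let a := nth 0 (wdB o i t) p in
     (a <= i + p) /\ (a != o -> nth 0 (wdB o i t) (a - i) = a)).
Proof.
elim: t => [|l [IHlS IHlB] r [IHrS IHrB]]; split=> //.
- by move=> o i [] //= oi _; rewrite addn0 eqxx.
- move=> i p ps a; have [lt_p|le_p] := leqP p (bsz l).
    have Ea : a = nth 0 (wdB i i l) p by rewrite /a nth_cat size_wdB ltnS lt_p.
    have [le_a Ea'] := IHlB i i p (leqnn i) lt_p; split; first by rewrite Ea.
    have [->|ne_a] := eqVneq a i; first by rewrite subnn /=; case: (l).
    rewrite nth_cat size_wdB; have -> : a - i < (bsz l).+1 by move: le_a; rewrite -Ea; lia.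
    by rewrite Ea; apply: Ea'; rewrite -Ea.
  have Ea : a = nth 0 (wdS (i + bsz l).+1 r) (p - (bsz l).+1).
    by rewrite /a nth_cat size_wdB ltnS leqNgt le_p.
  have lt_q : p - (bsz l).+1 < bsz r by move: ps => /=; lia.
  have [le_a Ea'] := IHrS (i + bsz l).+1 _ lt_q; split; first by rewrite Ea; lia.
  have : a \in wdS (i + bsz l).+1 r by rewrite Ea mem_nth // size_wdS.
  move=> /(mem_wd r).1 Ha; rewrite nth_cat size_wdB.
  have -> : (a - i < (bsz l).+1) = false by lia.
  by rewrite [RHS]Ea -[RHS]Ea' -Ea; congr nth; lia.
move=> o i [|p] oi ps a; first by split; [rewrite /a /= addn0 | rewrite /a /= eqxx].
have [lt_p|le_p] := ltnP p (bsz l).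
  have Ea : a = nth 0 (wdS i.+1 l) p by rewrite /a /= nth_cat size_wdS lt_p.
  have [le_a Ea'] := IHlS i.+1 _ lt_p; split; first by rewrite Ea; lia.
  have : a \in wdS i.+1 l by rewrite Ea mem_nth // size_wdS.
  move=> /(mem_wd l).1 Ha _; have -> : a - i = (a - i.+1).+1 by lia.
  rewrite /= nth_cat size_wdS; have -> : a - i.+1 < bsz l by lia.
  by rewrite [RHS]Ea -[RHS]Ea' -Ea.
have Ea : a = nth 0 (wdB o (i.+1 + bsz l) r) (p - bsz l).
  by rewrite /a /= nth_cat size_wdS ltnNge le_p.
have lt_q : p - bsz l <= bsz r by move: ps => /=; lia.
have oi' : o <= i.+1 + bsz l by lia.
have [le_a Ea'] := IHrB o (i.+1 + bsz l) _ oi' lt_q.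
split; first by rewrite Ea; lia.
move=> ne_a; have : a \in wdB o (i.+1 + bsz l) r by rewrite Ea mem_nth // size_wdB.
move=> /(mem_wd r).2; rewrite (negPf ne_a) /= => Ha.
have -> : a - i = (a - i.+1).+1 by lia.
rewrite /= nth_cat size_wdS; have -> : (a - i.+1 < bsz l) = false by lia.
by rewrite [RHS]Ea -[RHS]Ea' -?Ea //; congr nth; lia.
Qed.

Lemma cat_head_inj (T : eqType) (o : T) g g' z z' :
  o \notin g -> o \notin g' -> g ++ o :: z = g' ++ o :: z' -> g = g' /\ z = z'.
Proof.
elim: g g' => [|a g IHg] [|b g'] //=; rewrite ?inE ?negb_or.
- by move=> _ _ [->].
- by move=> _ /andP[/eqP ob _] [E _]; case: ob.
- by move=> /andP[/eqP oa _] _ [E _]; case: oa.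
by move=> /andP[_ og] /andP[_ og'] [-> /(IHg _ og og') [-> ->]].
Qed.

Lemma wdB_cons o i t : exists z, wdB o i t = o :: z.
Proof. by case: t => [|g b]; eexists. Qed.

Lemma wd_inj t : (forall i t', wdS i t = wdS i t' -> t = t') /\
  (forall o i t' z z', o <= i -> o \notin z -> o \notin z' ->
     wdB o i t ++ z = wdB o i t' ++ z' -> t = t' /\ z = z').
Proof.
have nil_wdB o i t' s : [::] = wdB o i t' ++ s -> False.
  by have [z ->] := wdB_cons o i t'.
elim: t => [|l [IHlS IHlB] r [IHrS IHrB]]; split=> [i [|l' r']|o i [|l' r'] z z' oi oz oz'] //.
- by move=> /nil_wdB.
- by case=> ->.
- case=> E; have := oz; rewrite E !mem_cat wdB_root //.
  by rewrite orbT.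
- by move/esym/nil_wdB.
- move=> /= E.
  have nr s : i \notin wdS (i + bsz s).+1 r by apply/negP => /(mem_wd r).1; lia.
  have nr' s : i \notin wdS (i + bsz s).+1 r' by apply/negP => /(mem_wd r').1; lia.
  have [El Er] := IHlB i i l' _ _ (leqnn i) (nr l) (nr' l') E.
  by move: Er; rewrite El => /IHrS ->.
- case=> E; have := oz'; rewrite -E !mem_cat wdB_root //.
  by rewrite orbT.
rewrite /= => -[]; rewrite -!catA.
have [y Ey] := wdB_cons o (i.+1 + bsz l) r.
have [y' Ey'] := wdB_cons o (i.+1 + bsz l') r'.
have nl : o \notin wdS i.+1 l by apply/negP => /(mem_wd l).1; lia.
have nl' : o \notin wdS i.+1 l' by apply/negP => /(mem_wd l').1; lia.
rewrite Ey Ey' !cat_cons => /(cat_head_inj nl nl') [El Ez].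
have Ell := IHlS _ _ El; rewrite -Ell in Ey' *.
have /IHrB : wdB o (i.+1 + bsz l) r ++ z = wdB o (i.+1 + bsz l) r' ++ z'.
  by rewrite Ey Ey' !cat_cons Ez.
by case=> // [|-> ->]; [lia|split].
Qed.

Definition canon i (w : seq nat) :=
  forall p, p < size w -> i <= nth 0 w p <= i + p /\ nth 0 w (nth 0 w p - i) = nth 0 w p.

Lemma nopat_sub u v z : nopat (u ++ v ++ z) -> nopat v.
Proof.
move=> N i j k l /andP[ij jk] /andP[kl ls] Eik Ejl.
have E p : p < size v -> nth 0 (u ++ v ++ z) (size u + p) = nth 0 v p.
  by move=> lt_p; rewrite nth_cat ltnNge leq_addr /= addKn nth_cat lt_p.
have := N (size u + i) (size u + j) (size u + k) (size u + l).
rewrite !size_cat !E; try lia.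
Qed.

Lemma split_first (o : nat) w : o \in w ->
  exists g z, w = g ++ o :: z /\ o \notin g.
Proof.
move=> ow; exists (take (index o w) w), (drop (index o w).+1 w).
have lt_o : index o w < size w by rewrite index_mem.
split; last first.
  apply/negP => /(nthP 0) [p]; rewrite size_takel ?(ltnW lt_o) // => lt_p.
  by rewrite nth_take // => E; have := before_find 0 lt_p; rewrite E /= eqxx.
by rewrite -{1}(cat_take_drop (index o w) w) (drop_nth 0) // nth_index.
Qed.

Lemma split_last (o : nat) w : o \in w ->
  exists g z, w = g ++ o :: z /\ o \notin z.
Proof.
rewrite -mem_rev => /split_first [g [z [E og]]].
exists (rev z), (rev g); rewrite mem_rev; split => //.
by rewrite -[w]revK E rev_cat rev_cons cat_rcons.
Qed.

Lemma nopat_gap o g z a : nopat (o :: g ++ o :: z) -> a != o ->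
  a \in g -> a \notin z.
Proof.
move=> N ao ag; apply/negP => az; apply/negP: ao; rewrite negbK; apply/eqP.
have lg : index a g < size g by rewrite index_mem.
have lz : index a z < size z by rewrite index_mem.
have := N 0 (index a g).+1 (size g).+1 (size g + (index a z)).+2.
rewrite /= !nth_cat lg nth_index // ltnn subnn.
have -> : ((size g + index a z).+1 < size g) = false by lia.
have -> : (size g + index a z).+1 - size g = (index a z).+1 by lia.
rewrite /= nth_index // size_cat /= => H; apply/esym/H => //; lia.
Qed.

Lemma canon_cat_l i u z : canon i (u ++ z) -> canon i u.
Proof.
move=> C p lt_p; have := C p; rewrite size_cat nth_cat lt_p => /(_ ltac:(lia)) [H].
by rewrite nth_cat; case: ltnP => //; lia.
Qed.

Lemma canon_cat_r i u z : canon i (u ++ z) -> {in z, forall a, a \notin u} ->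
  canon (i + size u) z.
Proof.
move=> C D p lt_p; have := C (size u + p); rewrite size_cat !nth_cat.
have -> : (size u + p < size u) = false by lia.
rewrite addKn => /(_ ltac:(lia)) [H].
have az : nth 0 z p \in z by apply: mem_nth.
have [lt|le] := ltnP.
  by move=> E; have := D _ az; rewrite -E mem_nth.
have -> : nth 0 z p - i - size u = nth 0 z p - (i + size u) by lia.
by move=> ->; split=> //; lia.
Qed.

Definition canonB o i (w : seq nat) := forall p, p < size w ->
  nth 0 w p != o -> i < nth 0 w p <= i + p /\ nth 0 w (nth 0 w p - i) = nth 0 w p.

(** The last occurrence of the first letter ends the first component; inside a component, the next
    occurrence of the outer letter ends a gap. Non-crossing separates the letters of the pieces. *)
Lemma wd_surj n :
  (forall w i, size w <= n -> nopat w -> canon i w -> exists s, w = wdS i s) /\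
  (forall w o i, size w < n -> o <= i -> last o w = o -> nopat (o :: w) ->
     canonB o i (o :: w) -> exists b, o :: w = wdB o i b).
Proof.
elim: n => [|n [IHS IHB]].
  by split=> [[|a w] i|w o i] // *; exists L.
(* The component case is proved first, since the forest case uses it on words of the same length. *)
have HB w o i : size w < n.+1 -> o <= i -> last o w = o -> nopat (o :: w) ->
    canonB o i (o :: w) -> exists b, o :: w = wdB o i b.
  move=> lt_w oi lo Np C; case: w lt_w lo Np C => [|c w'] lt_w lo Np C; first by exists L.
  have ow : o \in c :: w' by have := mem_last c w'; rewrite -[last c w']/(last o (c :: w')) lo.
have [g [z [E og]]] := split_first ow; rewrite {}E in lt_w lo Np C *.
have Sz : size (g ++ o :: z) = (size g + size z).+1 by rewrite size_cat /= addnS.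
have nthz p : nth 0 (o :: g ++ o :: z) (p + (size g).+1) = nth 0 (o :: z) p.
  by rewrite addnS /= nth_cat ltnNge leq_addl /= addnK.
have nthg p : p < size g -> nth 0 (o :: g ++ o :: z) p.+1 = nth 0 g p.
  by move=> lt_p; rewrite /= nth_cat lt_p.
have [s Es] : exists s, g = wdS i.+1 s.
  apply: IHS; first by lia.
    exact: (@nopat_sub [:: o] g (o :: z)).
  move=> p lt_p; have := C p.+1; rewrite nthg // /size -/size Sz => /(_ ltac:(lia)).
  have gp : nth 0 g p \in g by apply: mem_nth.
  have -> : nth 0 g p != o by apply: contraNneq og => <-.
  case=> // Hp E; split; first by lia.
  by rewrite -[RHS]E -nthg; [congr nth; lia | lia].
have [b Eb] : exists b, o :: z = wdB o (i.+1 + size g) b.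
  apply: IHB; [by lia | by lia | | |].
  - by move: lo; rewrite last_cat.
  - by apply: (@nopat_sub (o :: g) (o :: z) [::]); rewrite cats0.
  move=> p lt_p ne; have := C (p + (size g).+1); rewrite nthz => /(_ _ ne).
  case; first by rewrite /= Sz; move: lt_p => /=; lia.
  set c0 := nth 0 (o :: z) p in ne * => Hc E.
  have cz : c0 \in z.
    have : c0 \in o :: z by apply: mem_nth.
    by rewrite inE (negPf ne).
  have le_g : size g < c0 - i.
    rewrite ltnNge; apply/negP => le_c; move: cz; apply/negP.
    apply: (nopat_gap Np ne); rewrite -E.
    have -> : c0 - i = (c0 - i.+1).+1 by lia.
    have lt_c : c0 - i.+1 < size g by lia.
    by rewrite nthg // mem_nth.
  have ne2 : c0 - i != (size g).+1.
    apply: contraNneq ne => E2; move: E; rewrite E2.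
    by have := nthz 0; rewrite add0n => -> /= ->.
  split; first by move: Hc ne2 le_g; lia.
  rewrite -[RHS]E -nthz; congr nth; move: Hc ne2 le_g; lia.
exists (N s b).
have sg : size g = bsz s by rewrite Es size_wdS.
by rewrite /= -Es -sg -Eb.
split=> // -[|a w] i; first by exists L.
rewrite /= ltnS => le_w Np C.
  have Ea : a = i by have [] := C 0 isT; rewrite /= addn0; lia.
  subst a; have [p0 [z [E iz]]] := split_last (mem_head i w).
  have [b Eb] : exists b, rcons p0 i = wdB i i b.
    case: p0 E => [|a p0] E; first by exists L.
    have [Ea Ew] : i = a /\ w = p0 ++ i :: z by case: E.
    subst a; apply: HB => //.
    + by move: le_w; rewrite Ew size_cat size_rcons /=; lia.
    + by rewrite last_rcons.
    + by apply: (@nopat_sub [::] (rcons (i :: p0) i) z); rewrite cat0s cat_rcons -E.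
    have C' : canon i (rcons (i :: p0) i).
      by apply: (@canon_cat_l _ _ z); rewrite cat_rcons -E.
    move=> p lt_p ne; have [/andP[H1 H2] ->] := C' p lt_p; split=> //.
    by rewrite H2 ltn_neqAle eq_sym ne H1.
  have Dz : {in z, forall c, c \notin rcons p0 i}.
    move=> c cz; rewrite mem_rcons inE negb_or.
    have ci : c != i by apply: contraNneq iz => <-.
    rewrite ci /=; case: p0 E {Eb} => // a p0 [Ea Ew]; subst a.
    rewrite inE negb_or ci /=; apply/negP => cp; move: cz; apply/negP.
    by apply: (@nopat_gap i p0) => //; rewrite -Ew.
  have [s Es] : exists s, z = wdS (i + bsz b).+1 s.
    have Esz : size (rcons p0 i) = (bsz b).+1 by rewrite Eb size_wdB.
    apply: IHS.
    + by move: le_w; move/(congr1 size): E; rewrite size_cat /=; lia.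
    + by apply: (@nopat_sub (rcons p0 i) z [::]); rewrite cats0 cat_rcons -E.
    rewrite -addnS -Esz; apply: canon_cat_r => //.
    by rewrite cat_rcons -E.
  by exists (N b s); rewrite /= -Eb -Es cat_rcons.
Qed.

Section PartitionOfWord.
Variable n : nat.
Implicit Types (w : seq nat) (pi : {set {set 'I_n}}) (V W : {set 'I_n}).

Definition blkw w a : {set 'I_n} := [set i : 'I_n | nth 0 w i == a].
Definition partw w : {set {set 'I_n}} := [set blkw w (nth 0 w i) | i : 'I_n].

Lemma mem_blkw w a (i : 'I_n) : (i \in blkw w a) = (nth 0 w i == a).
Proof. by rewrite inE. Qed.

Lemma partwP w V : reflect (exists i : 'I_n, V = blkw w (nth 0 w i)) (V \in partw w).
Proof.
by apply: (iffP imsetP) => [[i _ ->]|[i ->]]; exists i.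
Qed.

Lemma partw_partition w : partition (partw w) [set: 'I_n].
Proof.
apply/and3P; split.
- apply/eqP/setP => i; rewrite inE; apply/bigcupP; exists (blkw w (nth 0 w i)).
    by apply/partwP; exists i.
  by rewrite mem_blkw.
- apply/trivIsetP => V W /partwP[i ->] /partwP[j ->] ne.
  rewrite -setI_eq0; apply/eqP/setP => k; rewrite !inE.
  by apply/negP => /andP[/eqP E1 /eqP E2]; move: ne; rewrite -E1 -E2 eqxx.
by apply/partwP => -[i /setP/(_ i)]; rewrite mem_blkw eqxx inE.
Qed.

Lemma pblock_partw w i : pblock (partw w) i = blkw w (nth 0 w i).
Proof.
have /and3P[_ tI _] := partw_partition w.
by apply: def_pblock; rewrite ?mem_blkw //; apply/partwP; exists i.
Qed.

Lemma partw_NC w : size w = n -> nopat w -> partw w \in NC n.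
Proof.
move=> sw Np; rewrite inE partw_partition /=.
apply/forallP => V; apply/implyP => /partwP[i ->].
apply/forallP => W; apply/implyP => /partwP[j ->]; apply/implyP => ne.
apply/negP => /existsP[a /andP[]]; rewrite mem_blkw => /eqP Ea.
move=> /existsP[b /andP[]]; rewrite mem_blkw => /eqP Eb.
move=> /existsP[c /andP[]]; rewrite mem_blkw => /eqP Ec.
move=> /existsP[d /andP[]]; rewrite mem_blkw => /eqP Ed /and3P[ab bc cd].
move/eqP: ne; apply; congr blkw; rewrite -Ea -Eb.
by apply: (Np a b c d); rewrite ?ab ?bc ?cd ?sw ?ltn_ord ?Ea ?Eb ?Ec ?Ed.
Qed.

(** In a canonical word the letter at a point is the minimum of its block, hence is determined by
    the partition. *)
Lemma partw_inj w w' : size w = n -> size w' = n -> canon 0 w -> canon 0 w' ->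
  partw w = partw w' -> w = w'.
Proof.
have half u u' (i : 'I_n) : size u = n -> size u' = n -> canon 0 u -> canon 0 u' ->
    partw u = partw u' -> nth 0 u' i <= nth 0 u i.
  move=> su su' C C' E; have [] := C i ltac:(by rewrite su); rewrite add0n subn0 => /andP[_ le_a] Ea.
  have lt_a : nth 0 u i < n := leq_ltn_trans le_a (ltn_ord i).
  have : Ordinal lt_a \in blkw u (nth 0 u i) by rewrite mem_blkw /= Ea.
  rewrite -pblock_partw E pblock_partw mem_blkw => /eqP <- /=.
  by have [] := C' (nth 0 u i) ltac:(by rewrite su'); rewrite add0n => /andP[].
move=> sw sw' C C' E; apply: (@eq_from_nth _ 0); first by rewrite sw sw'.
move=> i; rewrite sw => lt_i; apply/eqP; rewrite eqn_leq.
by rewrite (half _ _ (Ordinal lt_i) sw' sw C' C (esym E))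
           (half _ _ (Ordinal lt_i) sw sw' C C' E).
Qed.

Lemma pblock_eqE pi i j : partition pi [set: 'I_n] ->
  (pblock pi j == pblock pi i) = (j \in pblock pi i).
Proof.
move=> /and3P[/eqP cov tI _].
by rewrite eq_sym eq_pblock // cov inE.
Qed.

Lemma NC_word pi : pi \in NC n ->
  exists w, [/\ size w = n, nopat w, canon 0 w & partw w = pi].
Proof.
rewrite inE => /andP[part nc]; have /and3P[/eqP cov tI n0] := part.
pose t := [seq pblock pi i | i <- enum 'I_n].
have st : size t = n by rewrite size_map size_enum_ord.
(* The index of a block among the blocks of successive points is the position of its first point. *)
pose w := [seq index a t | a <- t].
have sw : size w = n by rewrite size_map st.
have nt (i : 'I_n) : nth set0 t i = pblock pi i.
  by rewrite (nth_map i) ?size_enum_ord // nth_ord_enum.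
have nw (i : 'I_n) : nth 0 w i = index (pblock pi i) t.
  by rewrite (nth_map set0) ?st // nt.
have tin (i : 'I_n) : pblock pi i \in t by rewrite -nt mem_nth // st.
have wE (i j : 'I_n) : nth 0 w i = nth 0 w j -> pblock pi i = pblock pi j.
  rewrite !nw => /(congr1 (nth set0 t)).
  by rewrite !nth_index.
exists w; split=> //.
- move=> i j k l /andP[ij jk] /andP[kl]; rewrite sw => ln.
  have kn := ltn_trans kl ln; have jn := ltn_trans jk kn; have i_n := ltn_trans ij jn.
  move=> /(wE (Ordinal i_n) (Ordinal kn)) Eik /(wE (Ordinal jn) (Ordinal ln)) Ejl.
  rewrite (nw (Ordinal i_n)) (nw (Ordinal jn)); congr index; apply/eqP/negPn/negP => ne.
  have pin (o : 'I_n) : pblock pi o \in pi by rewrite pblock_mem // cov inE.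
  have oin (o : 'I_n) : o \in pblock pi o by rewrite mem_pblock cov inE.
  move/forallP/(_ (pblock pi (Ordinal i_n)))/implyP/(_ (pin _)): nc.
  move/forallP/(_ (pblock pi (Ordinal jn)))/implyP/(_ (pin _))/implyP/(_ ne)/negP; apply.
  apply/existsP; exists (Ordinal i_n); rewrite oin /=.
  apply/existsP; exists (Ordinal jn); rewrite oin /=.
  apply/existsP; exists (Ordinal kn); rewrite Eik oin /=.
  by apply/existsP; exists (Ordinal ln); rewrite Ejl oin /= ij jk kl.
- move=> p; rewrite sw => lt_p; have := nw (Ordinal lt_p) => /= ->.
  set a := pblock _ _; rewrite subn0 add0n.
  have ai : index a t < size t by rewrite index_mem /a tin.
  split.
    rewrite leqNgt; apply/negP => lt_pi; have := before_find set0 lt_pi.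
    by rewrite /= (nt (Ordinal lt_p)) eqxx.
  by rewrite (nth_map set0) // nth_index ?tin.
have bE (i : 'I_n) : blkw w (nth 0 w i) = pblock pi i.
  apply/setP => j; rewrite mem_blkw -(pblock_eqE _ _ part).
  by apply/eqP/eqP => [/wE|] //; rewrite !nw => ->.
apply/setP => V; apply/partwP/idP => [[i ->]|Vpi].
  by rewrite bE pblock_mem // cov inE.
have [V0|[i iV]] := set_0Vmem V; first by rewrite -V0 Vpi in n0.
by exists i; rewrite bE (def_pblock tI Vpi iV).
Qed.

Definition part_of (s : bt) := partw (wdS 0 s).

Lemma wdS_canon i s : canon i (wdS i s).
Proof.
move=> p; rewrite size_wdS => lt_p; have [le_p E] := (wd_canon s).1 i p lt_p.
split=> //; rewrite le_p andbT.
have : nth 0 (wdS i s) p \in wdS i s by rewrite mem_nth // size_wdS.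
by move/(mem_wd s).1 => /andP[].
Qed.

Lemma perm_NC : perm_eq (map part_of (trs n)) (enum (NC n)).
Proof.
apply: uniq_perm; rewrite ?enum_uniq //.
  rewrite map_inj_in_uniq ?uniq_trs // => s s' /bsz_trs ss /bsz_trs ss' E.
  apply: (wd_inj s).1; apply: partw_inj E; rewrite ?size_wdS //; exact: wdS_canon.
move=> pi; rewrite mem_enum; apply/mapP/idP => [[s /bsz_trs ss ->]|/NC_word].
  by apply: partw_NC; [rewrite size_wdS | apply: (nopat_wd s).1].
move=> [w [sw Np C <-]]; have [s Es] := (wd_surj n).1 w 0 (eq_leq sw) Np C.
by exists s; rewrite ?mem_trs -?(size_wdS 0) -?Es ?sw // /part_of -Es.
Qed.

Lemma part_of_inj s s' : bsz s = n -> bsz s' = n -> part_of s = part_of s' -> s = s'.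
Proof.
move=> ss ss' E; apply: (wd_inj s).1; apply: partw_inj E; rewrite ?size_wdS //;
  exact: wdS_canon.
Qed.

Lemma big_NC (V : nmodType) (H : {set {set 'I_n}} -> V) :
  (\sum_(pi in NC n) H pi = \sum_(s <- trs n) H (part_of s))%R.
Proof. by rewrite -big_enum -(perm_big _ perm_NC) big_map. Qed.

Lemma part_of_NC s : bsz s = n -> part_of s \in NC n.
Proof. by move=> ss; apply: partw_NC; [rewrite size_wdS | apply: (nopat_wd s).1]. Qed.

End PartitionOfWord.

Local Open Scope ring_scope.

Lemma mem_lab_wd t : (forall i a, (a \in labS i t) = (a \in wdS i t)) /\
  (forall o i a, (a \in o :: labR i t) = (a \in wdB o i t)).
Proof.
elim: t => [|l [IHlS IHlB] r [IHrS IHrB]]; split=> //.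
  by move=> i a; rewrite [labS _ _]/= [wdS _ _]/= -cat_cons !mem_cat IHlB IHrS.
move=> o i a; rewrite [labR _ _]/= [wdB _ _ _]/= !inE !mem_cat IHlS -(IHrB o) inE.
by case: (a == o); rewrite ?orbT.
Qed.

Lemma uniq_lab t : (forall i, uniq (labS i t)) /\ (forall i, uniq (labR i t)).
Proof.
elim: t => [|l [IHlS IHlB] r [IHrS IHrB]]; split=> // i.
  rewrite [labS _ _]/= -cat_cons cat_uniq /= IHlB IHrS !andbT; apply/andP; split.
    by apply/negP => /(mem_lab l).2; lia.
  apply/hasPn => a /(mem_lab r).1 Ha; rewrite inE; apply/negP => /orP[/eqP|].
    by lia.
  by move=> /(mem_lab l).2; lia.
rewrite [labR _ _]/= cat_uniq IHlS IHrB !andbT; apply/hasPn => a /(mem_lab r).2 Ha.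
by apply/negP => /(mem_lab l).1; lia.
Qed.

Lemma wd_comb m : (forall o i, wdB o i (comb m) = nseq m.+1 o) /\
  (forall i, labR i (comb m) = [::]).
Proof.
by elim: m => //= m [IHw IHl]; split=> [o i|i]; rewrite ?IHw ?IHl.
Qed.

Section Blocks.
Variables (n : nat) (s : bt).
Hypothesis sn : bsz s = n.

Lemma blkw_inj : {in wdS 0 s &, injective (blkw n (wdS 0 s))}.
Proof.
move=> a b ain _ /setP E.
have [p lt_p Ep] : exists2 p, (p < size (wdS 0 s))%N & nth 0%N (wdS 0 s) p = a.
  by exists (index a (wdS 0 s)); rewrite ?index_mem ?nth_index.
rewrite size_wdS sn in lt_p.
have := E (Ordinal lt_p); rewrite !mem_blkw /= Ep eqxx.
by move/esym/eqP.
Qed.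

Lemma big_part_of (R : Type) (idx : R) (op : Monoid.com_law idx) (H : {set 'I_n} -> R) :
  \big[op/idx]_(V in part_of n s) H V =
  \big[op/idx]_(a <- labS 0 s) H (blkw n (wdS 0 s) a).
Proof.
rewrite -big_enum -(big_map (blkw n (wdS 0 s)) predT).
apply: perm_big; apply: uniq_perm; rewrite ?enum_uniq //.
  rewrite map_inj_in_uniq ?(uniq_lab s).1 // => a b.
  rewrite !(mem_lab_wd s).1; exact: blkw_inj.
move=> V; rewrite mem_enum; apply/partwP/mapP => [[i ->]|[a]].
  exists (nth 0%N (wdS 0 s) i) => //; rewrite (mem_lab_wd s).1 mem_nth //.
  by rewrite size_wdS sn.
rewrite (mem_lab_wd s).1 => /(nthP 0%N)[p]; rewrite size_wdS sn => lt_p <- ->.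
by exists (Ordinal lt_p).
Qed.

Lemma pblock_word : [seq pblock (part_of n s) i | i <- enum 'I_n] =
  map (blkw n (wdS 0 s)) (wdS 0 s).
Proof.
apply: (@eq_from_nth _ set0).
  by rewrite [LHS]size_map [RHS]size_map size_enum_ord size_wdS sn.
move=> i; rewrite size_map size_enum_ord => lt_i.
rewrite (nth_map (Ordinal lt_i)) ?size_enum_ord // pblock_partw.
by rewrite (nth_map 0%N) ?size_wdS ?sn // -[i]/(val (Ordinal lt_i)) nth_ord_enum.
Qed.

End Blocks.

Section ExtTree.
Variables (K : fieldType) (A : algType K) (SB : {pred A}) (B : subAlgType SB).
Let v : {lrmorphism B -> A} := @emb K A SB B.

Section Labelled.
Variables (n : nat) (s : bt).
Hypotheses (sn : bsz s = n) (n0 : (0 < n)%N).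

Lemma ext_fam_tree (F : {set 'I_n} -> seq A -> B) (x : n.-tuple A) :
  (forall V, leftlin v (F V)) ->
  ext_fam F (part_of n s) x = evLS v (fun a => F (blkw n (wdS 0 s) a)) 0 s x.
Proof.
move=> Fl; rewrite /ext_fam pblock_word // ext_word_map; last exact: blkw_inj.
apply: ext_word_wdS; rewrite ?size_tuple ?sn //.
  by move=> o; apply: Fl.
by apply/eqP => E; move: n0; rewrite -sn E.
Qed.

Lemma ext_tree (f : seq A -> B) (x : n.-tuple A) : leftlin v f ->
  ext f (part_of n s) x = evS v f s x.
Proof. by move=> fl; rewrite /ext ext_fam_tree // (evL_const v f s).1. Qed.

End Labelled.

Variable f : seq (dual A) -> dual B.
Hypothesis fgood : good (dual_map v) f.

Lemma ext_dual n s (x : n.-tuple A) : bsz s = n -> (0 < n)%N ->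
  ext (part1 f) (part_of n s) x = (evS (dual_map v) f s (map (@inj K A) x)).1.
Proof.
move=> sn n0; rewrite ext_tree //; last exact: part1_leftlin fgood.
by rewrite (dual_ev1 fgood s).1.
Qed.

Lemma dext_dual n s (x : n.-tuple A) : bsz s = n -> (0 < n)%N ->
  dext (part1 f) (part2 f) (part_of n s) x =
  (evS (dual_map v) f s (map (@inj K A) x)).2.
Proof.
move=> sn n0; rewrite ((dual_ev2 fgood s).1 0%N) /dext big_part_of //.
rewrite big_seq [RHS]big_seq; apply: eq_bigr => a; rewrite (mem_lab_wd s).1 => ain.
rewrite /dext_at ext_fam_tree //; last first.
  by move=> V; case: ifP => _; [exact: part2_leftlin fgood | exact: part1_leftlin fgood].
apply: (evL_agree _ _ _ _).1 => b u bin _; rewrite /split_fam.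
have -> // : (blkw n (wdS 0 s) b == blkw n (wdS 0 s) a) = (b == a).
by apply/eqP/eqP => [/(blkw_inj sn)->|->].
Qed.

End ExtTree.

(** * The deletion recursion depends only on short words *)

Section Agreement.
Variables (K : fieldType) (A : algType K) (SB : {pred A}) (B : subAlgType SB).

(** The disjunction is the invariant: a map is applied to [N] arguments only when [t] is constant
    and all [N] arguments remain, and a deletion leaves fewer arguments. *)
Lemma ext_word_agree (T : eqType) (F G : T -> seq A -> B) N m t x :
  (forall a u, (size u < N)%N -> F a u = G a u) ->
  (size t <= N)%N -> (size x <= N)%N -> ~~ constant t || (size x < N)%N ->
  ext_word F m t x = ext_word G m t x.
Proof.
move=> FG; elim: m t x => [|m IHm] [|a0 t'] x //.
set t := a0 :: t' => st sx H.
have Et : size t = (size t').+1 by [].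
have tn : t != [::] by [].
have [ct|nct] := boolP (constant t).
  by rewrite !(ext_word_constant _ m x a0) // FG //; move: H; rewrite ct.
rewrite !(ext_wordS _ m x a0) // -[head _ _]/a0.
set l := find _ _; set a := nth _ _ _; set k := count_mem a t.
have ain : a \in t.
  rewrite /a; have [lt|le] := ltnP l (size t); first by rewrite mem_nth.
  by rewrite nth_default // inE eqxx.
have k0 : (0 < k)%N by rewrite -has_count has_pred1.
have le_l : (l <= size t)%N.
  by rewrite /l (leq_trans (find_size _ _)) // size_iota.
have kt : (k < size t)%N.
  rewrite ltn_neqAle count_size andbT; apply: contraNneq nct => /eqP.
  rewrite -all_count => /allP Ha; apply/allP => b bt' /=.
  have /eqP -> : b == a by apply: Ha; rewrite inE bt' orbT.
  by rewrite eq_sym; apply: Ha; rewrite inE eqxx.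
have Eu : F a (take k (drop l x)) = G a (take k (drop l x)).
  apply: FG; rewrite size_take_min size_drop.
  by case: (l) le_l => [|l'] _; lia.
rewrite Eu; set b := (X in absorb _ _ X _).
have sxx : (size (absorb l k b x) <= N)%N /\
   ((l < size t)%N -> (size (absorb l k b x) < N)%N).
  rewrite /absorb; case: (l) le_l => [|l'] le_l'.
    by rewrite [size (_ :: _)]/= size_drop; lia.
  by rewrite size_cat [size (_ :: _)]/= size_take_min size_drop; lia.
have [s1 s2] := sxx.
apply: IHm => //.
  by rewrite size_cat size_takel // size_drop; lia.
(* For an arbitrary word the search may fail; then [t] does not change and stays non-constant. *)
have [lt|le] := ltnP l (size t); first by rewrite s2 ?orbT.
by rewrite take_oversize // drop_oversize ?cats0 ?nct //; lia.
Qed.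

End Agreement.

Local Close Scope ring_scope.

(* The pairs (min V, max V) of the blocks V. *)
Fixpoint ivS (i : nat) (t : bt) : seq (nat * nat) :=
  if t is N b s then (i, i + bsz b) :: ivR i b ++ ivS (i + bsz b).+1 s else [::]
with ivR (i : nat) (t : bt) : seq (nat * nat) :=
  if t is N g b then ivS i.+1 g ++ ivR (i.+1 + bsz g) b else [::].

Lemma unzip1_iv t : (forall i, map fst (ivS i t) = labS i t) /\
  (forall i, map fst (ivR i t) = labR i t).
Proof.
by elim: t => //= l [IHlS IHlB] r [IHrS IHrB]; split=> i;
  rewrite map_cat ?IHlB ?IHrS ?IHlS ?IHrB.
Qed.

Lemma size_iv t : (forall i, size (ivS i t) = nbS t) /\
  (forall i, (size (ivR i t)).+1 = nbB t).
Proof.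
elim: t => //= l [IHlS IHlB] r [IHrS IHrB]; split=> i; rewrite size_cat.
  by rewrite -(IHlB i) IHrS; lia.
by rewrite IHlS -(IHrB (i.+1 + bsz l)); lia.
Qed.

Lemma mem_iv t : (forall i p, p \in ivS i t -> i <= p.1 <= p.2 /\ p.2 < i + bsz t) /\
  (forall i p, p \in ivR i t -> i < p.1 <= p.2 /\ p.2 <= i + bsz t).
Proof.
elim: t => [|l [IHlS IHlB] r [IHrS IHrB]]; split=> // i p.
  rewrite [ivS _ _]/= inE mem_cat => /or3P[/eqP->|/IHlB[]|/IHrS[]] /=; lia.
by rewrite [ivR _ _]/= mem_cat => /orP[/IHlS[]|/IHrB[]] /=; lia.
Qed.

Lemma wdB_last o i t : nth 0 (wdB o i t) (bsz t) = o.
Proof.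
elim: t i => //= g _ b IHb i.
rewrite nth_cat size_wdS ltnNge leq_addr /= addKn; exact: IHb.
Qed.

Definition last_at (w : seq nat) d a h :=
  [/\ d <= h, nth 0 w (h - d) = a & forall p, p < size w -> nth 0 w p = a -> d + p <= h].

Lemma last_at_insert (u v z : seq nat) d (a h : nat) : a \notin u -> a \notin z -> h < d + size u + size v ->
  last_at v (d + size u) a h -> last_at (u ++ v ++ z) d a h.
Proof.
move=> au az lt_h [le_h Eh Hh]; split; first by lia.
  rewrite nth_cat; have -> : (h - d < size u) = false by lia.
  rewrite nth_cat; have -> : h - d - size u < size v by lia.
  by rewrite -[RHS]Eh; congr nth; lia.
move=> p; rewrite !size_cat nth_cat; case: (ltnP p (size u)) => [lt_p _ E|le_p].
  by rewrite -E mem_nth in au.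
rewrite nth_cat; case: (ltnP (p - size u) (size v)) => [lt_p _ E|le_p' lt_p E].
  by have := Hh _ lt_p E; lia.
have lt_q : p - size u - size v < size z by lia.
by rewrite -E mem_nth in az.
Qed.

Lemma iv_last t : (forall i p, p \in ivS i t -> last_at (wdS i t) i p.1 p.2) /\
  (forall o i p, o <= i -> p \in ivR i t -> last_at (wdB o i t) i p.1 p.2).
Proof.
elim: t => [|l [IHlS IHlB] r [IHrS IHrB]]; split=> //.
- move=> i [a h] /=; rewrite [ivS _ _]/= [wdS _ _]/= => pin.
  have nr c : i <= c <= i + bsz l -> c \notin wdS (i + bsz l).+1 r.
    by move=> Ha; apply/negP => /(mem_wd r).1; lia.
  have nl c : (i + bsz l).+1 <= c -> c \notin wdB i i l.
    by move=> Ha; apply/negP => /(mem_wd l).2 /orP[/eqP|]; lia.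
  move: pin; rewrite inE mem_cat => /or3P[/eqP[-> ->]|pin|pin].
  + apply: (@last_at_insert [::]); rewrite ?nr ?size_wdB ?addn0 //=; try lia.
    split; [by lia | by rewrite addKn wdB_last | move=> q; rewrite size_wdB => *; lia].
  + have /= [H1 H2] := (mem_iv l).2 _ _ pin.
    apply: (@last_at_insert [::]); rewrite ?nr ?size_wdB ?addn0 //=; try lia.
    exact: IHlB pin.
  have /= [H1 H2] := (mem_iv r).1 _ _ pin.
  rewrite -[wdS _ r]cats0; apply: last_at_insert; rewrite ?nl ?size_wdB ?size_wdS //; try lia.
  by rewrite addnS; apply: IHrS pin.
move=> o i [a h] oi /=; rewrite [ivR _ _]/= [wdB _ _ _]/= mem_cat => /orP[] pin.
  have /= [H1 H2] := (mem_iv l).1 _ _ pin.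
  rewrite -cat1s; apply: last_at_insert; rewrite ?size_wdS /=; try lia.
  - by rewrite inE; apply/eqP; lia.
  - by apply/negP => /(mem_wd r).2 /orP[/eqP|]; lia.
  by rewrite addn1; apply: IHlS pin.
have /= [H1 H2] := (mem_iv r).2 _ _ pin.
rewrite -cat_cons -[wdB _ _ r]cats0; apply: last_at_insert; rewrite ?size_wdB /= ?size_wdS //; try lia.
  rewrite inE negb_or; apply/andP; split; first by apply/eqP; lia.
  by apply/negP => /(mem_wd l).1; lia.
by rewrite addnS -addSn; apply: IHrB pin; lia.
Qed.

Lemma count_consE (T : Type) (P : pred T) x s : count P (x :: s) = P x + count P s.
Proof. by []. Qed.

Definition cont (p q : nat * nat) := (p.1 <= q.1) && (q.2 <= p.2).

Lemma count_outside i j (L : seq (nat * nat)) p :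
  {in L, forall q, ~~ ((i <= q.1) && (q.2 < j))} -> i <= p.1 -> p.2 < j ->
  count (cont p) L = 0.
Proof.
move=> out ip pj; apply/eqP; rewrite eqn0Ngt -has_count; apply/hasPn => q qL.
by apply: contra (out q qL); rewrite /cont; lia.
Qed.

(** The lists [U] and [Z] hold the intervals met outside the subtree. None of them lies in its span,
    so they do not affect the counts, and the induction can enlarge them. *)
Lemma prod_count t :
  (forall i U Z, {in U ++ Z, forall q, ~~ ((i <= q.1) && (q.2 < i + bsz t))} ->
     \prod_(p <- ivS i t) count (cont p) (U ++ ivS i t ++ Z) = tauS t) /\
  (forall i m U Z, {in U ++ Z, forall q, ~~ ((i < q.1) && (q.2 <= i + bsz t))} ->
     (m + size (ivR i t)).+1 * \prod_(p <- ivR i t) count (cont p) (U ++ ivR i t ++ Z)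
     = tauB t m).
Proof.
elim: t => [|l [IHlS IHlB] r [IHrS IHrB]]; split.
- by move=> i U Z _; rewrite big_nil.
- by move=> i m U Z _; rewrite big_nil addn0 muln1.
- move=> i U Z out; rewrite [ivS _ _]/= big_cons big_cat [tauS _]/= mulnA; congr (_ * _).
    rewrite -(IHlB i 0 ((i, i + bsz l) :: U) (ivS (i + bsz l).+1 r ++ Z)).
      congr (_ * _).
        rewrite !(count_cat, count_consE) /= add0n.
        have /= -> := @count_outside i (i + bsz l).+1 U (i, i + bsz l).
        + have /= -> := @count_outside i (i + bsz l).+1 Z (i, i + bsz l) => //.
            have /= -> := @count_outside i (i + bsz l).+1 (ivS (i + bsz l).+1 r) (i, i + bsz l) => //.
              have /eqP -> : count (cont (i, i + bsz l)) (ivR i l) == size (ivR i l).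
                rewrite -all_count; apply/allP => -[qa qh] /(mem_iv l).2 /= [H1 H2].
                by rewrite /cont /=; lia.
              by rewrite /cont /= !leqnn; lia.
            by move=> [qa qh] /(mem_iv r).1 /= [H1 H2]; lia.
          move=> [qa qh] qZ; have := out (qa, qh); rewrite mem_cat qZ orbT => /(_ isT) /=; lia.
        + move=> [qa qh] qU; have := out (qa, qh); rewrite mem_cat qU => /(_ isT) /=; lia.
        + by rewrite /=.
        by rewrite /=.
      rewrite big_seq [RHS]big_seq; apply: eq_bigr => p _.
      by rewrite !(count_cat, count_consE); lia.
    move=> [qa qh]; rewrite cat_cons inE !mem_cat => /orP[/eqP[-> ->]|] /=; first by lia.
    case/or3P => [qU|/(mem_iv r).1|qZ]; last 2 first.
    + by rewrite /=; lia.
    + have := out (qa, qh); rewrite mem_cat qZ orbT => /(_ isT) /=; lia.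
    have := out (qa, qh); rewrite mem_cat qU => /(_ isT) /=; lia.
  rewrite -(IHrS (i + bsz l).+1 (U ++ (i, i + bsz l) :: ivR i l) Z).
    by apply: eq_bigr => p _; rewrite -!catA !cat_cons -!catA.
  move=> [qa qh]; rewrite mem_cat mem_cat inE -!orbA => /or4P[qU|/eqP[-> ->]|/(mem_iv l).2|qZ] /=.
  + have := out (qa, qh); rewrite mem_cat qU => /(_ isT) /=; lia.
  + by rewrite /=; lia.
  + by rewrite /=; lia.
  have := out (qa, qh); rewrite mem_cat qZ orbT => /(_ isT) /=; lia.
move=> i m U Z out; rewrite [ivR _ _]/= big_cat [tauB _ _]/=.
rewrite -(IHlS i.+1 U (ivR (i.+1 + bsz l) r ++ Z)); last first.
  move=> [qa qh]; rewrite !mem_cat => /or3P[qU|/(mem_iv r).2|qZ].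
  + have := out (qa, qh); rewrite mem_cat qU => /(_ isT) /=; lia.
  + by rewrite /=; lia.
  have := out (qa, qh); rewrite mem_cat qZ orbT => /(_ isT) /=; lia.
rewrite -(IHrB (i.+1 + bsz l) (m + nbS l) (U ++ ivS i.+1 l) Z); last first.
  move=> [qa qh]; rewrite mem_cat mem_cat -orbA => /or3P[qU|/(mem_iv l).1|qZ].
  + have := out (qa, qh); rewrite mem_cat qU => /(_ isT) /=; lia.
  + by rewrite /=; lia.
  have := out (qa, qh); rewrite mem_cat qZ orbT => /(_ isT) /=; lia.
rewrite [RHS]mulnCA size_cat (size_iv l).1 -addnA; congr (_ * (_ * _)).
  by apply: eq_bigr => p _; rewrite -!catA.
by apply: eq_bigr => p _; rewrite -!catA.
Qed.

(** * Block number and tau(pi)! read off the tree *)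

Section Statistics.
Variables (n : nat) (s : bt).
Hypothesis sn : bsz s = n.
Notation w := (wdS 0 s).
Notation blk := (blkw n w).

Lemma card_part_of : #|part_of n s| = nbS s.
Proof.
rewrite -sum1_card big_part_of // sum1_size.
by rewrite -(unzip1_iv s).1 size_map (size_iv s).1.
Qed.

Lemma iv_spec a h : (a, h) \in ivS 0 s ->
  [/\ a <= h < n, nth 0 w a = a, nth 0 w h = a
    & forall p : 'I_n, p \in blk a -> a <= p <= h].
Proof.
move=> iv; have /= [_ Eh Hh] := (iv_last s).1 _ _ iv.
have /= [H1 H2] := (mem_iv s).1 _ _ iv.
rewrite subn0 in Eh; rewrite add0n in H2.
have [_ Ea] := (wd_canon s).1 0 h H2; rewrite subn0 Eh in Ea.
split=> //; first by rewrite -sn H2 andbT; lia.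
move=> p; rewrite mem_blkw => /eqP Ep.
have lt_p : p < bsz s by rewrite sn.
have := Hh p; rewrite size_wdS Ep => /(_ lt_p erefl) ->.
by have [] := (wd_canon s).1 0 p lt_p; rewrite Ep => ->.
Qed.

Lemma subset_hull a h b k : (a, h) \in ivS 0 s -> (b, k) \in ivS 0 s ->
  (blk b \subset hull (blk a)) = cont (a, h) (b, k).
Proof.
move=> /iv_spec [ah Ea Eh Ha] /iv_spec [bk Eb Ek Hb].
have hullE (p : 'I_n) : (p \in hull (blk a)) = (a <= p <= h).
  rewrite inE; apply/andP/andP => [[/existsP[j /andP[jin jp]] /existsP[k' /andP[kin pk]]]|[ap ph]].
    by have := Ha _ jin; have := Ha _ kin; lia.
  have an : a < n by lia.
  have hn : h < n by lia.
  split; apply/existsP; [exists (Ordinal an) | exists (Ordinal hn)];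
    by rewrite mem_blkw /= ?Ea ?Eh eqxx.
have bn : b < n by lia.
have kn : k < n by lia.
apply/subsetP/andP => [H|[/= ab kh] p pin].
  have := H (Ordinal bn); have := H (Ordinal kn).
  rewrite !hullE !mem_blkw /= Eb Ek eqxx => /(_ isT) + /(_ isT); lia.
by rewrite hullE; have := Hb _ pin; lia.
Qed.

Lemma big_iv (R : Type) (idx : R) (op : Monoid.com_law idx) (H : nat -> R) :
  \big[op/idx]_(a <- labS 0 s) H a = \big[op/idx]_(p <- ivS 0 s) H p.1.
Proof. by rewrite -(unzip1_iv s).1 big_map. Qed.

Lemma tau_part_of : tau_fact (part_of n s) = tauS s.
Proof.
rewrite /tau_fact big_part_of // big_iv.
rewrite -((prod_count s).1 0 [::] [::]) // big_seq [RHS]big_seq.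
apply: eq_bigr => -[a h] ah; rewrite /= cats0.
rewrite -sum1_card (eq_bigl (fun W => (W \in part_of n s) && (W \subset hull (blk a)))); last first.
  by move=> W; rewrite inE.
rewrite big_mkcondr big_part_of // big_iv -sum1_count [RHS]big_mkcond big_seq [RHS]big_seq.
by apply: eq_bigr => -[b k] bk /=; rewrite (subset_hull ah bk).
Qed.

End Statistics.

Fixpoint intvS (t : bt) : bool := if t is N b s then flat b && intvS s else true.

Lemma flat_wdB b : forall o i, o <= i ->
  flat b <-> (forall p, p <= bsz b -> nth 0 (wdB o i b) p = o).
Proof.
elim: b => [|g _ b IHb] o i oi; first by split=> // _ [].
split=> [/= /andP[/eqP-> fb] [|p] //= le_p|H /=].
  have [H _] := IHb o (i.+1 + 0) ltac:(lia); by apply: H.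
have gL : g = L.
  case: g H => // l r H; have := H 1 ltac:(by []); rewrite /= nth_cat size_cat size_wdB.
  by have [z ->] := wdB_cons i.+1 i.+1 l; rewrite /=; lia.
rewrite gL in H *; have [_ H'] := IHb o (i.+1 + 0) ltac:(lia).
by apply: H' => p le_p; apply: (H p.+1).
Qed.

Lemma flat_ivR b i : flat b -> ivR i b = [::].
Proof. by elim: b i => //= g _ b IHb i /andP[/eqP-> /IHb ->]. Qed.

Lemma intS_iv t : forall i, intvS t <-> (forall a h p, (a, h) \in ivS i t ->
  a <= p <= h -> nth 0 (wdS i t) (p - i) = a).
Proof.
elim: t => [|b _ s IHs] i //; split=> [/= /andP[fb fs] a h p|H /=].
  rewrite flat_ivR // inE => /orP[/eqP[-> ->]|ah] Hp.
    rewrite nth_cat size_wdB; have -> : p - i < (bsz b).+1 by lia.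
    have [E _] := flat_wdB b (leqnn i); rewrite E //; lia.
  have /= [H1 H2] := (mem_iv s).1 _ _ ah.
  rewrite nth_cat size_wdB; have -> : (p - i < (bsz b).+1) = false by lia.
  have [/(_ fs) E _] := IHs (i + bsz b).+1; rewrite -(E _ _ p ah) //.
  by congr nth; lia.
have fb : flat b.
  apply/(flat_wdB b (leqnn i)) => p le_p.
  have := H i (i + bsz b) (i + p) (mem_head _ _) ltac:(lia).
  by rewrite addKn /= nth_cat size_wdB ltnS le_p.
rewrite fb /=; apply/(IHs (i + bsz b).+1) => a h p ah Hp.
have /= [H1 H2] := (mem_iv s).1 _ _ ah.
have := H a h p; rewrite /= inE mem_cat ah !orbT => /(_ isT Hp).
rewrite nth_cat size_wdB; have -> : (p - i < (bsz b).+1) = false by lia.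
by move=> E; rewrite -[RHS]E; congr nth; lia.
Qed.

(** * Interval and irreducible partitions as trees *)

Section IntervalIrreducible.
Variable n : nat.

Lemma NCint_part_of s : bsz s = n -> (part_of n s \in NCint n) = intvS s.
Proof.
move=> sn; rewrite inE part_of_NC //=; have [IH1 IH2] := intS_iv s 0.
apply/forallP/idP => [H|/IH1 H V].
  apply: IH2 => a h p ah Hp; have [hn Ea Eh Ha] := iv_spec sn ah.
  have an : a < n by lia.
  have hn' : h < n by lia.
  have pn : p < n by lia.
  have Vin : blkw n (wdS 0 s) a \in part_of n s.
    by apply/partwP; exists (Ordinal an); rewrite /= Ea.
  have := H (blkw n (wdS 0 s) a); rewrite Vin /=.
  move=> /forallP/(_ (Ordinal an)); rewrite mem_blkw /= Ea eqxx /=.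
  move=> /forallP/(_ (Ordinal hn')); rewrite mem_blkw /= Eh eqxx /=.
  move=> /forallP/(_ (Ordinal pn)); rewrite mem_blkw /= Hp subn0.
  by move/eqP.
apply/implyP => /partwP[i ->]; set a := nth 0 _ _.
have : a \in labS 0 s.
  by rewrite (mem_lab_wd s).1 mem_nth // size_wdS sn.
rewrite -(unzip1_iv s).1 => /mapP[[a' h] ah /= Ea']; rewrite Ea' {a Ea'}.
have [hn Ea Eh Ha] := iv_spec sn ah.
apply/forallP => j; apply/implyP => /Ha Hj.
apply/forallP => k; apply/implyP => /Ha Hk.
apply/forallP => p; apply/implyP => Hp; rewrite mem_blkw.
have Hp' : a' <= p <= h by lia.
by have := H _ _ _ ah Hp'; rewrite subn0 => ->.
Qed.

Definition irrS (t : bt) : bool := if t is N b s then s == L else false.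

Lemma NCirr_part_of s : bsz s = n -> (0 < n) -> (part_of n s \in NCirr n) = irrS s.
Proof.
move=> sn n0; rewrite inE part_of_NC //=.
have w0 : nth 0 (wdS 0 s) 0 = 0.
  by have [] := (wd_canon s).1 0 0 ltac:(lia); rewrite addn0 leqn0 => /eqP.
have lt_l : n.-1 < n by rewrite prednK.
(* Label 0 is that of the first point, so the test says that the first and last points share a
   block. *)
have -> : irrS s = (nth 0 (wdS 0 s) n.-1 == 0).
  case: s sn w0 => [|b s] sn w0; first by move: n0; rewrite -sn.
  case: s sn w0 => [|b' s'] sn w0.
    by rewrite /= cats0 -sn /= addn0 wdB_last.
  have lt_q : n.-1 - (bsz b).+1 < bsz (N b' s') by move: sn => /=; lia.
  rewrite [irrS _]/= [wdS _ _]/= -/(wdS (0 + bsz b).+1 (N b' s')) nth_cat size_wdB.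
  have -> : (n.-1 < (bsz b).+1) = false by move: sn => /=; lia.
  have : nth 0 (wdS (0 + bsz b).+1 (N b' s')) (n.-1 - (bsz b).+1) \in
     wdS (0 + bsz b).+1 (N b' s') by rewrite mem_nth // size_wdS.
  by move/(mem_wd _).1 => Hm; apply/esym/negbTE; rewrite -lt0n; lia.
apply/existsP/eqP => [[V /andP[/partwP[i ->]]]|E].
  move=> /forallP H; have := H (Ordinal n0); have := H (Ordinal lt_l).
  rewrite !mem_blkw /= w0 prednK // eqxx orbT /= => /eqP -> /eqP <- //.
exists (blkw n (wdS 0 s) 0); apply/andP; split.
  by apply/partwP; exists (Ordinal n0); rewrite /= w0.
apply/forallP => i; apply/implyP => /orP[/eqP i0|/eqP il]; rewrite mem_blkw.
  by rewrite i0 w0.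
have -> : nat_of_ord i = n.-1 by move: il; lia.
by rewrite E.
Qed.

End IntervalIrreducible.

(** * Increasing colorings *)

Section Colorings.
Variables (T : finType) (R : rel T).

Definition incr k : {set {ffun T -> 'I_k}} :=
  [set c : {ffun T -> 'I_k} | [forall V, forall W, R V W ==> (c V < c W)]].
Definition surj k : {set {ffun T -> 'I_k}} :=
  [set c : {ffun T -> 'I_k} | (c \in incr k) && [forall j, exists V, c V == j]].

Lemma ltn_enum_val k (S : {set 'I_k}) (i j : 'I_#|S|) :
  (enum_val i < enum_val j) = (i < j).
Proof.
have x0 : 'I_k := enum_val i.
have so : sorted (fun a b : 'I_k => a < b) (enum S).
  apply: sorted_filter; first by move=> a b c; apply: ltn_trans.
  by rewrite -(@sorted_map _ _ val ltn) -enumT val_enum_ord iota_ltn_sorted.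
have homo (a b : 'I_#|S|) : a < b -> enum_val a < enum_val b.
  move=> ab; rewrite !(enum_val_nth x0).
  by apply: (sorted_ltn_nth _ x0 so) => //; rewrite ?inE -?cardE // => ? ? ?; apply: ltn_trans.
by case: (ltngtP i j) => [/homo //|/homo|/val_inj->]; rewrite ?ltnn //; lia.
Qed.

(** Replacing each color by its rank in [S] preserves strict inequalities. *)
Lemma card_incr_image k (S : {set 'I_k}) :
  #|[set c : {ffun T -> 'I_k} | (c \in incr k) && ([set c V | V : T] == S)]| = #|surj #|S| |.
Proof.
pose phi (c : {ffun T -> 'I_#|S|}) : {ffun T -> 'I_k} := [ffun V => enum_val (c V)].
have phi_inj : injective phi.
  by move=> c d /ffunP E; apply/ffunP => V; have := E V; rewrite !ffunE => /enum_val_inj.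
rewrite -(card_imset (surj #|S|) phi_inj); apply: eq_card => c.
apply/idP/imsetP => [|[d + ->]]; rewrite !inE.
  move=> /andP[/forallP ci /eqP Sc].
  have cS V : c V \in S by rewrite -Sc imset_f.
  pose d : {ffun T -> 'I_#|S|} := [ffun V => enum_rank_in (cS V) (c V)].
  have dE V : enum_val (d V) = c V by rewrite ffunE enum_rankK_in.
  exists d; last by apply/ffunP => V; rewrite ffunE dE.
  rewrite !inE; apply/andP; split.
    apply/forallP => V; apply/forallP => W; apply/implyP => RVW.
    by rewrite -ltn_enum_val !dE; have /forallP/(_ W)/implyP := ci V; apply.
  apply/forallP => j; apply/existsP.
  have : enum_val j \in S by apply: enum_valP.
  rewrite -{2}Sc => /imsetP[V _ Ej]; exists V.
  by apply/eqP/enum_val_inj; rewrite dE.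
move=> /andP[/forallP di /forallP ds]; apply/andP; split.
  apply/forallP => V; apply/forallP => W; apply/implyP => RVW.
  by rewrite !ffunE ltn_enum_val; have /forallP/(_ W)/implyP := di V; apply.
apply/eqP/setP => j; apply/imsetP/idP => [[V _ ->]|jS].
  by rewrite ffunE enum_valP.
have /existsP[V /eqP Ej] := ds (enum_rank_in jS j).
by exists V; rewrite // ffunE Ej enum_rankK_in.
Qed.

(** Colorings are sorted by the set of colors that they use. *)
Lemma card_incr k : #|incr k| = \sum_(j < k.+1) 'C(k, j) * #|surj j|.
Proof.
rewrite -sum1_card (partition_big (fun c : {ffun T -> 'I_k} => [set c V | V : T]) predT) //=.
transitivity (\sum_(S : {set 'I_k}) #|surj #|S| |).
  apply: eq_bigr => S _; rewrite -card_incr_image -sum1_card.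
  by apply: eq_bigl => c; rewrite !inE.
have lt_S (S : {set 'I_k}) : #|S| < k.+1 by rewrite ltnS -[X in _ <= X]card_ord max_card.
rewrite (partition_big (fun S => Ordinal (lt_S S)) predT) //=.
apply: eq_bigr => j _; rewrite (eq_bigr (fun=> #|surj j|)); last first.
  by move=> S /eqP <-.
rewrite sum_nat_const -[X in 'C(X, _)](card_ord k) -card_draws; congr (_ * _).
by apply: eq_card => S; rewrite !inE.
Qed.

Fixpoint words (k m : nat) : seq (seq nat) :=
  if m is m'.+1 then [seq c :: u | c <- iota 0 k, u <- words k m'] else [:: [::]].

Lemma mem_words k m u : (u \in words k m) = (size u == m) && all (fun c => c < k) u.
Proof.
elim: m u => [|m IHm] u; first by rewrite inE; case: u.
apply/allpairsP/idP => [[[c u'] /= [+ + ->]]|].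
  by rewrite mem_iota IHm /= => -> /andP[/eqP -> ->]; rewrite eqxx.
case: u => // c u /= /andP[/eqP[su] /andP[ck uk]]; exists (c, u) => /=.
by rewrite mem_iota IHm su eqxx uk.
Qed.

Lemma uniq_words k m : uniq (words k m).
Proof.
elim: m => //= m IHm; apply: allpairs_uniq => //; first exact: iota_uniq.
by move=> [a b] [c d] _ _ [-> ->].
Qed.

Lemma card_incr_words (E : seq T) k : uniq E -> (forall V, V \in E) ->
  #|incr k| = count (fun u => [forall V, forall W, R V W ==>
      (nth 0 u (index V E) < nth 0 u (index W E))]) (words k (size E)).
Proof.
move=> uE allE; rewrite -size_filter cardE.
pose phi (c : {ffun T -> 'I_k}) := [seq nat_of_ord (c V) | V <- E].
have nphi c V : nth 0 (phi c) (index V E) = c V.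
  by rewrite (nth_map V) ?index_mem // nth_index.
have phi_inj : injective phi.
  move=> c d E'; apply/ffunP => V; apply: val_inj => /=.
  by rewrite -!nphi E'.
rewrite -(size_map phi); apply: perm_size; apply: uniq_perm.
- by rewrite (map_inj_uniq phi_inj) enum_uniq.
- by rewrite filter_uniq // uniq_words.
move=> u; rewrite mem_filter mem_words; apply/mapP/idP => [[c + ->]|].
  rewrite mem_enum inE => ci; rewrite size_map eqxx /=; apply/andP; split.
    by apply/forallP => V; apply/forallP => W; rewrite !nphi; have /forallP/(_ W) := forallP ci V.
  by apply/allP => x /mapP[V _ ->].
move=> /andP[/forallP gu /andP[/eqP su /allP uk]].
have lt_u V : nth 0 u (index V E) < k.
  by apply: uk; rewrite mem_nth // su index_mem.
pose c : {ffun T -> 'I_k} := [ffun V => Ordinal (lt_u V)].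
exists c.
  rewrite mem_enum inE; apply/forallP => V; apply/forallP => W; rewrite !ffunE /=.
  by have /forallP/(_ W) := gu V.
apply: (@eq_from_nth _ 0); first by rewrite size_map.
move=> p; rewrite su => lt_p; have V0 : T by case: (E) lt_p.
rewrite -[in LHS](index_uniq V0 lt_p uE); rewrite -[in RHS](index_uniq V0 lt_p uE).
by rewrite nphi ffunE.
Qed.

End Colorings.

Lemma big_words (c k m : nat) (P : seq nat -> nat) : c <= k ->
  \sum_(u <- words k m | all (fun d => d < c) u) P u = \sum_(u <- words c m) P u.
Proof.
move=> ck; elim: m P => [|m IHm] P; first by rewrite !big_cons !big_nil.
have big_wS k' (Q : pred (seq nat)) : \sum_(u <- words k' m.+1 | Q u) P u =
    \sum_(0 <= d < k') \sum_(u <- words k' m | Q (d :: u)) P (d :: u).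
  rewrite /= big_flatten big_map /index_iota subn0.
  by apply: eq_bigr => d _; rewrite big_map.
rewrite !big_wS (big_cat_nat (n := c)) //= [X in _ + X]big_nat_cond.
rewrite [X in _ + X]big1 ?addn0; last first.
  move=> d /andP[/andP[cd _] _]; rewrite big_pred0 // => u.
  by rewrite ltnNge cd.
rewrite big_nat [RHS]big_nat; apply: eq_bigr => d /andP[_ dc].
by rewrite -(IHm (fun u => P (d :: u))); apply: eq_bigl => u; rewrite dc.
Qed.

Lemma big_wordsS k m (P : seq nat -> nat) :
  \sum_(u <- words k m.+1) P u = \sum_(c < k) \sum_(u <- words k m) P (nat_of_ord c :: u).
Proof.
rewrite /= big_flatten big_map.
have -> : iota 0 k = index_iota 0 k by rewrite /index_iota subn0.
rewrite big_mkord.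
by apply: eq_bigr => d _; rewrite big_map.
Qed.

Lemma big_words_cat k m1 m2 (P : seq nat -> nat) :
  \sum_(u <- words k (m1 + m2)) P u =
  \sum_(u <- words k m1) \sum_(u' <- words k m2) P (u ++ u').
Proof.
elim: m1 P => [|m1 IHm] P; first by rewrite big_seq1.
by rewrite addSn !big_wordsS; apply: eq_bigr => c _; rewrite IHm.
Qed.

Definition nest_ok (x y : (nat * nat) * nat) :=
  (x.1 != y.1) && cont x.1 y.1 ==> (y.2 < x.2).

Definition good_colors (z : seq ((nat * nat) * nat)) := allrel nest_ok z z.

Definition count_colors k (L : seq (nat * nat)) :=
  \sum_(u <- words k (size L)) (good_colors (zip L u) : nat).

Lemma good_colors_cat z1 z2 : good_colors (z1 ++ z2) =
  [&& good_colors z1, good_colors z2, allrel nest_ok z1 z2 & allrel nest_ok z2 z1].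
Proof.
rewrite /good_colors allrel_catl !allrel_catr.
by case: (allrel nest_ok z1 z1); case: (allrel nest_ok z2 z2);
   case: (allrel nest_ok z1 z2); case: (allrel nest_ok z2 z1).
Qed.

Lemma allrel_nest_disjoint (L1 L2 : seq (nat * nat)) u1 u2 :
  {in L1 & L2, forall p q, ~~ cont p q} -> allrel nest_ok (zip L1 u1) (zip L2 u2).
Proof.
have mem_zip1 (L : seq (nat * nat)) (u : seq nat) x : x \in zip L u -> x.1 \in L.
  elim: L u => [|p L IHL] [|c u] //=; rewrite !inE => /orP[/eqP->|/IHL->];
    by rewrite ?eqxx ?orbT.
move=> D; apply/allrelP => x y /mem_zip1 x1 /mem_zip1 y1.
by rewrite /nest_ok (negPf (D _ _ x1 y1)) andbF.
Qed.

Lemma count_colors_cat k L1 L2 :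
  {in L1 & L2, forall p q, ~~ cont p q} -> {in L2 & L1, forall p q, ~~ cont p q} ->
  count_colors k (L1 ++ L2) = count_colors k L1 * count_colors k L2.
Proof.
move=> D12 D21; rewrite /count_colors size_cat big_words_cat big_distrl /=.
rewrite big_seq [RHS]big_seq; apply: eq_bigr => u1; rewrite mem_words => /andP[/eqP s1 _].
rewrite big_distrr /=; apply: eq_bigr => u2 _.
rewrite zip_cat ?s1 // good_colors_cat !allrel_nest_disjoint // !andbT.
by rewrite -mulnb.
Qed.

(** Nested blocks take smaller colors, so color [c] on the root leaves the colors below [c] to all
    of [L]. *)
Lemma count_colors_root k r L : r \notin L ->
  {in L, forall q, cont r q} -> {in L, forall q, ~~ cont q r} ->
  count_colors k (r :: L) = \sum_(c < k) count_colors c L.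
Proof.
move=> rL C1 C2; rewrite /count_colors big_wordsS; apply: eq_bigr => c _.
rewrite -(@big_words c k) ?(ltnW (ltn_ord c)) // [RHS]big_mkcond big_seq [RHS]big_seq.
apply: eq_bigr => u; rewrite mem_words => /andP[/eqP su _] /=.
rewrite -[(r, _) :: _]/([:: (r, nat_of_ord c)] ++ zip L u) good_colors_cat.
have -> : good_colors [:: (r, nat_of_ord c)].
  by rewrite /good_colors /allrel /= /nest_ok eqxx.
have -> : allrel nest_ok (zip L u) [:: (r, nat_of_ord c)].
  by apply: (@allrel_nest_disjoint _ [:: r] _ [:: nat_of_ord c]) => p q pL; rewrite inE => /eqP->; apply: C2.
have -> : allrel nest_ok [:: (r, nat_of_ord c)] (zip L u) = all (fun d => d < c) u.
  rewrite /allrel /= andbT.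
  elim: L u su rL C1 {C2} => [|p L IHL] [|d u] //= [su].
  rewrite inE negb_or => /andP[rp rL] C1; rewrite IHL //; last first.
    by move=> q qL; apply: C1; rewrite inE qL orbT.
  by rewrite /nest_ok /= rp C1 // inE eqxx.
rewrite /= andbT; case: all; rewrite ?andbT ?andbF //.
Qed.

Lemma count_colors_iv t :
  (forall k i, count_colors k (ivS i t) = chr (OB k) t) /\ (forall k i, count_colors k (ivR i t) = prodgaps (chr (OB k)) t).
Proof.
have nil_count k : count_colors k [::] = 1 by rewrite /count_colors big_seq1.
(* Unrolled, the recursion sums over the color of the outer block. *)
have OBE k b : OB k b = \sum_(c < k) prodgaps (chr (OB c)) b.
  by elim: k => [|k IHk]; rewrite ?big_ord0 // big_ord_recr /= IHk.
elim: t => [|l [IHlS IHlB] r [IHrS IHrB]]; split=> // k i.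
  rewrite [ivS _ _]/= -cat_cons count_colors_cat ?IHrS.
  - congr (_ * _); rewrite count_colors_root.
    + by rewrite OBE; apply: eq_bigr => c _; apply: IHlB.
    + by apply/negP => /(mem_iv l).2 /=; lia.
    + by move=> [a h] /(mem_iv l).2 /=; rewrite /cont /=; lia.
    by move=> [a h] /(mem_iv l).2 /=; rewrite /cont /=; lia.
  - move=> [a h] [b m]; rewrite inE => /orP[/eqP[-> ->]|/(mem_iv l).2 H] /(mem_iv r).1;
      by try move: H; rewrite /cont /=; lia.
  move=> [a h] [b m] /(mem_iv r).1 H; rewrite inE => /orP[/eqP[-> ->]|/(mem_iv l).2];
    by move: H; rewrite /cont /=; lia.
rewrite [ivR _ _]/= count_colors_cat ?IHlS ?IHrB // => -[a h] [b m].
  by move=> /(mem_iv l).1 H /(mem_iv r).2; move: H; rewrite /cont /=; lia.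
by move=> /(mem_iv r).2 H /(mem_iv l).1; move: H; rewrite /cont /=; lia.
Qed.

Section OmegaTree.
Variables (n : nat) (s : bt).
Hypothesis sn : bsz s = n.
Notation w := (wdS 0 s).
Notation blk := (blkw n w).
Notation pi := (part_of n s).
Let T : finType := {V : {set 'I_n} | V \in pi}.
Let R : rel T := fun V W => nested (val V) (val W).

Lemma omega_k_surj k : omega_k pi k = #|surj R k|.
Proof. by apply: eq_card => c; rewrite !inE. Qed.

Lemma blk_in p : p \in ivS 0 s -> blk p.1 \in pi.
Proof.
case: p => a h /(iv_spec sn) [ahn Ea _ _]; have an : a < n by lia.
by apply/partwP; exists (Ordinal an); rewrite /= Ea.
Qed.

Lemma count_incr k : #|incr R k| = chr (OB k) s.
Proof.
set L := ivS 0 s; pose E : seq T := pmap insub [seq blk p.1 | p <- L].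
have vE : map val E = [seq blk p.1 | p <- L].
  rewrite (pmap_filter (@insubK _ _ _)); apply/all_filterP/allP => V /mapP[p pL ->].
  by rewrite /= isSome_insub /= blk_in.
have sE : size E = size L by rewrite -(size_map val E) vE size_map.
have LE : [seq blk p.1 | p <- L] = map blk (labS 0 s).
  by rewrite -(unzip1_iv s).1 -map_comp.
have uE : uniq E.
  apply: pmap_sub_uniq; rewrite LE map_inj_in_uniq ?(uniq_lab s).1 // => a b.
  rewrite !(mem_lab_wd s).1; exact: blkw_inj.
have uL : uniq L.
  by apply: (@map_uniq _ _ fst); rewrite (unzip1_iv s).1 (uniq_lab s).1.
have allE V : V \in E.
  rewrite mem_pmap_sub LE; have /partwP[i Ei] := valP V; rewrite Ei.
  by apply: map_f; rewrite (mem_lab_wd s).1 mem_nth // size_wdS sn.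
have nthE V0 p : p < size L -> val (nth V0 E p) = blk (nth (0, 0) L p).1.
  move=> lt_p; rewrite -(nth_map _ set0) ?sE // vE (nth_map (0, 0)) //.
rewrite (card_incr_words R k uE allE) -sum1_count big_mkcond.
rewrite -((count_colors_iv s).1 k 0) /count_colors -/L sE big_seq [RHS]big_seq.
apply: eq_bigr => u; rewrite mem_words => /andP[/eqP su _].
have szip : size (zip L u) = size L by rewrite size1_zip // su.
have nestE V0 p q : p < size L -> q < size L ->
    R (nth V0 E q) (nth V0 E p) =
    (nth (0, 0) L p != nth (0, 0) L q) && cont (nth (0, 0) L p) (nth (0, 0) L q).
  move=> lt_p lt_q; rewrite /R /nested !nthE //.
  have pL : nth (0, 0) L p \in ivS 0 s by apply: mem_nth.
  have qL : nth (0, 0) L q \in ivS 0 s by apply: mem_nth.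
  rewrite -!(nthE V0) // (inj_eq val_inj) !nth_uniq ?sE // !(nthE V0) // [q == p]eq_sym.
  by move: pL qL; case: (nth _ L p) => a h; case: (nth _ L q) => b m pL qL /=;
     rewrite (subset_hull sn pL qL).
suff -> : [forall V, forall W, R V W ==> (nth 0 u (index V E) < nth 0 u (index W E))] =
    good_colors (zip L u) by case: good_colors.
apply/forallP/allrelP => [H x y|H V].
  move=> /(nthP ((0, 0), 0))[p]; rewrite szip => lt_p <-.
  move=> /(nthP ((0, 0), 0))[q]; rewrite szip => lt_q <-.
  rewrite !nth_zip // /nest_ok /=; apply/implyP.
  have V0 : T by case: (E) sE lt_p => [<-|V0].
  rewrite -(nestE V0) // => Rqp.
  have /forallP/(_ (nth V0 E p))/implyP/(_ Rqp) := H (nth V0 E q).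
  by rewrite !index_uniq ?sE.
apply/forallP => W; apply/implyP => RVW.
have iV : index V E < size L by rewrite -sE index_mem.
have iW : index W E < size L by rewrite -sE index_mem.
have := H (nth ((0, 0), 0) (zip L u) (index W E)) (nth ((0, 0), 0) (zip L u) (index V E)).
rewrite !mem_nth ?szip // => /(_ isT isT); rewrite !nth_zip // /nest_ok /=.
by rewrite -(nestE V) // !nth_index // => /implyP; apply.
Qed.

End OmegaTree.

Local Open Scope ring_scope.

Lemma OB_omega (K : fieldType) n k b : bsz b = n -> (k <= n.+1)%N ->
  (OB k b)%:R = \sum_(j < n.+2) 'C(k, j)%:R * (omega_k (part_of n.+1 (N b L)) j)%:R :> K.
Proof.
move=> bn le_k; have sn : bsz (N b L) = n.+1 by rewrite /= bn addn0.
have := count_incr sn k; rewrite /= mulr1 => <-.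
rewrite card_incr natr_sum.
(* The range is made independent of k; the added terms vanish because 'C(k, j) = 0 for j > k. *)
rewrite (big_ord_widen_cond n.+2 predT (fun j => ('C(k, j) * #|surj _ j|)%:R : K)) //.
rewrite big_mkcond; apply: eq_bigr => j _; rewrite omega_k_surj -natrM.
by case: ifP => // /negbT; rewrite -leqNgt => lt; rewrite bin_small ?mul0n.
Qed.

(** * Refinement and Moebius inversion *)

(* [monoS t c]: every block of t is monochromatic for the word of colors c. *)
Fixpoint monoS (t : bt) (c : seq nat) : bool :=
  if t is N b s
  then monoB (head 0%N c) b (take (bsz b).+1 c) && monoS s (drop (bsz b).+1 c) else true
with monoB (a : nat) (t : bt) (c : seq nat) : bool :=
  if t is N g b
  then [&& head 0%N c == a, monoS g (take (bsz g) (behead c))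
         & monoB a b (drop (bsz g) (behead c))]
  else head 0%N c == a.

Lemma monoB_head a t c : monoB a t c -> head 0%N c = a.
Proof. by case: t => [|g b] /= => [/eqP|/and3P[/eqP]]. Qed.

Lemma monoB_last a t c d : size c = (bsz t).+1 -> monoB a t c -> last d c = a.
Proof.
elim: t c d => [|g _ b IHb] [|c0 c] d //= [sc]; first by case: c sc => // _ /eqP.
move=> /and3P[_ _ /IHb E]; rewrite -(cat_take_drop (bsz g) c) last_cat E //.
by rewrite size_drop sc; lia.
Qed.

Lemma drop_cat_le (T : Type) k (s s' : seq T) : (k <= size s)%N ->
  drop k (s ++ s') = drop k s ++ s'.
Proof.
move=> le_k; rewrite drop_cat; case: ltnP => // le.
have -> : (k - size s = 0)%N by lia.
by rewrite drop0 drop_oversize.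
Qed.

Lemma take_add_cat (T : Type) m k (u x : seq T) : size u = m ->
  take (m + k) (u ++ x) = u ++ take k x.
Proof. by move=> <-; rewrite take_cat ltnNge leq_addr /= addKn. Qed.

Lemma drop_add_cat (T : Type) m k (u x : seq T) : size u = m ->
  drop (m + k) (u ++ x) = drop k x.
Proof. by move=> <-; rewrite drop_cat ltnNge leq_addr /= addKn. Qed.

(** * Sums over the refinements of a partition *)

Section ColoredSums.
Variables (K : fieldType) (A B : algType K) (v : {lrmorphism B -> A}).
Variable r : seq A -> B.
Hypotheses (rl : slotlin v r) (rr : rightlin v r).
Implicit Types (c cu cv cz : seq nat) (w acc wu wv wz : seq A).

Definition Q c w : B := \sum_(t <- trs (size w)) (monoS t c)%:R *: evS v r t w.
Definition QB a acc c w : B :=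
  \sum_(b <- trs (size w).-1) (monoB a b c)%:R *: evB v r b acc w.

Lemma Q_nil c : Q c [::] = 1.
Proof. by rewrite /Q big_seq1 /= scale1r. Qed.

Lemma Q_rec c w : w != [::] -> Q c w = \sum_(q < size w)
  QB (head 0%N c) [::] (take q.+1 c) (take q.+1 w) * Q (drop q.+1 c) (drop q.+1 w).
Proof.
case: w => // y w _; rewrite /Q [size (y :: w)]/= big_trsS; apply: eq_bigr => q _.
rewrite /QB size_takel ?ltn_ord // mulr_suml /=.
rewrite big_seq [RHS]big_seq; apply: eq_bigr => b /bsz_trs bq.
rewrite size_drop mulr_sumr; apply: eq_bigr => s _.
by rewrite /= bq -scalerAl -scalerAr scalerA -natrM mulnb.
Qed.

Lemma QB_rec a acc c y w : w != [::] -> QB a acc c (y :: w) = (head 0%N c == a)%:R *: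
  \sum_(q < size w) QB a (rcons acc (y * v (Q (take q (behead c)) (take q w))))
     (drop q (behead c)) (drop q w).
Proof.
case: w => // y' w _; set w' := y' :: w; rewrite /QB [size (y :: w')]/= big_trsS.
rewrite scaler_sumr; apply: eq_bigr => q _.
rewrite exchange_big /= -/w'.
have -> : (size (drop q w')).-1 = (size w - q)%N.
  by rewrite size_drop [size w']/=; have := ltn_ord q; lia.
rewrite scaler_sumr; apply: eq_bigr => b _; rewrite /Q size_takel; last by rewrite ltnW // ltn_ord.
rewrite evB_last_sum // !scaler_sumr big_seq [RHS]big_seq.
apply: eq_bigr => g /bsz_trs gq; rewrite gq !scalerA -!natrM !mulnb.
by congr (_%:R *: _); case: eqP => //=; rewrite andbC.
Qed.

Lemma Q_recn n c w : size w = n.+1 -> Q c w = \sum_(q < n.+1)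
  QB (head 0%N c) [::] (take q.+1 c) (take q.+1 w) * Q (drop q.+1 c) (drop q.+1 w).
Proof. by move=> sw; rewrite -sw; apply: Q_rec; case: (w) sw. Qed.

Lemma QB_recn n a acc c y w : size w = n -> w != [::] ->
  QB a acc c (y :: w) = (head 0%N c == a)%:R *:
  \sum_(q < n) QB a (rcons acc (y * v (Q (take q (behead c)) (take q w))))
     (drop q (behead c)) (drop q w).
Proof. by move=> <- /QB_rec. Qed.

Lemma QB_head0 a acc c w : head 0%N c != a -> QB a acc c w = 0.
Proof.
move=> ne; rewrite /QB big1 // => b _.
by case mb: (monoB a b c); rewrite ?scale0r //; move/monoB_head: mb ne => ->; rewrite eqxx.
Qed.

Lemma QB_last0 a acc c w : size c = size w -> w != [::] -> last 0%N c != a ->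
  QB a acc c w = 0.
Proof.
move=> sc wn ne; rewrite /QB big_seq big1 // => b /bsz_trs sb.
have sc' : size c = (bsz b).+1 by rewrite sc sb prednK // lt0n size_eq0.
by case mb: (monoB a b c); rewrite ?scale0r //; rewrite (monoB_last _ sc' mb) eqxx in ne.
Qed.

Lemma QB_right a acc c w y e :
  QB a acc c (rcons w (y * v e)) = QB a acc c (rcons w y) * e.
Proof.
rewrite /QB !size_rcons mulr_suml big_seq [RHS]big_seq.
by apply: eq_bigr => b /bsz_trs sb; rewrite (ev_right b rr).2 // scalerAl.
Qed.

(** The first and last points of a component have the same color, so a component that starts in [w1]
    also ends there. *)
Lemma Q_cat c1 c2 w1 w2 : size c1 = size w1 -> size c2 = size w2 ->
  {in c1, forall a, a \notin c2} -> Q (c1 ++ c2) (w1 ++ w2) = Q c1 w1 * Q c2 w2.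
Proof.
have [n] := ubnP (size w1); elim: n c1 w1 => // n IHn c1 w1 lt_n s1 s2 D.
have [w10|w1n] := eqVneq w1 [::].
  by rewrite w10 in s1 *; move/size0nil: s1 => ->; rewrite Q_nil mul1r.
have c1n : (0 < size c1)%N by rewrite s1 lt0n size_eq0.
rewrite Q_rec; last by case: (w1) w1n.
rewrite size_cat big_split_ord /= [X in _ + X]big1 ?addr0; last first.
  move=> q _; rewrite QB_last0 ?mul0r //.
  - by rewrite !size_take_min !size_cat s1 s2.
  - by case: (w1) w1n.
  have E : take (size w1 + q).+1 (c1 ++ c2) = c1 ++ take q.+1 c2.
    by rewrite take_cat -s1; case: ltnP; [lia | move=> _; congr (_ ++ take _ _); lia].
  rewrite E last_cat.
  have lt_q : (q.+1 <= size c2)%N by rewrite s2 ltn_ord.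
  have : last (last 0%N c1) (take q.+1 c2) \in take q.+1 c2.
    case E2: (take q.+1 c2) => [|a s]; last exact: mem_last.
    by move/(congr1 size): E2; rewrite size_takel.
  rewrite (_ : head 0%N (c1 ++ c2) = head 0%N c1); last by case: (c1) c1n.
  move=> /mem_take lin; apply: contraTneq lin => ->; apply: D.
  by case: (c1) c1n => // a s _; rewrite inE eqxx.
rewrite Q_rec // mulr_suml; apply: eq_bigr => q _.
have lt_q : (q < size c1)%N by rewrite s1 ltn_ord.
have -> : head 0%N (c1 ++ c2) = head 0%N c1 by case: (c1) c1n.
have lt_q' : (q < size w1)%N := ltn_ord q.
rewrite !takel_cat // !drop_cat_le // -mulrA IHn //.
- by rewrite size_drop; lia.
- by rewrite !size_drop s1.
by move=> a /mem_drop; apply: D.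
Qed.

Definition Q_insert_at m := forall cu cv cz wu y wv wz, size wu = m ->
  size cu = (size wu).+1 -> size cv = size wv -> size cz = size wz ->
  {in cv, forall b, (b \notin cu) && (b \notin cz)} ->
  Q (cu ++ cv ++ cz) (rcons wu y ++ wv ++ wz) =
  Q (cu ++ cz) (rcons wu (y * v (Q cv wv)) ++ wz).

(** [wz] must be nonempty: a component ends at a point of its outer block, so with nothing after
    [wv] the left side would be 0, while on the right the component could end at the letter [y]. *)
Definition QB_insert_at m := forall a acc cu cv cz wu y wv wz, size wu = m ->
  wz != [::] -> size cu = (size wu).+1 -> size cv = size wv -> size cz = size wz ->
  {in cv, forall b, (b \notin cu) && (b \notin cz)} ->
  QB a acc (cu ++ cv ++ cz) (rcons wu y ++ wv ++ wz) =
  QB a acc (cu ++ cz) (rcons wu (y * v (Q cv wv)) ++ wz).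

(** The colors of [cv] occur nowhere else, so the blocks on [wv] are separate from the others and
    sit between two neighboring letters; their total value is absorbed into the letter on the
    left. *)
Lemma Q_insert m : Q_insert_at m /\ QB_insert_at m.
Proof.
elim/ltn_ind: m => m IHm.
have HB : QB_insert_at m.
  move=> a acc cu cv cz wu y wv wz su zn scu scv scz D.
  case: cu scu D => // a0 cu scu D.
  have [ea|ne] := eqVneq a0 a; last by rewrite !QB_head0.
  have D' : {in cv, forall b, b \notin cz} by move=> b /D /andP[].
  have av b : b \in cv -> b != a.
    by move=> /D /andP[+ _]; rewrite inE negb_or ea => /andP[].
  have headv q u : (q < size cv)%N -> head 0%N (drop q (cv ++ u)) != a.
    move=> lt_q; rewrite -nth0 nth_drop addn0 nth_cat lt_q; apply: av.
    exact: mem_nth.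
  have zn' u : u ++ wz != [::] by case: u.
  case: wu su scu => [|y0 wu] su [scu].
    move/size0nil: scu D => -> D /=.
    rewrite (QB_recn _ _ _ _ (size_cat wv wz)) // (QB_recn _ _ _ _ (erefl (size wz))) //=.
    congr (_ *: _); rewrite big_split_ord /= big1 ?add0r => [|q _]; last first.
      by rewrite QB_head0 // headv // scv.
    apply: eq_bigr => j _; rewrite !take_add_cat // !drop_add_cat //.
    rewrite Q_cat ?rmorphM ?mulrA //.
      by rewrite !size_take_min scz.
    by move=> b /D'; apply: contra => /mem_take.
  rewrite !rcons_cons !cat_cons.
  have sz Y : size (rcons wu Y ++ wv ++ wz) = ((size wu).+1 + (size wv + size wz))%N.
    by rewrite !size_cat size_rcons.
  have sz' Y : size (rcons wu Y ++ wz) = ((size wu).+1 + size wz)%N.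
    by rewrite !size_cat size_rcons.
  have rn Y u : rcons wu Y ++ u != [::] by case: (wu).
  rewrite (QB_recn _ _ _ _ (sz _)) // (QB_recn _ _ _ _ (sz' _)) //=.
  have D2 : {in cv, forall b, (b \notin cu) && (b \notin cz)}.
    by move=> b /D /andP[]; rewrite inE negb_or => /andP[_ ->] ->.
  have lt_m : (size wu < m)%N by move: su => /=; lia.
  congr (_ *: _); rewrite !big_split_ord /=; congr (_ + _).
    apply: eq_bigr => q _; have lt_q := ltn_ord q.
    have le_q : (q <= size wu)%N by [].
    have le_qc : (q <= size cu)%N by lia.
    rewrite !takel_cat ?size_rcons ?(ltnW lt_q) //.
    rewrite !take_rcons_le // !drop_cat_le ?size_rcons ?(ltnW lt_q) //.
    rewrite !drop_rcons_le //; apply: ((IHm (size (drop q wu)) _).2) => //.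
    - by rewrite size_drop; lia.
    - by rewrite !size_drop; lia.
    by move=> b /D2 /andP[bu ->]; rewrite andbT; apply: contra bu => /mem_drop.
  rewrite big1 ?add0r => [|q _]; last first.
    by rewrite drop_add_cat // QB_head0 // headv // scv.
  apply: eq_bigr => j _.
  rewrite !take_add_cat ?size_rcons // !drop_add_cat ?size_rcons //.
  congr (QB _ (rcons _ (_ * v _)) _ _); apply: (IHm _ lt_m).1 => //.
    by rewrite !size_take_min scz.
  by move=> b /D2 /andP[-> bz] /=; apply: contra bz => /mem_take.
split=> // cu cv cz wu y wv wz su scu scv scz D.
have D' : {in cv, forall b, b \notin cz} by move=> b /D /andP[].
have sz : size (rcons wu y ++ wv ++ wz) = ((size wu).+1 + (size wv + size wz))%N.
  by rewrite !size_cat size_rcons.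
have sz' Y : size (rcons wu Y ++ wz) = ((size wu).+1 + size wz)%N.
  by rewrite !size_cat size_rcons.
have hd u : head 0%N (cu ++ u) = head 0%N cu by case: (cu) scu.
(* The sums are split by the end of the first component: up to [y], inside [wv], where the colors
   give 0, or inside [wz]. *)
rewrite (Q_recn _ sz) (Q_recn _ (sz' _)) !hd -!addSn !big_split_ord /=.
congr (_ + _); last first.
  rewrite big1 ?add0r => [|q _]; last first.
    rewrite -addnS !take_add_cat ?size_rcons // QB_last0 ?mul0r //.
    - by rewrite !size_cat size_rcons scu !size_take_min !size_cat scv scz.
    - by case: (wu).
    have lt_q : (q.+1 <= size cv)%N by rewrite scv.
    rewrite takel_cat // last_cat.
    have : last (last 0%N cu) (take q.+1 cv) \in take q.+1 cv.
      case E2: (take q.+1 cv) => [|b s]; last exact: mem_last.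
      by move/(congr1 size): E2; rewrite size_takel.
    move=> /mem_take /D /andP[+ _]; apply: contraNneq => ->.
    by case: (cu) scu => // b s _; rewrite inE eqxx.
  apply: eq_bigr => j _; have lt_j := ltn_ord j.
  rewrite -!addnS !take_add_cat ?size_rcons // !drop_add_cat ?size_rcons //.
  rewrite HB //.
  - by rewrite -size_eq0 size_takel.
  - by rewrite !size_take_min scz.
  by move=> b /D /andP[-> bz] /=; apply: contra bz => /mem_take.
rewrite !big_ord_recr /=; congr (_ + _).
  apply: eq_bigr => q _; have lt_q := ltn_ord q.
  have lt_qc : (q < size cu)%N by lia.
  rewrite !takel_cat ?size_rcons //; try lia.
  rewrite !take_rcons_le // !drop_cat_le ?size_rcons //; try lia.
  rewrite !drop_rcons_le //; congr (_ * _).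
  apply: ((IHm (size (drop q.+1 wu)) _).1) => //.
  - by rewrite size_drop; lia.
  - by rewrite !size_drop; lia.
  by move=> b /D /andP[bu ->]; rewrite andbT; apply: contra bu => /mem_drop.
(* The component ends at [y] itself: [wv] then starts the remaining forest on the left side, and its
   value leaves the last slot on the right side. *)
rewrite -[(size wu).+1]addn0 !take_add_cat ?size_rcons // !drop_add_cat ?size_rcons //.
rewrite !take0 !drop0 !cats0 Q_cat // QB_right mulrA //.
Qed.

(** This is the identity M_pi = sum of r_sigma over sigma <= pi: for the labels of [t] as colors,
    the monochromatic partitions are the refinements of [t], and insertion peels off one gap after
    another. *)
Lemma Q_wd t :
  (forall i w, size w = bsz t -> Q (wdS i t) w = evS v (ES v r (fun=> 1)) t w) /\
  (forall o i acc w, (o <= i)%N -> size w = (bsz t).+1 ->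
     Q (nseq (size acc) o ++ wdB o i t) (acc ++ w) = evB v (ES v r (fun=> 1)) t acc w).
Proof.
have monoC a s : monoS s (nseq (bsz s) a) /\ monoB a s (nseq (bsz s).+1 a).
  elim: s => [|b [IHb1 IHb2] s [IHs1 IHs2]]; first by rewrite /= eqxx.
  have tk m k : take m (nseq (m + k) a) = nseq m a by rewrite nseqD take_size_cat ?size_nseq.
  have dr m k : drop m (nseq (m + k) a) = nseq k a by rewrite nseqD drop_size_cat ?size_nseq.
  rewrite [bsz _]/=; split.
    have -> : ((bsz b + bsz s).+1 = (bsz b).+1 + bsz s)%N by lia.
    by rewrite [monoS _ _]/= tk dr IHb2.
  have -> : ((bsz b + bsz s).+2 = (bsz b + (bsz s).+1).+1)%N by lia.
  by rewrite [monoB _ _ _]/= eqxx tk dr IHb1.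
elim: t => [|g [IHgS IHgB] b [IHbS IHbB]]; split.
- by move=> i w /size0nil ->; rewrite Q_nil.
- move=> o i acc [|y [|]] // oi _; rewrite [wdB _ _ _]/= nseq_cons cats0 cats1 /=.
  rewrite /Q /ES; rewrite big_seq [RHS]big_seq; apply: eq_bigr => s /bsz_trs ss.
  rewrite size_rcons in ss; rewrite (_ : o :: _ = nseq (size acc).+1 o) // -ss.
  by rewrite (monoC o s).1.
- move=> i w sw; rewrite [wdS _ _]/= -{1}(cat_take_drop (bsz g).+1 w).
  have st : size (take (bsz g).+1 w) = (bsz g).+1 by rewrite size_takel // sw /=; lia.
  rewrite Q_cat ?size_wdB ?size_wdS ?st ?size_drop ?sw //; try by rewrite /=; lia.
    rewrite (IHgB i i [::]) // IHbS ?size_drop ?sw //=; lia.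
  move=> a /(mem_wd g).2 Ha; apply/negP => /(mem_wd b).1 Hb.
  by case/orP: Ha => [/eqP|]; lia.
move=> o i acc [|w0 w] // oi [sw]; rewrite [wdB _ _ _]/= nseq_cons.
have -> : acc ++ w0 :: w = rcons acc w0 ++ take (bsz g) w ++ drop (bsz g) w.
  by rewrite cat_take_drop cat_rcons.
rewrite (Q_insert (size acc)).1 ?size_nseq ?size_wdB ?size_wdS //.
- rewrite IHgS; last by rewrite size_takel // sw; lia.
  set z := w0 * _; rewrite -(size_rcons acc z) IHbB //; first by lia.
  by rewrite size_drop sw; lia.
- by rewrite size_takel // sw; lia.
- by rewrite size_drop sw; lia.
move=> a /(mem_wd g).1 Ha; rewrite mem_nseq; apply/andP; split.
  by rewrite negb_and; apply/orP; right; apply/eqP; lia.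
by apply/negP => /(mem_wd b).2 /orP[/eqP|]; lia.
Qed.

End ColoredSums.

Local Close Scope ring_scope.

(** A label is the position of a first point, so [map f] repeats the color of the first point along
    each block. *)
Lemma mono_wd (f : nat -> nat) t :
  (forall i c, size c = bsz t -> (forall k, k < bsz t -> f (i + k) = nth 0 c k) ->
     monoS t c = (map f (wdS i t) == c)) /\
  (forall o i c, size c = (bsz t).+1 ->
     (forall k, k < bsz t -> f (i.+1 + k) = nth 0 c k.+1) ->
     monoB (f o) t c = (map f (wdB o i t) == c)).
Proof.
elim: t => [|g [IHgS IHgB] b [IHbS IHbB]]; split.
- by move=> i c /size0nil ->.
- by move=> o i [|a [|]] //= _ _; rewrite eqseq_cons eqxx andbT eq_sym.
- move=> i c sc H; rewrite [bsz _]/= in sc H.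
  have h0 : f i = head 0 c by rewrite -nth0 -H // addn0.
  rewrite [monoS _ _]/= -h0 (IHgB i i); last first.
  + by move=> k lt_k; rewrite nth_take // -H; [congr f; lia|lia].
  + by rewrite size_takel // sc; lia.
  rewrite (IHbS (i + bsz g).+1); last first.
  + by move=> k lt_k; rewrite nth_drop -H; [congr f; lia|lia].
  + by rewrite size_drop sc; lia.
  rewrite -[in RHS](cat_take_drop (bsz g).+1 c) [wdS _ _]/= map_cat eqseq_cat //.
  by rewrite size_map size_wdB size_takel // sc; lia.
move=> o i [|c0 c] //; rewrite [bsz _]/= => -[sc] H.
rewrite [monoB _ _ _]/= (IHgS i.+1); last first.
- by move=> k lt_k; rewrite nth_take // H //; lia.
- by rewrite size_takel // sc; lia.
rewrite (IHbB o (i.+1 + bsz g)); last first.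
- move=> k lt_k; rewrite nth_drop.
  have -> : (i.+1 + bsz g).+1 + k = i.+1 + (bsz g + k.+1) by lia.
  by rewrite H //; lia.
- by rewrite size_drop sc; lia.
rewrite [wdB _ _ _]/= map_cons eqseq_cons eq_sym; congr (_ && _).
rewrite -[in RHS](cat_take_drop (bsz g) c) map_cat eqseq_cat //.
by rewrite size_map size_wdS size_takel // sc; lia.
Qed.

Lemma refines_part_of n t t' : bsz t = n -> bsz t' = n ->
  refines (part_of n t) (part_of n t') = monoS t (wdS 0 t').
Proof.
move=> tn tn'; set w' := wdS 0 t'; set w := wdS 0 t.
have sw : size w = n by rewrite size_wdS.
have sw' : size w' = n by rewrite size_wdS.
rewrite ((mono_wd (nth 0 w') t).1 0) ?sw' //.
apply/forall_inP/eqP => [H|E V /partwP[i ->]].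
  apply: (@eq_from_nth _ 0); rewrite size_map sw // => p lt_p.
  rewrite (nth_map 0) ?sw //; set a := nth 0 w p.
  have [le_a Ea] : 0 <= a <= 0 + p /\ nth 0 w (a - 0) = a.
    by apply: (@wdS_canon 0 t); rewrite size_wdS tn.
  have lt_a : a < n by lia.
  have /H/exists_inP[W /partwP[j ->] /subsetP sub] : blkw n w a \in part_of n t.
    by apply/partwP; exists (Ordinal lt_p).
  have /sub pW : Ordinal lt_p \in blkw n w a by rewrite mem_blkw.
  have /sub aW : Ordinal lt_a \in blkw n w a.
    by rewrite mem_blkw -[nth _ _ _]/(nth 0 w a) -{2}Ea subn0.
  by move: pW aW; rewrite !mem_blkw => /eqP pW /eqP aW; rewrite [LHS]aW -pW.
have En p : p < n -> nth 0 w' (nth 0 w p) = nth 0 w' p.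
  by move=> lt_p; rewrite -[in RHS]E (nth_map 0) // sw.
apply/exists_inP; exists (blkw n w' (nth 0 w' i)).
  by apply/partwP; exists i.
apply/subsetP => j; rewrite !mem_blkw => /eqP Ej.
by rewrite -(En j) // Ej (En i).
Qed.

Section RefinementOrder.
Variable n : nat.
Implicit Types pi sigma rho : {set {set 'I_n}}.

Lemma refines_refl : {in NC n, reflexive (@refines n)}.
Proof. by move=> pi _; apply/forall_inP => V VV; apply/exists_inP; exists V. Qed.

Lemma refines_trans : {in NC n & &, transitive (@refines n)}.
Proof.
move=> pi sigma rho _ _ _ /forall_inP H1 /forall_inP H2; apply/forall_inP => V.
move=> /H1/exists_inP[W /H2/exists_inP[X XX WX] VW]; apply/exists_inP; exists X => //.
exact: subset_trans WX.
Qed.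

Lemma refines_anti : {in NC n &, antisymmetric (@refines n)}.
Proof.
have half sigma pi : sigma \in NC n -> refines sigma pi -> refines pi sigma ->
    sigma \subset pi.
  rewrite inE => /andP[/and3P[_ tI n0] _] /forall_inP H1 /forall_inP H2.
  apply/subsetP => V Vs; have /exists_inP[W Wp VW] := H1 V Vs.
  have /exists_inP[X Xs WX] := H2 W Wp.
  have VX : V = X.
    apply: contraNeq n0 => ne.
    have := trivIsetP tI V X Vs Xs ne; rewrite -setI_eq0.
    by rewrite (setIidPl (subset_trans VW WX)) => /eqP <-.
  suff -> : V = W by [].
  by apply/eqP; rewrite eqEsubset VW /= VX.
move=> sigma pi sN pN /andP[H1 H2]; apply/eqP.
by rewrite eqEsubset !half.
Qed.

Lemma refines_one_part pi : refines pi (one_part n).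
Proof.
apply/forall_inP => V _; apply/exists_inP; exists setT; first by rewrite inE.
exact: subsetT.
Qed.

End RefinementOrder.

Section MobiusLeft.
Variables (T : finType) (P : {set T}) (le : rel T).
Hypothesis le_refl : {in P, reflexive le}.
Hypothesis le_anti : {in P &, antisymmetric le}.
Hypothesis le_trans : {in P & &, transitive le}.

(* The incidence matrix of the order has a right inverse, hence a left one. *)
Lemma mobius_suml x y : x \in P -> y \in P ->
  (\sum_(z in P | le x z && le z y) mobius P le z y = (x == y)%:R)%R.
Proof.
move=> xP yP.
pose Z := (\matrix_(i < #|P|, j < #|P|) (le (enum_val i) (enum_val j))%:R : 'M[int]_#|P|)%R.
pose Mu := (\matrix_(i < #|P|, j < #|P|) ((le (enum_val i) (enum_val j))%:R
  * mobius P le (enum_val i) (enum_val j)) : 'M[int]_#|P|)%R.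
have E (F : T -> int) a b : 
    (\sum_(z in P | le a z && le z b) F z =
     \sum_(k < #|P|) (le a (enum_val k))%:R * (le (enum_val k) b)%:R * F (enum_val k))%R.
  rewrite big_mkcondr.
  rewrite -(big_enum_val (fun z => (le a z)%:R * (le z b)%:R * F z)%R).
  apply: eq_bigr => z _; by rewrite -natrM mulnb; case: (_ && _); rewrite ?mul1r ?mul0r.
have MuZ : (Mu *m Z = 1%:M)%R.
  apply/matrixP => i j; rewrite !mxE.
  have [le_ij|nle] := boolP (le (enum_val i) (enum_val j)).
    rewrite -(inj_eq enum_val_inj) -(mobius_sum le_refl le_anti le_trans) ?enum_valP // E.
    by apply: eq_bigr => k _; rewrite !mxE mulrAC.
  rewrite big1 => [|k _].
    by case: eqP nle => // ->; rewrite le_refl ?enum_valP.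
  rewrite !mxE mulrAC -natrM mulnb.
  case: andP => [[le1 le2]|_]; last by rewrite mul0r.
  by rewrite (le_trans _ _ _ le1 le2) ?enum_valP in nle.
have /matrixP ZMu := mulmx1C MuZ.
have := ZMu (enum_rank_in xP x) (enum_rank_in xP y).
rewrite !mxE -(inj_eq enum_val_inj) !enum_rankK_in // => <-.
by rewrite E; apply: eq_bigr => k _; rewrite !mxE !enum_rankK_in // mulrA.
Qed.

End MobiusLeft.

Local Open Scope ring_scope.

Lemma part_of_comb n : part_of n.+1 (N (comb n) L) = one_part n.+1.
Proof.
have E i : blkw n.+1 (wdS 0 (N (comb n) L)) (nth 0%N (wdS 0 (N (comb n) L)) i) = setT
    \/ (n.+1 <= i)%N.
  rewrite [wdS _ _]/= cats0 (wd_comb n).1.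
  have [lt_i|?] := ltnP i n.+1; [left|by right].
  by apply/setP => j; rewrite mem_blkw !nth_nseq lt_i ltn_ord inE eqxx.
apply/setP => V; rewrite inE; apply/partwP/eqP => [[i ->]|->].
  by case: (E i) => //; rewrite leqNgt ltn_ord.
by exists ord0; case: (E 0%N).
Qed.

Lemma one_part_NC n : (0 < n)%N -> one_part n \in NC n.
Proof.
by case: n => // n _; rewrite -part_of_comb part_of_NC //= bsz_comb addn0.
Qed.

Lemma pblock_one_part n i : pblock (one_part n) i = setT.
Proof.
have : pblock (one_part n) i \in one_part n.
  by apply: pblock_mem; rewrite /cover /one_part big_set1 inE.
by rewrite inE => /eqP.
Qed.

(** * Uniqueness in the moment-cumulant formulas *)

Section Uniqueness.
Variables (K : fieldType) (A : algType K) (SB : {pred A}) (B : subAlgType SB).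

Section Fixed.
Variables (n : nat) (n0 : (0 < n)%N).
Implicit Types (pi : {set {set 'I_n}}) (x : n.-tuple A).

Lemma pblock_word_constant pi : pi \in NC n ->
  constant [seq pblock pi i | i <- enum 'I_n] = (pi == one_part n).
Proof.
rewrite inE => /andP[pP _]; have /and3P[/eqP cP tI p0] := pP.
case: n n0 pi pP cP tI p0 => // m _ pi pP cP tI p0.
apply/idP/eqP => [cst|->].
  have E i : pblock pi i = pblock pi ord0.
    rewrite enum_ordSl /= in cst; move/allP: cst => cst.
    have : i \in enum 'I_m.+1 by rewrite mem_enum.
    rewrite enum_ordSl inE => /orP[/eqP-> //|ii].
    by have /cst/eqP := map_f (pblock pi) ii.
  have T0 : pblock pi ord0 = setT.
    by apply/setP => i; rewrite -(pblock_eqE _ _ pP) E eqxx inE.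
  apply/setP => V; rewrite inE; apply/idP/eqP => [Vpi|->].
    have [V0|[i iV]] := set_0Vmem V; first by rewrite -V0 Vpi in p0.
    by rewrite -(def_pblock tI Vpi iV) E T0.
  by rewrite -T0 pblock_mem // cP inE.
by rewrite (eq_map (pblock_one_part (n := m.+1))) enum_ordSl /=; apply/allP => V /mapP[? _ ->] /=.
Qed.

Lemma ext_fam_agree (F G : {set 'I_n} -> seq A -> B) pi x :
  pi \in NC n -> pi != one_part n ->
  (forall V u, (size u < n)%N -> F V u = G V u) -> ext_fam F pi x = ext_fam G pi x.
Proof.
move=> pN ne FG; apply: (ext_word_agree (N := n)) => //.
- by rewrite size_map size_enum_ord.
- by rewrite size_tuple.
by rewrite pblock_word_constant ?ne.
Qed.

Lemma ext_fam_one_part (F : {set 'I_n} -> seq A -> B) x :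
  ext_fam F (one_part n) x = F setT x.
Proof.
rewrite /ext_fam; case: n n0 F x => // m _ F x.
rewrite (eq_map (pblock_one_part (n := m.+1))) enum_ordSl /= ifT //.
by apply/allP => V /mapP[? _ ->] /=.
Qed.

Lemma ext_one_part (f : seq A -> B) x : ext f (one_part n) x = f x.
Proof. exact: ext_fam_one_part. Qed.

Lemma dext_one_part (f df : seq A -> B) x : dext f df (one_part n) x = df x.
Proof. by rewrite /dext big_set1 /dext_at ext_fam_one_part eqxx. Qed.

Lemma ext_agree (f g : seq A -> B) pi x : pi \in NC n -> pi != one_part n ->
  (forall u, (size u < n)%N -> f u = g u) -> ext f pi x = ext g pi x.
Proof. by move=> pN ne fg; apply: ext_fam_agree => // _; apply: fg. Qed.

Lemma dext_agree (f g df dg : seq A -> B) pi x : pi \in NC n -> pi != one_part n ->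
  (forall u, (size u < n)%N -> f u = g u) -> (forall u, (size u < n)%N -> df u = dg u) ->
  dext f df pi x = dext g dg pi x.
Proof.
move=> pN ne fg dfg; apply: eq_bigr => V _; apply: ext_fam_agree => // W u lt_u.
by case: ifP => _; [apply: dfg | apply: fg].
Qed.

End Fixed.

Variable c : forall n, {set {set 'I_n}} -> K.
Hypothesis c1 : forall n, c (one_part n.+1) = 1.

(** Induction on the number of arguments: the one-block term isolates the unknown map with
    coefficient 1, and every other partition involves it on shorter words only. [X] and [Y] stand
    for [ext] or [dext]. *)
Lemma top_part_unique (f g : seq A -> B)
    (X Y : forall n, {set {set 'I_n}} -> n.-tuple A -> B) : f [::] = g [::] ->
  (forall n (x : n.+1.-tuple A),
     X n.+1 (one_part n.+1) x = f x /\ Y n.+1 (one_part n.+1) x = g x) ->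
  (forall n pi (x : n.+1.-tuple A), pi \in NC n.+1 -> pi != one_part n.+1 ->
     (forall u, (size u < n.+1)%N -> f u = g u) -> X n.+1 pi x = Y n.+1 pi x) ->
  (forall n (x : n.-tuple A), (0 < n)%N ->
     \sum_(pi in NC n) c pi *: X n pi x = \sum_(pi in NC n) c pi *: Y n pi x) ->
  f =1 g.
Proof.
move=> fg0 top low H x; have [n] := ubnP (size x); elim: n x => // n IHn [//|y x] lt_x.
have := H _ (in_tuple (y :: x)) (ltn0Sn _).
rewrite (bigD1 (one_part _)) ?one_part_NC //= [in RHS](bigD1 (one_part _)) ?one_part_NC //=.
have [-> ->] := top _ (in_tuple (y :: x)).
rewrite c1 !scale1r (eq_bigr (fun pi => c pi *: Y _ pi (in_tuple (y :: x)))).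
  by move/addIr.
move=> pi /andP[pN ne]; congr (_ *: _); apply: low => // u lt_u.
by apply: IHn; apply: leq_trans lt_u _.
Qed.

Lemma ext_unique (f g : seq A -> B) : f [::] = g [::] ->
  (forall n (x : n.-tuple A), (0 < n)%N ->
     \sum_(pi in NC n) c pi *: ext f pi x = \sum_(pi in NC n) c pi *: ext g pi x) ->
  f =1 g.
Proof.
move=> fg0; apply: top_part_unique => // [n x|n pi x pN ne fg].
  by rewrite !ext_one_part.
exact: ext_agree.
Qed.

Lemma dext_unique (f d d' : seq A -> B) : d [::] = d' [::] ->
  (forall n (x : n.-tuple A), (0 < n)%N ->
     \sum_(pi in NC n) c pi *: dext f d pi x = \sum_(pi in NC n) c pi *: dext f d' pi x) ->
  d =1 d'.
Proof.
move=> d0; apply: top_part_unique => // [n x|n pi x pN ne dd'].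
  by rewrite !dext_one_part.
exact: dext_agree.
Qed.

End Uniqueness.

(** * Infinitesimal cumulants as eps-components *)

Section Deconcatenation.
Variables (K : fieldType) (A B : algType K) (v : {lrmorphism B -> A}).
Variable beta : seq A -> B.
Let M := ES v beta (chr (fun b => (flat b)%:R)).

Lemma flat_renewal (w : seq A) : w != [::] ->
  M w = \sum_(q < size w) beta (take q.+1 w) * M (drop q.+1 w).
Proof.
case: w => // y w _; rewrite /M ES_chr [size (_ :: _)]/=.
by apply: eq_bigr => q _; rewrite EB_flat.
Qed.

Lemma flat_renewal_last (w : seq A) : w != [::] ->
  M w = \sum_(q < size w) M (take q w) * beta (drop q w).
Proof.
have M0 : M [::] = 1 by rewrite /M ES_nil scale1r.
have [n] := ubnP (size w); elim: n w => // n IHn [//|y w] lt_n _.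
rewrite flat_renewal // [size _]/= big_ord_recr big_ord_recl /= take_size drop_size M0.
rewrite mulr1 mul1r addrC; congr (_ + _).
under [RHS]eq_bigr => m _.
  rewrite flat_renewal // [size _]/= mulr_suml size_takel ?(ltnW (ltn_ord m)) //.
  under eq_bigr => q _ do rewrite /= take_takel -1?ltnS //.
  over.
rewrite (big_triangle _ (fun m q => beta (y :: take q w) * M (drop q (take m w)) * beta (drop m w))).
apply: eq_bigr => q _; have lt_q := ltn_ord q.
have dn : drop q w != [::] by rewrite -size_eq0 size_drop -lt0n subn_gt0.
rewrite IHn //; last by rewrite size_drop; move: lt_n => /=; lia.
rewrite size_drop.
rewrite mulr_sumr; apply: eq_bigr => p _.
by rewrite mulrA take_drop drop_drop addnC.
Qed.

Lemma flat_inverse y w :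
  beta (y :: w) = - ES v M (chr (fun b => - (flat b)%:R)) (y :: w).
Proof.
have [n] := ubnP (size w); elim: n y w => // n IHn y w lt_n.
rewrite ES_chr big_ord_recr /= take_size drop_size ES_nil /= scale1r mulr1.
rewrite EB_opp_flat opprD opprK flat_renewal_last // [size _]/= big_ord_recl /=.
rewrite (_ : M [::] = 1) ?mul1r; last by rewrite /M ES_nil scale1r.
rewrite addrCA -[LHS]addr0; congr (_ + _).
apply/esym/eqP; rewrite addrC subr_eq0; apply/eqP; apply: eq_bigr => q _.
rewrite EB_opp_flat mulNr -mulrN; congr (_ * _).
have lt_q : (q < size w)%N := ltn_ord q; case E: (drop q w) => [|z u].
  by move/(congr1 size): E; rewrite size_drop /=; lia.
rewrite IHn //; move/(congr1 size): E; rewrite size_drop /=; lia.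
Qed.

Lemma flat_inverse_int y w : beta (y :: w) =
  ES v M (fun t => (-1) ^+ (nbS t).-1 * (intvS t)%:R) (y :: w).
Proof.
rewrite flat_inverse -sumrN /ES big_seq [RHS]big_seq; apply: eq_bigr => t /bsz_trs.
case: t => // b s _; rewrite -scaleNr; congr (_ *: _).
have E t : chr (fun b => - (flat b)%:R) t = (-1) ^+ nbS t * (intvS t)%:R :> K.
  elim: t => [|b' _ s' IHs]; first by rewrite /= mulr1.
  rewrite /= IHs; case fb: (flat b'); last by rewrite oppr0 mul0r mulr0.
  have /eqP -> : nbB b' == 1%N by rewrite nbB1.
  by rewrite exprS mulrA.
rewrite E -mulNr; congr (_ * _).
have : (0 < nbS (N b s))%N by rewrite /= addn_gt0 nbB_gt0.
by case: (nbS _) => // k _; rewrite exprS mulN1r opprK.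
Qed.

End Deconcatenation.

Section PatchedCumulants.
Variables (K : fieldType) (A B : algType K) (v : {lrmorphism B -> A}).

Lemma evS_ext (f g : seq A -> B) t w : f =1 g -> evS v f t w = evS v g t w.
Proof. by move=> fg; apply: ev_agree => u _; apply: fg. Qed.

Lemma ES_ext (f g : seq A -> B) G w :
  (forall u, u <> [::] -> f u = g u) -> ES v f G w = ES v g G w.
Proof.
move=> fg; apply: eq_bigr => t _; congr (_ *: _); apply: ev_agree => u /andP[u0 _].
by apply: fg => u1; rewrite u1 in u0.
Qed.

(** The formula does not see the value at the empty word; prescribing it allows an equality of
    functions with a given family. *)
Lemma exists_cumulant (M : seq A -> B) (c : bt -> K) (b0 : B) :
  good v M -> M [::] = 1 -> c L = 1 -> (forall n, c (N (comb n) L) = 1) ->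
  exists f, [/\ good v f, f [::] = b0 & ES v f c =1 M].
Proof.
move=> Mgood M0 cL c1; have [cs cl cr] := cumulant_good c Mgood.
exists (fun w => if w is [::] then b0 else cumulant v M c w); split=> //.
  split=> [p q y z d cd|d y q|p y d]; last by have := cr p y d; case: p.
    by have := cs p q y z d cd; case: p.
  exact: cl.
move=> w; rewrite (ES_ext _ (g := cumulant v M c)); last by case.
by case: w => [|y w]; rewrite ?ES_nil ?cL ?scale1r ?M0 // -cumulantP.
Qed.

End PatchedCumulants.

Lemma chr_one (R : pzSemiRingType) t : chr (fun=> 1) t = 1 :> R.
Proof. by elim: t => //= b _ s ->; rewrite mulr1. Qed.

Lemma chr_flat (R : pzSemiRingType) t : chr (fun b => (flat b)%:R) t = (intvS t)%:R :> R.
Proof. by elim: t => //= b _ s ->; rewrite -natrM mulnb. Qed.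

Lemma chr_hwt1 (K : fieldType) t : chr (hwt 1) t = (tauS t)%:R^-1 :> K.
Proof.
elim: t => [|b _ s IHs] /=; first by rewrite invr1.
by rewrite IHs /hwt expr1n natrM invfM mul1r.
Qed.

Section DualLevel.
Variables (K : fieldType) (A : algType K) (SB : {pred A}) (B : subAlgType SB).
Let v : {lrmorphism B -> A} := @emb K A SB B.
Let vd := dual_map v.

Lemma eq_dext (f g df dg : seq A -> B) n (pi : {set {set 'I_n}}) (x : n.-tuple A) :
  f =1 g -> df =1 dg -> dext f df pi x = dext g dg pi x.
Proof.
move=> fg dfg; apply: eq_bigr => V _.
apply: (ext_word_agree (N := n.+1)); first by move=> W u _; case: ifP.
- by rewrite size_map size_enum_ord.
- by rewrite size_tuple.
by rewrite size_tuple ltnSn orbT.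
Qed.

Lemma big_subNC (V : lmodType K) n (Q : {set {set {set 'I_n}}}) (a : {set {set 'I_n}} -> K)
    (X : {set {set 'I_n}} -> V) : Q \subset NC n ->
  \sum_(pi in Q) a pi *: X pi = \sum_(pi in NC n) ((pi \in Q)%:R * a pi) *: X pi.
Proof.
move=> /subsetP QN; rewrite big_mkcond [RHS]big_mkcond; apply: eq_bigr => pi _.
case: ifP => [/QN ->|_]; first by rewrite mul1r.
by rewrite mul0r scale0r if_same.
Qed.

Section Family.
Variable f : seq (dual A) -> dual B.
Hypothesis fgood : good vd f.
Variables (n : nat) (n0 : (0 < n)%N) (x : n.-tuple A).
Let w := map (@inj K A) x.
Let sw : size w = n. Proof. by rewrite size_map size_tuple. Qed.
Implicit Type a : {set {set 'I_n}} -> K.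

Lemma sum_ext_dual a : \sum_(pi in NC n) a pi *: ext (part1 f) pi x =
  (ES vd f (fun t => a (part_of n t)) w).1.
Proof.
rewrite big_NC /ES dual_sum1 sw big_seq [RHS]big_seq; apply: eq_bigr => t /bsz_trs tn.
by rewrite dualZ1 ext_dual.
Qed.

Lemma sum_dext_dual a : \sum_(pi in NC n) a pi *: dext (part1 f) (part2 f) pi x =
  (ES vd f (fun t => a (part_of n t)) w).2.
Proof.
rewrite big_NC /ES dual_sum2 sw big_seq [RHS]big_seq; apply: eq_bigr => t /bsz_trs tn.
by rewrite dualZ2 dext_dual.
Qed.

Lemma sum_irr_dual a : \sum_(pi in NCirr n) a pi *: dext (part1 f) (part2 f) pi x =
  (EB vd f (fun b => a (part_of n (N b L))) w).2.
Proof.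
rewrite big_subNC; last by apply/subsetP => pi /[!inE] /andP[].
rewrite sum_dext_dual; congr (_ .2); rewrite /ES /EB sw.
rewrite big_seq (eq_bigr (fun t => ((irrS t)%:R * a (part_of n t)) *: evS vd f t w)); last first.
  by move=> t /bsz_trs tn; rewrite NCirr_part_of.
rewrite -big_seq; move: (w) sw => u su; case: n n0 a su => // m _ a' su; rewrite big_trsS big_ord_recr /= subnn.
rewrite [X in X + _ = _]big1 ?add0r => [|q _].
  rewrite big_seq [RHS]big_seq; apply: eq_bigr => b /bsz_trs bm.
  by rewrite big_seq1 /= bm mul1r mulr1 take_oversize // su.
rewrite big1 // => b _; rewrite big_seq big1 // => s /bsz_trs sq.
case: s sq => [|? ?] //=; last by rewrite mul0r scale0r.
by have := ltn_ord q; lia.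
Qed.

End Family.

Variables (E E' : {linear A -> B}).
Hypothesis hE : ov_inf_prob_space E E'.

Definition dualE (a : dual A) : dual B := (E a.1, E' a.1 + E a.2).
Definition dualM (w : seq (dual A)) : dual B := dualE (\prod_(a <- w) a).

Lemma E_left b a : E (val b * a) = b * E a.
Proof. by have := ov_E_bimod hE a b 1; rewrite rmorph1 !mulr1. Qed.
Lemma E_right b a : E (a * val b) = E a * b.
Proof. by have := ov_E_bimod hE a 1 b; rewrite rmorph1 !mul1r. Qed.
Lemma E'_left b a : E' (val b * a) = b * E' a.
Proof. by have := ov_E'_bimod hE a b 1; rewrite rmorph1 !mulr1. Qed.
Lemma E'_right b a : E' (a * val b) = E' a * b.
Proof. by have := ov_E'_bimod hE a 1 b; rewrite rmorph1 !mul1r. Qed.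

Lemma dualE_left b a : dualE (vd b * a) = b * dualE a.
Proof.
apply: dual_eqP; rewrite /dualE ?dualM1 ?dualM2; first exact: E_left.
rewrite linearD /= E_left E'_left E_left mulrDr -!addrA; congr (_ + _).
Qed.

Lemma dualE_right b a : dualE (a * vd b) = dualE a * b.
Proof.
apply: dual_eqP; rewrite /dualE ?dualM1 ?dualM2; first exact: E_right.
by rewrite linearD /= !E_right E'_right mulrDl addrCA.
Qed.

Lemma dualED a b : dualE (a + b) = dualE a + dualE b.
Proof.
by apply: dual_eqP; rewrite /= ?linearD // addrACA.
Qed.

Lemma dualM_good : good vd dualM.
Proof.
split=> [p q y z c [cb ca]|b y q|p y b]; rewrite /dualM.
- rewrite !big_cat !big_cons /= -dualE_right -dualED; congr dualE.
  by rewrite mulrDl mulrDr -!mulrA ca.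
- by rewrite !big_cons -mulrA dualE_left.
by rewrite -!cats1 !big_cat !big_seq1 /= -dualE_right mulrA.
Qed.

Lemma dualM_nil : dualM [::] = 1.
Proof.
rewrite /dualM big_nil; apply: dual_eqP; rewrite /= ?(ov_E'1 hE) ?linear0 ?addr0 //.
by have := ov_E_id hE 1; rewrite rmorph1.
Qed.

Lemma prod_inj (x : seq A) : \prod_(a <- map (@inj K A) x) a = inj (\prod_(a <- x) a).
Proof. by elim: x => [|a x IHx]; rewrite ?big_nil // !big_cons IHx injM. Qed.

Lemma part1_dualM : part1 dualM =1 moments E.
Proof. by move=> x; rewrite /part1 /dualM prod_inj. Qed.

Lemma part2_dualM : part2 dualM =1 moments E'.
Proof. by move=> x; rewrite /part2 /dualM prod_inj /= linear0 addr0. Qed.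

(** Over the dual numbers [f] is obtained from its moments by Moebius inversion, and the
    eps-component of that formula is the definition of [dfree]. *)
Lemma free_part2 f : good vd f -> ES vd f (chr (fun=> 1)) =1 dualM ->
  forall y x, part2 f (y :: x) = dfree E E' (y :: x).
Proof.
move=> fgood fM y x0; set x := y :: x0; set n := size x.
pose xt : n.-tuple A := in_tuple x.
have n0 : (0 < n)%N by [].
have [fs fl fr] := fgood.
rewrite /dfree -/n.
under eq_bigr do rewrite -(eq_dext _ _ part1_dualM part2_dualM).
rewrite (sum_dext_dual dualM_good n0 xt (fun pi => (Mob pi (one_part n))%:~R)) /part2.
set w := map (@inj K A) xt; congr (_ .2).
have sw : size w = n by rewrite size_map.
transitivity (\sum_(t <- trs n) \sum_(s <- trs n)
   ((Mob (part_of n t) (one_part n))%:~R * (refines (part_of n s) (part_of n t))%:R)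
   *: evS vd f s w); last first.
  rewrite /ES sw big_seq [RHS]big_seq; apply: eq_bigr => t /bsz_trs tn.
  have -> : evS vd dualM t w = evS vd (ES vd f (fun=> 1)) t w.
    by apply: evS_ext => u; rewrite -fM; apply: eq_ES => s; rewrite chr_one.
  rewrite -((Q_wd fs fr t).1 0%N) ?sw ?tn // /Q sw scaler_sumr.
  rewrite big_seq [RHS]big_seq; apply: eq_bigr => s /bsz_trs sn.
  by rewrite scalerA (refines_part_of sn tn).
rewrite exchange_big /=.
(* After the exchange of sums, the coefficient of the partition [s] is the sum of Mob(pi, 1_n) over
   pi >= [s]. *)
have E1 s : bsz s = n -> \sum_(t <- trs n)
   ((Mob (part_of n t) (one_part n))%:~R * (refines (part_of n s) (part_of n t))%:R)
   = (part_of n s == one_part n)%:R :> K.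
  move=> sn; rewrite -(big_NC (fun pi => (Mob pi (one_part n))%:~R * (refines (part_of n s) pi)%:R)).
  have := mobius_suml (@refines_refl n) (@refines_anti n) (@refines_trans n)
    (part_of_NC sn) (one_part_NC n0).
  move/(congr1 (fun i : int => i%:~R : K)); rewrite rmorph_sum /= => Em.
  rewrite (_ : (_ == _)%:R = ((part_of n s == one_part n)%:R : int)%:~R); last by case: (_ == _).
  rewrite -Em big_mkcondr; apply: eq_bigr => pi _.
  by rewrite refines_one_part andbT; case: refines; rewrite ?mulr1 ?mulr0.
rewrite big_seq (eq_bigr (fun s => (part_of n s == one_part n)%:R *: evS vd f s w)); last first.
  by move=> s /bsz_trs sn; rewrite -scaler_suml E1.
rewrite -big_seq big_trs_comb part_of_comb eqxx scale1r evS_comb //.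
rewrite big_seq_cond big1 ?addr0 // => s /andP[/bsz_trs sn ne].
case: eqP => [Es|_]; last by rewrite scale0r.
by case/eqP: ne; apply: (part_of_inj sn); rewrite ?part_of_comb //= bsz_comb addn0.
Qed.

Lemma boolean_part2 f : ES vd f (chr (fun b => (flat b)%:R)) =1 dualM ->
  forall y x, part2 f (y :: x) = dboolean E E' (y :: x).
Proof.
move=> fM y x0; set x := y :: x0; set n := size x.
pose xt : n.-tuple A := in_tuple x.
have n0 : (0 < n)%N by [].
rewrite /dboolean -/n.
under eq_bigr do rewrite -(eq_dext _ _ part1_dualM part2_dualM).
rewrite big_subNC; last by apply/subsetP => pi /[!inE] /andP[].
rewrite (sum_dext_dual dualM_good n0 xt (fun pi => (pi \in NCint n)%:R * (-1) ^+ (#|pi|).-1)).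
rewrite /part2; congr (_ .2); rewrite [LHS](flat_inverse_int vd).
rewrite (ES_ext _ _ (g := dualM)) //.
rewrite /ES size_map big_seq [RHS]big_seq; apply: eq_bigr => t /bsz_trs tn.
by rewrite NCint_part_of // card_part_of // mulrC.
Qed.

(** [f] is known only through the formula for [E]. The family over the dual numbers is built from
    [dualM], and uniqueness identifies its first component with [f]. *)
Lemma dual_cumulants (cP : forall n, {set {set 'I_n}} -> K) (c : bt -> K)
    (f : seq A -> B) (df0 : B) :
  (forall n t, bsz t = n -> cP n (part_of n t) = c t) ->
  c L = 1 -> (forall n, c (N (comb n) L) = 1) ->
  (forall n (x : n.-tuple A), (0 < n)%N ->
     moments E x = \sum_(pi in NC n) cP n pi *: ext f pi x) ->
  exists fd, [/\ good vd fd, ES vd fd c =1 dualM, f =1 part1 fd, part2 fd [::] = df0 &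
    forall n (x : n.-tuple A), (0 < n)%N ->
      moments E' x = \sum_(pi in NC n) cP n pi *: dext f (part2 fd) pi x].
Proof.
move=> cPc cL c1 fE.
have [fd [fgood f0 fM]] := exists_cumulant (v := vd) ((f [::], df0) : dual B)
  dualM_good dualM_nil cL c1.
have ES_c n (x : n.-tuple A) : ES vd fd (fun t => cP n (part_of n t)) (map (@inj K A) x) =
    dualM (map (@inj K A) x).
  rewrite -fM /ES size_map size_tuple big_seq [RHS]big_seq.
  by apply: eq_bigr => t /bsz_trs tn; rewrite cPc.
have fE1 : f =1 part1 fd.
  apply: (ext_unique (c := cP)); last 1 first.
  - by move=> n x n0; rewrite -fE // (sum_ext_dual fgood n0 x (cP n)) ES_c -part1_dualM.
  - by move=> n; rewrite -part_of_comb cPc //= bsz_comb addn0.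
  - by rewrite /part1 f0.
exists fd; split=> // [|n x n0]; first by rewrite /part2 f0.
under eq_bigr do rewrite (eq_dext _ _ fE1 (frefl _)).
by rewrite (sum_dext_dual fgood n0 x (cP n)) ES_c -part2_dualM.
Qed.

End DualLevel.

Lemma eq_EB_trs (K : fieldType) (A B : algType K) (v : {lrmorphism B -> A}) f a a' n w :
  size w = n.+1 -> (forall b, bsz b = n -> a b = a' b) -> EB v f a w = EB v f a' w.
Proof.
move=> sw aa'; rewrite /EB sw big_seq [RHS]big_seq.
by apply: eq_bigr => b /bsz_trs /aa' ->.
Qed.

Theorem theorem1p4 (K : fieldType) (charK0 : [pchar K] =i pred0)
  (A : algType K) (SB : {pred A}) (B : subAlgType SB)
  (E E' : {linear A -> B}) (hE : ov_inf_prob_space E E')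
  (r beta h dh : seq A -> B)
  (hr : free_cumulants E r)
  (hbeta : boolean_cumulants E beta)
  (hh : monotone_cumulants E h)
  (hdh : monotone_inf_cumulants E' h dh)
  (n : nat) (hn : (0 < n)%N) (x : n.-tuple A) :
  let dr := dfree E E' in
  let dbeta := dboolean E E' in
  [/\ dbeta x = \sum_(pi in NCirr n) dext r dr pi x
    & dr x = \sum_(pi in NCirr n) (-1) ^+ (#|pi|).-1 *: dext beta dbeta pi x]
  /\ [/\ dbeta x = \sum_(pi in NCirr n) (tau_fact pi)%:R^-1 *: dext h dh pi x
    & dr x = \sum_(pi in NCirr n)
        ((-1) ^+ (#|pi|).-1 / (tau_fact pi)%:R) *: dext h dh pi x]
  /\ [/\ dh x = \sum_(pi in NCirr n) omega K pi *: dext beta dbeta pi x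
    & dh x = \sum_(pi in NCirr n)
        ((-1) ^+ (#|pi|).-1 * omega K pi) *: dext r dr pi x].
Proof.
move=> dr dbeta.
pose v : {lrmorphism B -> A} := @emb K A SB B.
have tau_c k t : bsz t = k -> (tau_fact (part_of k t))%:R^-1 = chr (hwt 1) t :> K.
  by move=> tk; rewrite chr_hwt1 tau_part_of.
have comb_c k : chr (fun b => (flat b)%:R) (N (comb k) L) = 1 :> K.
  by rewrite /= flat_comb mulr1.
have comb_tau k : chr (hwt 1) (N (comb k) L) = 1 :> K.
  by rewrite chr_hwt1 /= tauB_flat ?flat_comb ?invr1.
(* The three formulas differ only in their weights on NC(n): 1, the indicator of interval
   partitions, and 1 / tau(pi)!. Values at the empty word are copied from the given families. *)
have [|||k y k0|rd [rgood rM rE r0 _]] := dual_cumulants hE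
    (cP := fun _ _ => 1) (c := chr (fun=> 1)) (f := r) (dr [::]) => //; try by move=> *; rewrite chr_one.
  by rewrite hr //; apply: eq_bigr => pi _; rewrite scale1r.
have [k t tk||||bd [bgood bM betaE b0 _]] := dual_cumulants hE
    (cP := fun k pi => (pi \in NCint k)%:R * 1) (c := chr (fun b => (flat b)%:R))
    (f := beta) (dbeta [::]) => //.
- by rewrite chr_flat NCint_part_of // mulr1.
- move=> k y k0; rewrite -(big_subNC (fun=> 1)); last by apply/subsetP => pi /[!inE] /andP[].
  by rewrite hbeta //; apply: eq_bigr => pi _; rewrite scale1r.
have [hd [hgood hM hEq h0 hE2]] := dual_cumulants hE (dh [::]) tau_c erefl comb_tau hh.
(* [dh] is defined by recursion and is identified by uniqueness, whereas [dr] and [dbeta] are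
   matched through their explicit sums. *)
have dhE : dh =1 part2 hd.
  apply: (@dext_unique K A SB B (fun k pi => (tau_fact pi)%:R^-1) _ h) => [k||k y k0].
  - by rewrite -part_of_comb tau_c ?comb_tau //= bsz_comb addn0.
  - by rewrite h0.
  by rewrite -(hdh k y k0) -hE2.
have drE : dr =1 part2 rd.
  by case=> [|y w]; rewrite ?r0 ?(free_part2 hE rgood rM).
have dbE : dbeta =1 part2 bd.
  by case=> [|y w]; rewrite ?b0 ?(boolean_part2 hE bM).
have [[rs _ rr] [bs _ br] [hs _ hr']] := And3 rgood bgood hgood.
have rb : ES (dual_map v) rd (chr (fun=> 1)) =1 ES (dual_map v) bd (chr (fun b => (flat b)%:R)).
  by move=> w; rewrite rM bM.
have bh : ES (dual_map v) bd (chr (fun b => (flat b)%:R)) =1 ES (dual_map v) hd (chr (hwt 1)).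
  by move=> w; rewrite bM hM.
case: n hn x => // m _ x.
have [y [w xE]] : exists y w, tval x = y :: w by case/tupleP: x => y w; exists y, w.
have sw : size (map (@inj K A) w) = m.
  by rewrite size_map; have := size_tuple x; rewrite xE => -[].
(* Each right side of the theorem is thus the eps-component of a sum over components, to which the
   relations over the dual numbers apply. *)
have irr a (f : seq (dual A) -> dual B) (g dg : seq A -> B) (c : bt -> K) :
    good (dual_map v) f -> g =1 part1 f -> dg =1 part2 f ->
    (forall b, bsz b = m -> a (part_of m.+1 (N b L)) = c b) ->
    \sum_(pi in NCirr m.+1) a pi *: dext g dg pi x =
    (EB (dual_map v) f c (inj y :: map (@inj K A) w)).2.
  move=> fgood gE dgE ac; under eq_bigr do rewrite (eq_dext _ _ gE dgE).
  rewrite sum_irr_dual // xE; congr (_.2); apply: (@eq_EB_trs K (dual A : algType K) (dual B : algType K) (dual_map v) f _ _ m) => //=.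
  by rewrite sw.
have [R1 R2 R3 R4] := relations charK0 rs rr bs br hs hr' rb bh (inj y) (map (@inj K A) w).
pose W j b : K := (omega_k (part_of m.+1 (N b L)) j)%:R.
have OW k b : (k <= m.+1)%N -> bsz b = m ->
    (OB k b)%:R = \sum_(j < m.+2) 'C(k, j)%:R * W j b.
  by move=> km bm; apply: OB_omega.
have [R5 R6] := relations_omega charK0 rs rr bs br hs hr' rb bh (inj y) sw OW.
have snl b : bsz b = m -> bsz (N b L) = m.+1 by move=> /= ->; rewrite addn0.
have cardE b : bsz b = m -> #|part_of m.+1 (N b L)| = nbB b.
  by move=> /snl /card_part_of ->; rewrite /= addn0.
have tauE b : bsz b = m -> tau_fact (part_of m.+1 (N b L)) = tauB b 0.
  by move=> /snl /tau_part_of ->; rewrite /= muln1.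
rewrite dbE drE dhE xE.
rewrite -[part2 bd _]/((bd (inj y :: map (@inj K A) w)).2).
rewrite -[part2 rd _]/((rd (inj y :: map (@inj K A) w)).2).
rewrite -[part2 hd _]/((hd (inj y :: map (@inj K A) w)).2).
split; last split; split.
- rewrite R1 -(irr (fun=> 1) rd r dr) //.
  by apply: eq_bigr => pi _; rewrite scale1r.
- by rewrite R2 -(irr (fun pi => (-1) ^+ (#|pi|).-1) bd beta dbeta) // => b /cardE ->.
- by rewrite R3 -(irr (fun pi => (tau_fact pi)%:R^-1) hd h dh) // => b /tauE ->.
- rewrite R4 -(irr (fun pi => (-1) ^+ (#|pi|).-1 / (tau_fact pi)%:R) hd h dh) //.
  by move=> b bm; rewrite cardE // tauE.
- by rewrite R5 -(irr (omega K (n := m.+1)) bd beta dbeta).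
rewrite R6 -(irr (fun pi => (-1) ^+ (#|pi|).-1 * omega K pi) rd r dr) //.
by move=> b bm; rewrite cardE.
Qed.
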